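(* Let $\mathbb X^{(1)},\mathbb X^{(2)}$ be independent $\Omega_T^p$-valued random variables and assume there exist $q>1$, $M>0$ and an increasing $g:\mathbb R\to\mathbb R$ with $g(0)=0$ such that for all $0\le s<t\le T$ $$\max\Big\{\mathbb E\big[\|\mathbb X^{(2)}\|^q_{1/p\text{-Höl};[0,T]}\big],\ \mathbb E\big[\|\mathbb X^{(1)}\|^q_{1/p\text{-Höl};[0,T]}\big]\Big\}\le M,\qquad \mathbb E\big[d_{p\text{-var};[s,t]}(\mathbb X^{(2)},\mathbb X^{(1)})\big]\ge g(|t-s|).$$ Let $0<\delta<1$, $\varepsilon\in(0,1/2)$, and let $\theta\in[0,T]$ be any fixed realization of the change-point. Let $l^{(1)}\in T((\mathbb R^{1+d})^* )$ be a detector coefficient for $(\varepsilon,\delta)$ (as defined in the context). Let $\mathbb X^1,\dots,\mathbb X^R$ be $R$ independent observed paths sharing this common $\theta$, i.e. concatenations at $\theta$ of independent copies $(\mathbb X^{(1),i},\mathbb X^{(2),i})$ of $(\mathbb X^{(1)},\mathbb X^{(2)})$. Put $$\bar S^R_t=\frac1R\sum_{i=1}^R\mathbf 1_{\{\sup_{s\in[0,t]}|\langle l^{(1)},\widehat{\mathbb X}^{i,<\infty}_{0,s}\rangle|>1\}},\qquad \tilde\tau=\inf\{t:\bar S^R_t>\alpha\}\wedge T.$$ Then for $\varepsilon<\alpha<1-\varepsilon$, $$\mathbb P\big((\tilde\tau-\theta)^+\le g^{-1}(1+\delta)\big)\ge1-\exp\big(-2R(1-\varepsilon-\alpha)^2\big),$$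 $$\mathbb P(\tilde\tau<\theta)\le\exp\big(-2R(\alpha-\varepsilon)^2\big).$$ Furthermore, $$\mathbb E[(\tilde\tau-\theta)^+]\le g^{-1}(1+\delta)+T\exp\big(-2R(1-\varepsilon-\alpha)^2\big),$$ $$\mathbb E|\tilde\tau-\theta|\le g^{-1}(1+\delta)+T\big[\exp(-2R(1-\varepsilon-\alpha)^2)+\exp(-2R(\alpha-\varepsilon)^2)\big].$$ Here $g^{-1}(y)=\inf\{x\in\mathbb R:g(x)\ge y\}$.
   Context: Rough paths. Fix $d\ge1$, $p\ge1$, $T>0$, $N=\lfloor p\rfloor$. $G^N(\mathbb R^d)$ is the free step-$N$ nilpotent group inside the truncated tensor algebra, with product $\otimes$ and identity $\mathbf 1$; $S_N(x)_{s,t}$ is the step-$N$ truncated signature (iterated integrals) of a continuous bounded variation path $x$ over $[s,t]$. The Carnot–Carathéodory norm is $\|g\|_{CC}=\inf\{\text{length}(\gamma):\gamma\in C^{1\text{-var}}([0,1],\mathbb R^d),\ S_N(\gamma)_{0,1}=g\}$ and $d_{CC}(g,h)=\|g^{-1}\otimes h\|_{CC}$. For continuous $\mathbb X,\mathbb Y:[0,T]\to G^N(\mathbb R^d)$ started at $\mathbf 1$: $\mathbb X_{s,t}:=\mathbb X_s^{-1}\otimes\mathbb X_t$; $d_{p\text{-var};[s,t]}(\mathbb X,\mathbb Y)=\big(\sup_{\mathcal D\subset[s,t]}\sum_i d_{CC}(\mathbb X_{t_i,t_{i+1}},\mathbb Y_{t_i,t_{i+1}})^p\big)^{1/p}$ over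 partitions $\mathcal D$ of $[s,t]$; $\|\mathbb X\|_{1/p\text{-Höl};[0,T]}=\sup_{0\le s<t\le T}\|\mathbb X_{s,t}\|_{CC}/|t-s|^{1/p}$. A geometric $p$-rough path is such a path $\mathbb X$ with finite homogeneous $p$-variation for which there are bounded variation paths $x^m$ with $d_{p\text{-var};[0,T]}(S_N(x^m),\mathbb X)\to0$; their set is $\Omega_T^p$. Time augmentation and signature. $\widehat\Omega_T^p$ is the closure, in the homogeneous $p$-variation distance, of the step-$\lfloor p\rfloor$ lifts of paths $(t,x_t)\in\mathbb R^{1+d}$ with $x$ of bounded variation; $\widehat{\mathbb X}\in\widehat\Omega_T^p$ is the time-augmented version of $\mathbb X$. By Lyons' extension theorem it has a unique full signature $\widehat{\mathbb X}^{<\infty}_{0,t}\in T((\mathbb R^{1+d}))=\prod_n(\mathbb R^{1+d})^{\otimes n}$ (group-like, truncations of finite $p$-variation, agreeing with $\widehat{\mathbb X}$ up to level $\lfloor p\rfloor$). $T((\mathbb R^{1+d})^* )=\bigoplus_{n\ge0}((\mathbb R^{1+d})^* )^{\otimes n}$ and $\langle l,\mathbf a\rangle=\sum_n\langle l^{(n)},a_n\rangle$. Observation model. The laws $\mu_1,\mu_2$ of $\mathbb X^{(1)},\mathbb X^{(2)}$ are distinct. The concatenation (observed path) at $\theta$ is $\mathbb X_{0,t}=\mathbf 1_{\{t<\theta\}}\mathbb X^{(1)}_{0,t}+\mathbf 1_{\{t\ge\theta\}}\,(\mathbb X^{(1)}_{0,\theta}\otimes\mathbb X^{(2)}_{\theta,t})$,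 $t\in[0,T]$; each $\mathbb X^i$ is built in this way from $(\mathbb X^{(1),i},\mathbb X^{(2),i})\sim\mu_1\otimes\mu_2$. Probabilities and expectations are for the fixed $\theta$. Detector coefficient. For given $\varepsilon,\delta$ (and the fixed $\theta$, with $\mathbb X$ the corresponding observed path) a detector coefficient is an $l^{(1)}\in T((\mathbb R^{1+d})^* )$ such that (a) $\mathbb P\big(\sup_{t\in[0,T]}|\langle l^{(1)},\widehat{\mathbb X}^{(1),<\infty}_{0,t}\rangle|\le\delta\big)\ge1-\varepsilon$; (b) $\mathbb P\big(\sup_{s\in[0,t]}|\langle l^{(1)},\widehat{\mathbb X}^{<\infty}_{0,s}\rangle|\ge g((t-\theta)^+)-\delta\big)\ge1-\varepsilon$ for all $t\in[0,T]$; (c) with a constant $c$ depending only on $T,p,q$ and with $1/q+1/m=1$, $\mathbb E\big[|\langle l^{(1)},\widehat{\mathbb X}^{<\infty}_{0,t}\rangle|\big]\ge g((t-\theta)^+)-\delta(1-\varepsilon)-cM^{1/q}\varepsilon^{1/m}$ for all $t\in[0,T]$. (The paper asserts that, for any $\varepsilon,\delta>0$, a coefficient with these properties exists whenever $\mathbb X^{(1)},\mathbb X^{(2)}$ are independent and $\Omega_T^p$-valued, $\mathbb X$ is their concatenation at $\theta$ given above, and there exist $q>1$, $M>0$ and an increasing $g:\mathbb R\to\mathbb R$ with $g(0)=0$ such that $\mathbb E\big[\|\mathbb X^{(i)}\|^q_{1/p\text{-Höl};[0,T]}\big]\le M$ for $i=1,2$ and $\mathbb E\big[d_{p\text{-var};[s,t]}(\mathbb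 X^{(2)},\mathbb X^{(1)})\big]\ge g(|t-s|)$ for all $0\le s<t\le T$.) Convention: $\inf\emptyset=+\infty$. *)

(* Defs.v *)
From HB Require Import structures.
From mathcomp Require Import all_boot all_order all_algebra finmap.
From mathcomp Require Import all_classical all_reals all_analysis.
Import Order.TTheory GRing.Theory Num.Theory.
Import numFieldNormedType.Exports.

Set Implicit Arguments.
Unset Strict Implicit.
Unset Printing Implicit Defensive.

Local Open Scope classical_set_scope.
Local Open Scope ring_scope.

(* Conventions.  A tensor series over R^d is the family of its coordinates,
   indexed by words over the alphabet 'I_d; the truncated tensor algebra of
   step N is the set of series vanishing on the words of length > N, its
   product being the truncation of the product of series.  Paths are functions
   on R of which only the restriction to the relevant interval matters. *)

Definition tseries (R : realType) (d : nat) := seq 'I_d -> R.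

Section Tensor.
Variables (R : realType) (d : nat).
Implicit Types (a b : tseries R d) (u v w : seq 'I_d).

Definition tone : tseries R d := fun w => (w == [::])%:R.

Definition tmul a b : tseries R d :=
  fun w => \sum_(k < (size w).+1) a (take k w) * b (drop k w).

(* Neumann series \sum_k (1 - a)^k; it is the inverse of a when a [::] = 1, and
   then only the powers k <= |w| contribute to the coordinate w. *)
Definition tinv a : tseries R d :=
  fun w => \sum_(k < (size w).+1)
    iter k (tmul (fun v => tone v - a v)) tone w.

Definition ttrunc (N : nat) a : tseries R d :=
  fun w => if (size w <= N)%N then a w else 0.

End Tensor.

Arguments tone {R d}.

(* The shuffles of u and v, listed with multiplicity. *)
Fixpoint shuffle (A : Type) (u : seq A) : seq A -> seq (seq A) :=
  match u with
  | [::] => fun v => [:: v]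
  | i :: u' =>
      fix aux (v : seq A) : seq (seq A) :=
        match v with
        | [::] => [:: u]
        | j :: v' => map (cons i) (shuffle u' v) ++ map (cons j) (aux v')
        end
  end.

Section Group.
Variables (R : realType) (d : nat).

Definition group_like (a : tseries R d) : Prop :=
  a [::] = 1 /\
  forall u v : seq 'I_d, a u * a v = \sum_(w <- shuffle u v) a w.

Definition free_nilpotent_group (N : nat) : set (tseries R d) :=
  [set ttrunc N a | a in group_like].

End Group.

(* Sum of F t_i t_(i+1) over the points of a :: s, where itv_partition a b s
   says that a :: s is a partition of [a, b]. *)
Definition partition_sum (R : realType) (a : R) (s : seq R)
    (F : R -> R -> \bar R) : \bar R :=
  (\sum_(i < size s) F (nth a (a :: s) i) (nth a s i))%E.

Section RiemannStieltjes.
Variable R : realType.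
Implicit Types (f g : R -> R) (a b : R).

Definition mesh_lt a (s : seq R) (e : R) : Prop :=
  forall i, (i < size s)%N -> nth a s i - nth a (a :: s) i < e.

Definition tags_of a (s : seq R) (xi : nat -> R) : Prop :=
  forall i, (i < size s)%N -> nth a (a :: s) i <= xi i <= nth a s i.

Definition RS_sum f g a (s : seq R) (xi : nat -> R) : R :=
  \sum_(i < size s) f (xi i) * (g (nth a s i) - g (nth a (a :: s) i)).

Definition is_RS_integral f g a b (I : R) : Prop :=
  forall e, 0 < e -> exists2 h, 0 < h &
    forall (s : seq R) (xi : nat -> R),
      itv_partition a b s -> mesh_lt a s h -> tags_of a s xi ->
      `|RS_sum f g a s xi - I| < e.

(* 0 if the integral does not exist, which cannot happen for f, g continuous
   and g of bounded variation. *)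
Definition RS_integral f g a b : R := xget 0 (is_RS_integral f g a b).

End RiemannStieltjes.

Section BoundedVariation.
Variables (R : realType) (d : nat).
Implicit Types (x : R -> 'rV[R]_d) (s t : R).

Definition euclidean_norm (v : 'rV[R]_d) : R :=
  Num.sqrt (\sum_i (v ord0 i) ^+ 2).

Definition path_length s t x : \bar R :=
  ereal_sup [set partition_sum s D
                   (fun u v => (euclidean_norm (x v - x u))%:E)
            | D in itv_partition s t].

Definition bv_path s t : set (R -> 'rV[R]_d) :=
  [set x | {within `[s, t], continuous x} /\ (path_length s t x < +oo)%E].

(* rw is the word read backwards: the last letter is integrated last. *)
Fixpoint iterated_integral x s (rw : seq 'I_d) : R -> R :=
  match rw with
  | [::] => fun=> 1
  | i :: rw' => fun t =>
      RS_integral (iterated_integral x s rw') (fun u => x u ord0 i) s t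
  end.

Definition signature x s t : tseries R d :=
  fun w => iterated_integral x s (rev w) t.

Definition lift_path (N : nat) x : R -> tseries R d :=
  fun t => ttrunc N (signature x 0 t).

End BoundedVariation.

Section RoughPaths.
Variables (R : realType) (d : nat).
Implicit Types (N : nat) (p s t T : R) (X Y : R -> tseries R d).

Definition cc_norm N (g : tseries R d) : \bar R :=
  ereal_inf [set path_length 0 1 x
            | x in [set x | bv_path 0 1 x /\ ttrunc N (signature x 0 1) = g]].

Definition cc_dist N (g h : tseries R d) : \bar R :=
  cc_norm N (ttrunc N (tmul (tinv g) h)).

Definition incr N X s t : tseries R d := ttrunc N (tmul (tinv (X s)) (X t)).

Definition pvar_norm N p s t X : \bar R :=
  (ereal_sup [set partition_sum s D (fun u v => cc_norm N (incr N X u v) `^ p)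
             | D in itv_partition s t] `^ p^-1)%E.

Definition pvar_dist N p s t X Y : \bar R :=
  (ereal_sup [set partition_sum s D
                    (fun u v => cc_dist N (incr N X u v) (incr N Y u v) `^ p)
             | D in itv_partition s t] `^ p^-1)%E.

Definition holder_norm N p T X : \bar R :=
  ereal_sup [set (cc_norm N (incr N X st.1 st.2)
                    * ((st.2 - st.1) `^ p^-1)^-1%:E)%E
            | st in [set st : R * R | 0 <= st.1 /\ st.1 < st.2 /\ st.2 <= T]].

Definition group_path N T : set (R -> tseries R d) :=
  [set X | [/\ X 0 = tone,
               forall t, 0 <= t <= T -> free_nilpotent_group N (X t) &
               forall w, {within `[0, T], continuous (fun t => X t w)}]].

(* The paths of step floor(p) that are limits in homogeneous p-variation of
   lifts of paths in C. *)
Definition pvar_closure p T (C : set (R -> 'rV[R]_d)) :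
    set (R -> tseries R d) :=
  let N := Num.truncn p in
  [set X | group_path N T X /\
     exists2 x : nat -> R -> 'rV[R]_d, forall k, C (x k) &
       pvar_dist N p 0 T (lift_path N (x k)) X @[k --> \oo] --> (0 : \bar R)%E].

Definition geometric_rough_path p T : set (R -> tseries R d) :=
  [set X | pvar_closure p T (bv_path 0 T) X /\
           (pvar_norm (Num.truncn p) p 0 T X < +oo)%E].

Definition geometric_open p T : set (set (R -> tseries R d)) :=
  [set U | U `<=` geometric_rough_path p T /\
     forall X, U X -> exists2 e : R, 0 < e &
       forall Y, geometric_rough_path p T Y ->
         (pvar_dist (Num.truncn p) p 0 T X Y < e%:E)%E -> U Y].

(* Z_t stands for the full signature over [0, t] of the rough path X. *)
Definition full_signature p T X (Z : R -> tseries R d) : Prop :=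
  let N := Num.truncn p in
  [/\ Z 0 = tone,
      forall t, 0 <= t <= T -> group_like (Z t),
      forall t, 0 <= t <= T -> ttrunc N (Z t) = X t,
      forall w, {within `[0, T], continuous (fun t => Z t w)} &
      forall n, (N <= n)%N ->
        (pvar_norm n p 0 T (fun t => ttrunc n (Z t)) < +oo)%E].

Definition concatenation N (th : R) (X1 X2 : R -> tseries R d) :
    R -> tseries R d :=
  fun t => if t < th then incr N X1 0 t
           else ttrunc N (tmul (incr N X1 0 th) (incr N X2 th t)).

End RoughPaths.

(* The measurable space of paths: its trace on geometric_rough_path p T is the
   Borel sigma-algebra of the homogeneous p-variation distance. *)
Notation rough_space R d p T :=
  (g_sigma_algebraType (@geometric_open R d p T)).

Section TimeAugmentation.
Variables (R : realType) (d : nat).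

(* Time is the letter ord0 of 'I_d.+1; lift ord0 embeds the alphabet 'I_d. *)
Definition time_augment (x : R -> 'rV[R]_d) : R -> 'rV[R]_d.+1 :=
  fun t => \row_(j < d.+1) oapp (fun i => x t ord0 i) t (unlift ord0 j).

Definition augmented_rough_path (p T : R) : set (R -> tseries R d.+1) :=
  pvar_closure p T [set time_augment x | x in bv_path 0 T].

Definition time_augmentation (p T : R) (X : R -> tseries R d)
    (Xhat : R -> tseries R d.+1) : Prop :=
  augmented_rough_path p T Xhat /\
  forall t, 0 <= t <= T -> forall w, Xhat t (map (lift ord0) w) = X t w.

Definition augmented_signature (p T : R) (X : R -> tseries R d)
    (Z : R -> tseries R d.+1) : Prop :=
  exists2 Xhat, time_augmentation p T X Xhat & full_signature p T Xhat Z.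

End TimeAugmentation.

(* The algebraic direct sum of the tensor powers of the dual of R^d, in the
   dual basis. *)
Notation dual_tensor R d := ({fsfun seq 'I_d -> R with 0}).

Definition pairing (R : realType) (d : nat) (l : dual_tensor R d)
    (a : tseries R d) : R :=
  \sum_(w <- finsupp l) l w * a w.

Definition running_sup (R : realType) (d : nat) (l : dual_tensor R d)
    (Z : R -> tseries R d) (t : R) : \bar R :=
  ereal_sup [set `|pairing l (Z s)|%:E | s in `[0, t]%classic].

Section Probability.
Context (disp : measure_display) (Omega : measurableType disp) (R : realType)
  (P : probability Omega R).
Local Open Scope ereal_scope.

Definition same_law (disp' : measure_display) (E : measurableType disp')
    (X Y : Omega -> E) : Prop :=
  forall A : set E, measurable A -> P (X @^-1` A) = P (Y @^-1` A).

Definition independent2 (disp' : measure_display) (E : measurableType disp')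
    (X Y : Omega -> E) : Prop :=
  forall A B : set E, measurable A -> measurable B ->
    P ((X @^-1` A) `&` (Y @^-1` B)) = P (X @^-1` A) * P (Y @^-1` B).

Definition mutually_independent (I : finType) (disp' : measure_display)
    (E : measurableType disp') (X : I -> Omega -> E) : Prop :=
  forall (J : {set I}) (A : I -> set E), (forall i, measurable (A i)) ->
    P (\bigcap_(i in [set` J]) (X i @^-1` A i))
      = \prod_(i in J) P (X i @^-1` A i).

(* Z1 and Z are the full signatures of the time-augmentations of the pre-change
   path and of the observed path; c is the value at (T, p, q) of the constant
   of the last clause. *)
Definition detector_coefficient (d : nat) (T q M c : R) (g : R -> R)
    (eps delta theta : R) (Z1 Z : Omega -> R -> tseries R d)
    (l : dual_tensor R d) : Prop :=
  [/\ P [set o | running_sup l (Z1 o) T <= delta%:E] >= (1 - eps)%:E,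
      forall t : R, (0 <= t <= T)%R ->
        P [set o | running_sup l (Z o) t
                     >= (g (Num.max (t - theta) 0) - delta)%:E]
          >= (1 - eps)%:E &
      forall m : R, (q^-1 + m^-1 = 1)%R ->
      forall t : R, (0 <= t <= T)%R ->
        \int[P]_o `|pairing l (Z o t)|%:E
          >= (g (Num.max (t - theta) 0) - delta * (1 - eps)
                - c * M `^ q^-1 * eps `^ m^-1)%:E].

Definition exceedance_rate (d n : nat) (l : dual_tensor R d)
    (Z : 'I_n -> Omega -> R -> tseries R d) (t : R) (o : Omega) : R :=
  (n%:R^-1 * \sum_(i < n) \1_[set o | 1 < running_sup l (Z i o) t]%E o)%R.

(* Infimum in \bar R, so that inf set0 = +oo. *)
Definition detection_time (d n : nat) (T alpha : R) (l : dual_tensor R d)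
    (Z : 'I_n -> Omega -> R -> tseries R d) (o : Omega) : \bar R :=
  mine (ereal_inf [set t%:E | t in
          [set t : R | (0 <= t <= T)%R /\ (alpha < exceedance_rate l Z t o)%R]])
       T%:E.

End Probability.

Definition generalized_inverse (R : realType) (g : R -> R) (y : R) : \bar R :=
  ereal_inf [set x%:E | x in [set x : R | y <= g x]].

(* Main.v *)
Require Import Defs.
From HB Require Import structures.
From mathcomp Require Import all_boot all_order all_algebra finmap.
From mathcomp Require Import all_classical all_reals all_analysis.
From mathcomp Require Import measurable_realfun.
From mathcomp Require Import ring lra.
Import Order.TTheory GRing.Theory Num.Theory.
Import numFieldNormedType.Exports.

Set Implicit Arguments.
Unset Strict Implicit.
Unset Printing Implicit Defensive.

Local Open Scope classical_set_scope.
Local Open Scope ring_scope.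

(* All events must be shown to be measurable functions of the pairs
   (X^(1), X^(2)), although a signature Z of the augmented path is only known by
   its defining properties.  The key point is that
     Z_t = lim_n prod_(k <= n) E_k,  with  r_k = k t / (n + 1),
   where E_k has time coordinate r_(k+1) - r_k, agrees with the increment of X
   over [r_k, r_(k+1)] on the words without time letter, and vanishes on the
   other words: E_k differs from the increment of Z by a summably small error,
   because a word with at least two letters and a time letter among them has
   order o(r_(k+1) - r_k), and a word of length greater than p has order > 1 by
   finiteness of the p-variation.  Since X |-> X_t is continuous for the
   homogeneous p-variation distance, the running suprema are measurable
   functionals of X, and they depend on X only up to time t.  Hence the indicators
   averaged in the exceedance rate are independent Bernoulli variables, whose
   parameter is at least 1 - eps at the times theta + x with g x > 1 + delta, and
   at most eps at time theta, where the observed path still coincides with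
   X^(1).  Hoeffding's inequality bounds the probability that the rate stays below
   alpha up to such a time, respectively exceeds alpha at time theta. *)

(** * Tensor series *)

(** [Z], [Z1] and [W] are arbitrary pointwise choices of signatures, with no measurability in the
    sample point, whereas laws and independence speak only of measurable sets of pairs of paths.
    This forces an explicit functional of the pair, built from evaluations at countably many times.
    The delicate words in the product formula are those of length between 2 and floor(p) that
    contain the time letter: finite p-variation alone gives their increments order at most 1. The
    gain must come from the approximating lifts, whose lengths may explode in the limit. Hence the
    bound for their iterated integrals involves only t - s and the sizes of the two subwords around
    the time letter, and so survives the limit. On the probabilistic side, g may jump and exceedance
    is a strict inequality, so nothing is known at theta plus the delay itself. The missed-detection
    bound is proved at slightly later times and transferred by continuity of P from below.
    Hoeffding's bound is obtained by summing the weights of the sets of successes, so independence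
    enters only through probabilities of finite intersections. *)

Section TensorAlgebra.
Variables (R : realType) (d : nat).
Implicit Types (a b c : tseries R d) (w v : seq 'I_d).

Lemma tmul_nil a b : tmul a b [::] = a [::] * b [::].
Proof. by rewrite /tmul big_ord1. Qed.

Lemma tmul_cons a b i w :
  tmul a b (i :: w) = a [::] * b (i :: w) + tmul (fun v => a (i :: v)) b w.
Proof. by rewrite /tmul big_ord_recl. Qed.

Lemma tmulA a b c : tmul a (tmul b c) = tmul (tmul a b) c.
Proof.
have mulZl x e f v : tmul (fun u => x * e u) f v = x * tmul e f v.
  by rewrite /tmul mulr_sumr; apply: eq_bigr => k _; rewrite mulrA.
have mulDl e e' f v : tmul (fun u => e u + e' u) f v = tmul e f v + tmul e' f v.
  by rewrite /tmul -big_split /=; apply: eq_bigr => k _; rewrite mulrDl.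
apply/funext => w; elim: w a b => [|i w IH] a b; first by rewrite !tmul_nil mulrA.
rewrite !tmul_cons tmul_nil IH mulrDr mulrA -addrA; congr (_ + _).
under [in RHS](_ : (fun v => tmul a b (i :: v)) =
    (fun v => a [::] * b (i :: v) + tmul (fun u => a (i :: u)) b v)).
  by apply/funext => v; rewrite tmul_cons.
by rewrite mulDl mulZl.
Qed.

Lemma tmul1l a : tmul tone a = a.
Proof.
apply/funext => w; rewrite /tmul big_ord_recl take0 drop0 /tone eqxx mul1r.
rewrite big1 ?addr0// => k _; rewrite lift0.
case: w k => [|i w] k; first by case: k.
by rewrite /= mul0r.
Qed.

Lemma tmul1r a : tmul a tone = a.
Proof.
apply/funext => w; rewrite /tmul big_ord_recr /= take_size drop_size /tone eqxx mulr1.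
rewrite big1 ?add0r// => k _; have /negPf -> : drop k w != [::]; last by rewrite mulr0.
by rewrite -size_eq0 size_drop -lt0n subn_gt0.
Qed.

Lemma eq_tmul_le n a a' b b' :
  (forall v, (size v <= n)%N -> a v = a' v) ->
  (forall v, (size v <= n)%N -> b v = b' v) ->
  forall w, (size w <= n)%N -> tmul a b w = tmul a' b' w.
Proof.
move=> aa' bb' w wn; apply: eq_bigr => k _; rewrite aa' ?bb'//.
  by rewrite size_drop; apply: leq_trans wn; apply: leq_subr.
by rewrite size_take_min; apply: leq_trans wn; apply: geq_minr.
Qed.

Lemma eq_tinv_le n a a' :
  (forall v, (size v <= n)%N -> a v = a' v) ->
  forall w, (size w <= n)%N -> tinv a w = tinv a' w.
Proof.
move=> aa' w wn; apply: eq_bigr => k _.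
move: {k}(nat_of_ord k) => m; elim: m w wn => //= m IH w wn.
by apply: (@eq_tmul_le n) => // v vn; rewrite aa'.
Qed.

Lemma tmulBl a b c w :
  tmul (fun v => a v - b v) c w = tmul a c w - tmul b c w.
Proof.
by rewrite /tmul -sumrB; apply: eq_bigr => k _; rewrite mulrBl.
Qed.

Lemma tmulBr a b c w :
  tmul a (fun v => b v - c v) w = tmul a b w - tmul a c w.
Proof.
by rewrite /tmul -sumrB; apply: eq_bigr => k _; rewrite mulrBr.
Qed.

(** Since [c = 1 - a] has no constant term, its k-th power vanishes on words of fewer than k
    letters. Cutting the Neumann series at any order beyond the length of the word thus changes
    nothing, and [1 - c] telescopes against the partial sums. *)
Lemma tmulV a : a [::] = 1 -> tmul a (tinv a) = tone.
Proof.
move=> a1; pose c : tseries R d := fun v => tone v - a v.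
have c0 : c [::] = 0 by rewrite /c /tone eqxx a1 subrr.
have iter0 k w : (size w < k)%N -> iter k (tmul c) tone w = 0.
  elim: k w => [|k IH] w //=; rewrite ltnS => wk.
  rewrite /tmul big_ord_recl take0 c0 mul0r add0r big1// => i _.
  rewrite lift0; case: w i wk => [|x w] i wk; first by case: i.
  rewrite IH ?mulr0//= size_drop.
  exact: leq_ltn_trans (leq_subr _ _) wk.
pose S n : tseries R d := fun v => \sum_(k < n) iter k (tmul c) tone v.
have SE n w : (size w < n)%N -> tinv a w = S n w.
  move=> wn; rewrite /tinv /S -(subnKC wn).
  elim: (n - (size w).+1)%N => [|m IH]; first by rewrite addn0.
  rewrite addnS [RHS]big_ord_recr [X in _ = _ + X]iter0; first by rewrite addr0 IH.
  exact: leq_addr.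
have mulS n : tmul c (S n) = fun v => S n.+1 v - tone v.
  apply/funext => v; rewrite /S big_ord_recl addrC addKr /tmul /=.
  under [LHS]eq_bigr => j _ do rewrite mulr_sumr.
  by rewrite exchange_big.
apply/funext => w.
have -> : tmul a (tinv a) w = tmul a (S (size w).+1) w.
  by apply: (@eq_tmul_le (size w)) => // v vw; apply: SE.
have -> : a = fun v => tone v - c v by apply/funext => v; rewrite /c opprB addrCA subrr addr0.
rewrite tmulBl tmul1l mulS /S [X in _ - (X - _)]big_ord_recr [X in _ - (_ + X - _)]iter0// addr0.
by rewrite opprB addrCA subrr addr0.
Qed.

Lemma tinv_nil a : tinv a [::] = 1.
Proof. by rewrite /tinv big_ord1 /tone. Qed.

(** [tinv a] has a right inverse of its own, which must be [a]; so the right inverse is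
    two-sided. *)
Lemma tmulVl a : a [::] = 1 -> tmul (tinv a) a = tone.
Proof.
move=> a1; have ai := tmulV a1; have ii := tmulV (tinv_nil a).
have {2}-> : a = tinv (tinv a) by rewrite -[LHS]tmul1r -ii tmulA ai tmul1l.
exact: ii.
Qed.

Lemma tinv1 : tinv tone = tone :> tseries R d.
Proof. by rewrite -[LHS]tmul1l tmulV// /tone eqxx. Qed.

Lemma ttrunc_le N a w : (size w <= N)%N -> ttrunc N a w = a w.
Proof. by rewrite /ttrunc => ->. Qed.

End TensorAlgebra.

(** Prefixes and suffixes of a renamed word are renamed words, so pulling a series back along a map
    of alphabets respects products. This is how the space part of an augmented series is read off
    the words without time letter. *)
Lemma tmul_map (R : realType) (d d' : nat) (f : 'I_d -> 'I_d')
    (a b : tseries R d') (w : seq 'I_d) :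
  tmul a b (map f w) =
  tmul (fun v => a (map f v)) (fun v => b (map f v)) w.
Proof.
rewrite /tmul size_map; apply: eq_bigr => k _.
by rewrite map_take map_drop.
Qed.

Lemma tinv_map (R : realType) (d d' : nat) (f : 'I_d -> 'I_d')
    (a : tseries R d') (w : seq 'I_d) :
  tinv a (map f w) = tinv (fun v => a (map f v)) w.
Proof.
rewrite /tinv size_map; apply: eq_bigr => k _.
move: {k}(nat_of_ord k) => m; elim: m w => [|m IH] w /=; first by rewrite /tone; case: w.
rewrite tmul_map; apply: eq_bigr => j _; rewrite IH.
by congr ((_ - _) * _); rewrite /tone; case: (take j w).
Qed.

(** * Uniform continuity and controls *)

(** Heine's form of continuity, stated for ordered pairs: the pairs met below are end points of
    intervals, and the bound on [v - u] is the mesh bound of a partition. *)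
Definition ucont (R : realType) (a b : R) (f : R -> R) : Prop :=
  forall e, 0 < e -> exists2 h, 0 < h &
    forall u v, a <= u -> u <= v -> v <= b -> v - u < h -> `|f v - f u| <= e.

Section UniformContinuity.
Variables (R : realType) (a b : R).
Implicit Types f g : R -> R.

Lemma within_ucont f : {within `[a, b], continuous f} -> ucont a b f.
Proof.
move=> /subspace_continuousP cf e e0; have e20 : 0 < e / 2 by rewrite divr_gt0.
(* The near-covering form of compactness turns moduli valid near each point into a single
   modulus. *)
have /compact_near_coveringP := @segment_compact R a b.
pose Q (h u : R) := forall v, a <= u -> u <= v -> v <= b -> v - u < h ->
  `|f v - f u| <= e.
move=> /(_ R (at_right 0) Q _) cov.
have [x|] := cov.
  move=> abx; have /cvgrPdist_lt /(_ (e / 2)) := cf x abx.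
  move=> /(_ e20) /nbhs_ballP [r /= r0 hr].
  exists (ball x (r / 2), [set h | h < r / 2]).
    split; first by apply: nbhsx_ballx; rewrite divr_gt0.
    by apply: nbhs_right_lt; rewrite divr_gt0.
  move=> [u h] /= [xu hr2] v au uv vb vuh.
  have fu : `|f x - f u| < e / 2.
    apply: hr; last by rewrite /= in_itv/= au (le_trans uv vb).
    by apply: lt_le_trans xu _; rewrite ler_pdivrMr// ler_peMr ?ler1n// ltW.
  have fv : `|f x - f v| < e / 2.
    apply: hr; last by rewrite /= in_itv/= vb (le_trans au uv).
    move: xu; rewrite /ball /= => xu.
    rewrite -[x - v](subrKA u) (le_lt_trans (ler_normD _ _))//.
    by rewrite [r]splitr ltrD// distrC ger0_norm ?subr_ge0// (lt_trans vuh).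
  rewrite -[f v - f u](subrKA (f x)) (le_trans (ler_normD _ _))//.
  by rewrite [e]splitr lerD// ltW// distrC.
move=> h /= h0 covh.
have [r r0 hr] : exists2 r : R, 0 < r & forall u, `[a, b]%classic u -> Q r u.
  exists (h / 2); first by rewrite divr_gt0.
  apply: (covh (h / 2)); last by rewrite divr_gt0.
  by rewrite /ball/= sub0r normrN gtr0_norm ?divr_gt0// ltr_pdivrMr// ltr_pMr// ltr1n.
exists r => // u v au uv vb; apply: hr => //.
by rewrite /= in_itv/= au (le_trans uv vb).
Qed.

Lemma ucont_sub f a' b' : a <= a' -> b' <= b -> ucont a b f -> ucont a' b' f.
Proof.
move=> aa' bb' cf e /cf[h h0 hf]; exists h => // u v au uv vb.
by apply: hf => //; [exact: le_trans au|exact: le_trans bb'].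
Qed.

Lemma eq_ucont f g : (forall u, a <= u -> u <= b -> f u = g u) ->
  ucont a b f -> ucont a b g.
Proof.
move=> fg cf e /cf[h h0 hf]; exists h => // u v au uv vb.
by rewrite -!fg//; [exact: hf|exact: le_trans uv vb|exact: le_trans au uv].
Qed.

Lemma ucont_cst x : ucont a b (fun=> x).
Proof. by move=> e e0; exists 1 => // u v *; rewrite subrr normr0 ltW. Qed.

Lemma ucontD f g : ucont a b f -> ucont a b g -> ucont a b (fun u => f u + g u).
Proof.
move=> cf cg e e0; have e20 : 0 < e / 2 by rewrite divr_gt0.
have [h h0 hf] := cf _ e20; have [k k0 kg] := cg _ e20.
exists (Num.min h k) => [|u v au uv vb]; first by rewrite lt_min h0.
rewrite lt_min => /andP[vh vk].
have := hf u v au uv vb vh; have := kg u v au uv vb vk.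
by rewrite !ler_norml => /andP[? ?] /andP[? ?]; apply/andP; split; lra.
Qed.

(** Walking from [a] in steps of h/2, over each of which [f] moves by at most 1, reaches every point
    of the interval in boundedly many steps. *)
Lemma ucont_bounded f : ucont a b f ->
  exists2 B, 0 <= B & forall u, a <= u -> u <= b -> `|f u| <= B.
Proof.
move=> /(_ 1 ltr01)[h h0 hf].
have step k : forall u, a <= u -> u <= b -> u - a <= k%:R * (h / 2) ->
    `|f u| <= `|f a| + k%:R.
  elim: k => [|k IH] u au ub.
    by rewrite mul0r subr_le0 => ua; rewrite addr0 (@le_anti _ _ u a) ?ua.
  rewrite -natr1 => uk.
  have [uh|hu] := leP (u - a) (h / 2).
    have := hf a u (lexx _) au ub (le_lt_trans uh _); rewrite ltr_pdivrMr//.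
    rewrite ltr_pMr// ltr1n => /(_ isT) fua.
    have := ler_normD (f u - f a) (f a); rewrite subrK => H.
    have := ler0n R k; lra.
  have au' : a <= u - h / 2 by lra.
  have uu' : u - h / 2 <= u by lra.
  have := IH (u - h / 2) au' (le_trans uu' ub).
  have -> : u - h / 2 - a <= k%:R * (h / 2) by lra.
  move=> /(_ isT) fu'; have := hf _ u au' uu' ub.
  have -> : u - (u - h / 2) < h by lra.
  move=> /(_ isT) fu; have := ler_normD (f u - f (u - h / 2)) (f (u - h / 2)).
  by rewrite subrK; lra.
pose K := Num.truncn ((b - a) / (h / 2)).
exists (`|f a| + K.+1%:R) => [|u au ub]; first by rewrite addr_ge0.
apply: step => //; rewrite -ler_pdivrMr ?divr_gt0//.
apply: le_trans (ltW (truncnS_gt _)).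
by rewrite ler_pM2r ?invr_gt0 ?divr_gt0// lerD2r.
Qed.

Lemma ucontM f g : ucont a b f -> ucont a b g -> ucont a b (fun u => f u * g u).
Proof.
move=> cf cg e e0.
have [B B0 Bf] := ucont_bounded cf; have [C C0 Cg] := ucont_bounded cg.
have K0 : 0 < B + C + 1 by lra.
have [h h0 hf] := cf _ (divr_gt0 e0 K0); have [k k0 kg] := cg _ (divr_gt0 e0 K0).
exists (Num.min h k) => [|u v au uv vb]; first by rewrite lt_min h0.
rewrite lt_min => /andP[vh vk].
have -> : f v * g v - f u * g u = (f v - f u) * g v + f u * (g v - g u) by ring.
apply: le_trans (ler_normD _ _) _; rewrite !normrM.
have Cv := Cg v (le_trans au uv) vb; have Bu := Bf u au (le_trans uv vb).
have := ler_pM (normr_ge0 _) (normr_ge0 _) (hf u v au uv vb vh) Cv.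
have := ler_pM (normr_ge0 _) (normr_ge0 _) Bu (kg u v au uv vb vk).
have -> : B * (e / (B + C + 1)) = e * (B / (B + C + 1)) by ring.
have -> : e / (B + C + 1) * C = e * (C / (B + C + 1)) by ring.
have : e * (B / (B + C + 1)) + e * (C / (B + C + 1)) <= e.
  by rewrite -mulrDr -mulrDl -[leRHS]mulr1 ler_pM2l// ler_pdivrMr// mul1r; lra.
by lra.
Qed.

Lemma ucontN f : ucont a b f -> ucont a b (fun u => - f u).
Proof. by move=> cf e /cf[h h0 hf]; exists h => // u v *; rewrite -opprD normrN hf. Qed.

Lemma ucont_sum (I : Type) (r : seq I) (F : I -> R -> R) :
  (forall i, ucont a b (F i)) -> ucont a b (fun u => \sum_(i <- r) F i u).
Proof.
move=> cF; elim: r => [|i r IH].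
  by apply: (@eq_ucont (fun=> 0)); [move=> u; rewrite big_nil|exact: ucont_cst].
apply: (@eq_ucont (fun u => F i u + \sum_(j <- r) F j u)).
  by move=> u; rewrite big_cons.
exact: ucontD.
Qed.

End UniformContinuity.

Section Control.
Variable R : realType.
Implicit Types (a b : R) (s : seq R).

Lemma partition_sum_cons a x s (F : R -> R -> \bar R) :
  partition_sum a (x :: s) F = (F a x + partition_sum x s F)%E.
Proof.
rewrite /partition_sum big_ord_recl; congr (_ + _)%E.
apply: eq_bigr => i _; rewrite lift0 /=.
by congr (F _ _); apply: set_nth_default => //=; rewrite ltnW// ltnS.
Qed.

Lemma partition_sum_rcons a x s (F : R -> R -> \bar R) :
  partition_sum a (rcons s x) F = (partition_sum a s F + F (last a s) x)%E.
Proof.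
elim: s a => [|y s IH] a /=.
  by rewrite partition_sum_cons /partition_sum !big_ord0 adde0 add0e.
by rewrite !partition_sum_cons IH addeA.
Qed.

Lemma itv_partition_rcons a u v s :
  itv_partition a u s -> u < v -> itv_partition a v (rcons s v).
Proof.
move=> [ps /eqP ls] uv; split; last by rewrite last_rcons.
by rewrite rcons_path ps ls.
Qed.

Lemma partition_sum_ge0 a s (F : R -> R -> \bar R) :
  (forall u v, (0 <= F u v)%E) -> (0 <= partition_sum a s F)%E.
Proof. by move=> F0; rewrite /partition_sum; apply: sume_ge0. Qed.

(* The witness is t |-> sup of the partition sums over [a, t]; it is
   superadditive because a partition can be prolonged by one point. *)
Lemma control_of_partition_sums a b (F : R -> R -> \bar R) :
  a <= b -> (forall u v, (0 <= F u v)%E) ->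
  (ereal_sup [set partition_sum a s F | s in itv_partition a b] < +oo)%E ->
  exists V : R -> R, [/\ forall u v, a <= u -> u < v -> v <= b ->
      (F u v <= (V v - V u)%:E)%E,
    0 <= V a &
    ((V b)%:E <= ereal_sup [set partition_sum a s F | s in itv_partition a b])%E].
Proof.
move=> ab F0 Soo.
pose S t := ereal_sup [set partition_sum a s F | s in itv_partition a t].
have prolong u v s : itv_partition a u s -> u < v ->
    (partition_sum a s F + F u v <= S v)%E.
  move=> us uv; apply: ereal_sup_ubound => /=.
  exists (rcons s v); first exact: itv_partition_rcons us uv.
  by rewrite partition_sum_rcons; case: us => _ /eqP ->.
have S0 t : a <= t -> (0 <= S t)%E.
  rewrite le_eqVlt => /predU1P[<-|at_].
    apply: ereal_sup_ubound => /=; exists [::] => //.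
    by rewrite /partition_sum big_ord0.
  apply: (@le_trans _ _ (partition_sum a [:: t] F)); first exact: partition_sum_ge0.
  by apply: ereal_sup_ubound => /=; exists [:: t] => //; exact: itv_partition1.
have Sle t : a <= t -> t <= b -> (S t <= S b)%E.
  move=> at_; rewrite le_eqVlt => /predU1P[->//|tb].
  apply: ge_ereal_sup => _ [s ts <-].
  by apply: le_trans (prolong _ _ _ ts tb); apply: leeDl.
have Sfin t : a <= t -> t <= b -> S t \is a fin_num.
  by move=> at_ tb; rewrite ge0_fin_numE ?S0// (le_lt_trans (Sle _ _ _)).
exists (fun t => fine (S t)); split => [u v au uv vb| |].
- have av : a <= v by rewrite (le_trans au)// ltW.
  have ub : u <= b by rewrite (le_trans _ vb)// ltW.
  rewrite EFinB !fineK ?Sfin// leeBrDl ?Sfin//.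
  have Fv : (F u v <= S v)%E.
    have [s us] : exists s, itv_partition a u s.
      move: au; rewrite le_eqVlt => /predU1P[<-|au]; first by exists [::].
      by exists [:: u]; exact: itv_partition1.
    by apply: le_trans (prolong _ _ _ us uv); apply: leeDr; exact: partition_sum_ge0.
  have Ff : F u v \is a fin_num.
    by rewrite ge0_fin_numE// (le_lt_trans Fv)// -ge0_fin_numE ?S0// Sfin.
  rewrite -leeBrDr//; apply: ge_ereal_sup => _ [s us <-].
  by rewrite leeBrDr//; exact: prolong.
- by rewrite fine_ge0 ?S0.
- by rewrite fineK ?Sfin.
Qed.

End Control.

(** * Riemann-Stieltjes integrals *)

Section RiemannStieltjesTheory.
Variable R : realType.
Implicit Types (a b c x : R) (s : seq R) (f g V : R -> R).

(** A list starting at [a] uses [a] as the default of [nth], its tail uses [x]. This equivalence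
    absorbs the change of default in the inductions that remove the first cell. *)
Lemma forall_cells_cons (P : nat -> R -> R -> Prop) a x s :
  (forall i, (i < size (x :: s))%N ->
    P i (nth a [:: a, x & s] i) (nth a (x :: s) i)) <->
  P 0%N a x /\ forall i, (i < size s)%N -> P i.+1 (nth x (x :: s) i) (nth x s i).
Proof.
split=> [H|[H0 H] [|i] //= ilt].
  split=> [|i ilt]; first exact: (H 0%N).
  have := H i.+1 ilt => /=.
  by rewrite (set_nth_default x a)//= 1?ltnW// (set_nth_default x a).
have := H i ilt.
by rewrite (set_nth_default a x)//= 1?ltnW// (set_nth_default a x).
Qed.

Lemma RS_sum_nil f g a xi : RS_sum f g a [::] xi = 0.
Proof. by rewrite /RS_sum big_ord0. Qed.

Lemma RS_sum_cons f g a x s xi : RS_sum f g a (x :: s) xi =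
  f (xi 0%N) * (g x - g a) + RS_sum f g x s (fun i => xi i.+1).
Proof.
rewrite /RS_sum big_ord_recl; congr (_ + _).
apply: eq_bigr => i _; rewrite lift0 /=.
rewrite (set_nth_default x a)//; congr (_ * (_ - g _)).
by apply: set_nth_default => /=; rewrite ltnW// ltnS.
Qed.

Lemma itv_partition_consE a b x s :
  itv_partition a b (x :: s) <-> a < x /\ itv_partition x b s.
Proof. by split=> [[/= /andP[? ?] ?]|[ax [? ?]]]; [|split=> //=; rewrite ax]. Qed.

Lemma itv_partition_leE a b s : itv_partition a b s -> a <= b.
Proof.
elim: s a => [|x s IH] a; first by move/itv_partition_nil ->.
by move/itv_partition_consE => [ax /IH]; apply: le_trans; exact: ltW.
Qed.

Lemma itv_partition_nth_bounds a b s i : itv_partition a b s ->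
  (i < size s)%N -> a <= nth a (a :: s) i /\ nth a s i <= b.
Proof.
elim: s a i => [//|y s IH] a [|i] /itv_partition_consE[ay ps] /= ilt.
  by split=> //; exact: itv_partition_leE ps.
have [yi ib] := IH y i ps ilt.
rewrite (set_nth_default y)//=; last by rewrite ltnW.
by rewrite (set_nth_default y a)//; split=> //; apply: le_trans yi; exact: ltW.
Qed.

Lemma itv_partition_refl a s : itv_partition a a s -> s = [::].
Proof.
case: s => // x s /itv_partition_consE[ax /itv_partition_leE].
by rewrite leNgt ax.
Qed.

Lemma fine_partition a b h : a <= b -> 0 < h ->
  exists2 s, itv_partition a b s & mesh_lt a s h.
Proof.
move=> ab h0; have [K] : exists K : nat, b - a <= K%:R * (h / 2).
  exists (Num.truncn ((b - a) / (h / 2))).+1.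
  by rewrite -ler_pdivrMr ?divr_gt0// ltW// truncnS_gt.
elim: K a ab => [|k IH] a; rewrite le_eqVlt => /predU1P[->|ab] bak.
- by exists [::].
- by move: bak; rewrite mul0r subr_le0 leNgt ab.
- by exists [::].
have [bah|hba] := ltP (b - a) h.
  by exists [:: b]; [exact: itv_partition1|case].
have := IH (a + h / 2); rewrite -natr1 in bak.
have -> : a + h / 2 <= b by lra.
have -> : b - (a + h / 2) <= k%:R * (h / 2) by lra.
move=> /(_ isT isT)[s ps ms]; exists (a + h / 2 :: s).
  by apply/itv_partition_consE; split=> //; rewrite ltrDl divr_gt0.
apply/(forall_cells_cons (fun _ u v => v - u < h)); split=> //.
by rewrite addrC addKr ltr_pdivrMr// ltr_pMr// ltr1n.
Qed.

Lemma tags_of_left a b s : itv_partition a b s -> tags_of a s (nth a (a :: s)).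
Proof.
elim: s a => [//|x s IH] a /itv_partition_consE[ax /IH xs].
apply/(forall_cells_cons (fun i u v => u <= nth a [:: a, x & s] i <= v)).
split; first by rewrite /= lexx ltW.
move=> i ilt; have := xs i ilt; rewrite /=.
by rewrite [nth a _ _](set_nth_default x)//= ltnW.
Qed.

Lemma RS_sum_bound f g V a b s xi B :
  (forall u v, a <= u -> u <= v -> v <= b -> `|g v - g u| <= V v - V u) ->
  (forall u, a <= u -> u <= b -> `|f u| <= B) ->
  itv_partition a b s -> tags_of a s xi ->
  `|RS_sum f g a s xi| <= B * (V b - V a).
Proof.
elim: s a xi => [|x s IH] a xi gV fB.
  by move=> /itv_partition_nil -> _; rewrite RS_sum_nil normr0 subrr mulr0.
move=> /itv_partition_consE[ax ps].
move=> /(forall_cells_cons (fun i u v => u <= xi i <= v))[/andP[t0 t1] ts].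
rewrite RS_sum_cons (le_trans (ler_normD _ _))//.
have xb := itv_partition_leE ps.
have {}IH : `|RS_sum f g x s (fun i => xi i.+1)| <= B * (V b - V x).
  apply: IH => // [u v xu|u xu]; first by apply: gV; rewrite (le_trans _ xu)// ltW.
  by apply: fB; rewrite (le_trans _ xu)// ltW.
have -> : B * (V b - V a) = B * (V x - V a) + B * (V b - V x) by ring.
apply: lerD IH; rewrite normrM ler_pM//; first by apply: fB => //; exact: le_trans xb.
by apply: gV => //; exact: ltW.
Qed.

(* phi i stands for a value that is e-close to f on the whole i-th cell; unlike
   a tag of that cell, it remains admissible on a subinterval of the cell. *)
Lemma RS_sum_compare f g V e a b s s' (phi phi' : nat -> R) :
  (forall u v, a <= u -> u <= v -> v <= b -> `|g v - g u| <= V v - V u) ->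
  itv_partition a b s -> itv_partition a b s' ->
  (forall i, (i < size s)%N ->
    forall z, nth a (a :: s) i <= z <= nth a s i -> `|phi i - f z| <= e) ->
  (forall i, (i < size s')%N ->
    forall z, nth a (a :: s') i <= z <= nth a s' i -> `|phi' i - f z| <= e) ->
  `|RS_sum id g a s phi - RS_sum id g a s' phi'| <= 2 * e * (V b - V a).
Proof.
pose P phi (i : nat) u v := forall z, u <= z <= v -> `|phi i - f z| <= e.
have [n] := ubnP (size s + size s').
elim: n => // n IH in a s s' phi phi' *; rewrite ltnS => sn gV.
have head u phi1 phi2 : a <= u -> u <= b -> `|phi1 - f a| <= e ->
    `|phi2 - f a| <= e ->
    `|(phi1 - phi2) * (g u - g a)| <= 2 * e * (V u - V a).
  move=> au ub p1 p2; rewrite normrM ler_pM//; last exact: gV.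
  rewrite -[phi1 - phi2](subrKA (f a)) (le_trans (ler_normD _ _))//.
  by rewrite (distrC (f a)); lra.
have step t t' p p' x x' : ((size t).+1 + (size t').+1 <= n)%N ->
    x < x' -> itv_partition a b (x :: t) -> itv_partition a b (x' :: t') ->
    (forall i, (i < size (x :: t))%N ->
      forall z, nth a [:: a, x & t] i <= z <= nth a (x :: t) i -> `|p i - f z| <= e) ->
    (forall i, (i < size (x' :: t'))%N ->
      forall z, nth a [:: a, x' & t'] i <= z <= nth a (x' :: t') i -> `|p' i - f z| <= e) ->
    `|RS_sum id g a (x :: t) p - RS_sum id g a (x' :: t') p'| <= 2 * e * (V b - V a).
  move=> tn xx' /itv_partition_consE[ax pt] /itv_partition_consE[ax' pt'].
  move=> /(forall_cells_cons (P p))[p0 ps] /(forall_cells_cons (P p'))[p0' ps'].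
  have -> : RS_sum id g a (x' :: t') p' =
      p' 0%N * (g x - g a) + RS_sum id g x (x' :: t') p'.
    by rewrite !RS_sum_cons; ring.
  rewrite RS_sum_cons opprD addrACA -mulrBl.
  have -> : 2 * e * (V b - V a) = 2 * e * (V x - V a) + 2 * e * (V b - V x) by ring.
  apply: le_trans (ler_normD _ _) _; apply: lerD.
    apply: head; [exact: ltW|exact: itv_partition_leE pt| |].
      by apply: p0; rewrite lexx ltW.
    by apply: p0'; rewrite lexx ltW.
  apply: IH => //.
  - by move=> u v xu; apply: gV; rewrite (le_trans _ xu)// ltW.
  - by apply/itv_partition_consE.
  apply/(forall_cells_cons (P p')); split=> // z /andP[xz zx'].
  by apply: p0'; rewrite zx' (le_trans _ xz)// ltW.
case: s s' sn => [|x s] [|x' s'] sn.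
- by move=> /itv_partition_nil -> _ _ _; rewrite !RS_sum_nil !subrr normr0 mulr0.
- by move=> /itv_partition_nil -> /itv_partition_refl.
- by move=> ps /itv_partition_nil ab; move: ps; rewrite ab => /itv_partition_refl.
have [xx'|x'x|<-] := ltgtP x x'.
- exact: step.
- move=> ps ps' hs hs'; rewrite distrC; apply: step => //.
  by move: sn; rewrite /= addnC.
move=> /itv_partition_consE[ax ps] /itv_partition_consE[_ ps'].
move=> /(forall_cells_cons (P phi))[p0 hs] /(forall_cells_cons (P phi'))[p0' hs'].
rewrite !RS_sum_cons opprD addrACA -mulrBl.
have -> : 2 * e * (V b - V a) = 2 * e * (V x - V a) + 2 * e * (V b - V x) by ring.
apply: le_trans (ler_normD _ _) _; apply: lerD.
  apply: head; [exact: ltW|exact: itv_partition_leE ps| |].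
    by apply: p0; rewrite lexx ltW.
  by apply: p0'; rewrite lexx ltW.
apply: IH => //; first by move: sn; rewrite /= addSn addnS => /ltnW.
by move=> u v xu; apply: gV; rewrite (le_trans _ xu)// ltW.
Qed.

(** Every point of a cell is within [h] of the tag, so the value at the tag is close to [f] on the
    whole cell, as [RS_sum_compare] requires. The 1 added in the denominator allows a constant
    [V]. *)
Lemma RS_sum_cauchy f g V a b e : a <= b -> ucont a b f ->
  (forall u v, a <= u -> u <= v -> v <= b -> `|g v - g u| <= V v - V u) ->
  0 < e -> exists2 h, 0 < h & forall s s' xi xi',
    itv_partition a b s -> mesh_lt a s h -> tags_of a s xi ->
    itv_partition a b s' -> mesh_lt a s' h -> tags_of a s' xi' ->
    `|RS_sum f g a s xi - RS_sum f g a s' xi'| <= e.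
Proof.
move=> ab cf gV e0; have V0 : 0 <= V b - V a by apply: le_trans (gV _ _ _ ab _).
have e'0 : 0 < e / (2 * (V b - V a + 1)) by rewrite divr_gt0// mulr_gt0//; lra.
have [h h0 hf] := cf _ e'0; exists h => // s s' xi xi' ps ms ts ps' ms' ts'.
have close t (x : nat -> R) : itv_partition a b t -> mesh_lt a t h -> tags_of a t x ->
    forall i, (i < size t)%N -> forall z, nth a (a :: t) i <= z <= nth a t i ->
    `|f (x i) - f z| <= e / (2 * (V b - V a + 1)).
  move=> pt mt tt i it z /andP[iz zi].
  have := tt i it => /andP[ix xi_].
  have [ai ib] := itv_partition_nth_bounds pt it.
  have mi := mt i it.
  have [xz|zx] := leP (x i) z.
    by rewrite distrC; apply: hf => //; lra.
  by apply: hf => //; lra.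
apply: le_trans (RS_sum_compare gV ps ps' (close _ _ ps ms ts) (close _ _ ps' ms' ts')) _.
have -> : 2 * (e / (2 * (V b - V a + 1))) * (V b - V a) =
    e * ((V b - V a) / (V b - V a + 1)).
  by field; lra.
by rewrite -[leRHS]mulr1 ler_pM2l// ler_pdivrMr ?mul1r; lra.
Qed.

(** The integral is the supremum of the set [A] of eventual lower bounds of the sums. By the Cauchy
    property a fine sum lowered by e lies in [A], and raised by e it is an upper bound of [A]; no
    sequence of partitions has to be chosen. *)
Lemma RS_integral_exists f g V a b : a <= b -> ucont a b f ->
  (forall u v, a <= u -> u <= v -> v <= b -> `|g v - g u| <= V v - V u) ->
  exists I, is_RS_integral f g a b I.
Proof.
move=> ab cf gV.
pose A := [set x | exists2 h, 0 < h & forall s xi, itv_partition a b s ->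
  mesh_lt a s h -> tags_of a s xi -> x <= RS_sum f g a s xi].
have key e : 0 < e -> exists2 h, 0 < h & forall s xi,
    itv_partition a b s -> mesh_lt a s h -> tags_of a s xi ->
    A (RS_sum f g a s xi - e) /\ ubound A (RS_sum f g a s xi + e).
  move=> e0; have [h h0 H] := RS_sum_cauchy ab cf gV e0; exists h => // s xi ps ms ts.
  split=> [|x [k k0 Hk]].
    exists h => // s' xi' ps' ms' ts'.
    by have := H _ _ _ _ ps ms ts ps' ms' ts'; rewrite ler_norml => /andP[_]; lra.
  have hk : 0 < Num.min h k by rewrite lt_min h0.
  have [s' ps' ms'] := fine_partition ab hk; have ts' := tags_of_left ps'.
  have ms1 : mesh_lt a s' h by move=> i /ms'; rewrite lt_min => /andP[].
  have ms2 : mesh_lt a s' k by move=> i /ms'; rewrite lt_min => /andP[].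
  have := Hk _ _ ps' ms2 ts'.
  by have := H _ _ _ _ ps ms ts ps' ms1 ts'; rewrite ler_norml => /andP[]; lra.
exists (sup A) => e e0; have e20 : 0 < e / 2 by rewrite divr_gt0.
have [h h0 H] := key _ e20; exists h => // s xi ps ms ts.
have [As uA] := H s xi ps ms ts.
have lo : RS_sum f g a s xi - e / 2 <= sup A.
  by apply: ub_le_sup => //; exists (RS_sum f g a s xi + e / 2).
have up : sup A <= RS_sum f g a s xi + e / 2.
  by apply: ge_sup => //; exists (RS_sum f g a s xi - e / 2).
by rewrite ltr_norml; apply/andP; split; lra.
Qed.

Lemma RS_integralE f g a b I : a <= b -> is_RS_integral f g a b I ->
  RS_integral f g a b = I.
Proof.
move=> ab HI; rewrite /RS_integral.
have HJ := xgetI 0 HI; set J := xget _ _ in HJ *.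
apply/eqP; rewrite -subr_eq0 -normr_le0 leNgt; apply/negP => JI0.
have e0 : 0 < `|J - I| / 2 by rewrite divr_gt0.
have [h h0 H] := HI _ e0; have [k k0 K] := HJ _ e0.
have hk : 0 < Num.min h k by rewrite lt_min h0.
have [s ps ms] := fine_partition ab hk; have ts := tags_of_left ps.
have ms1 : mesh_lt a s h by move=> i /ms; rewrite lt_min => /andP[].
have ms2 : mesh_lt a s k by move=> i /ms; rewrite lt_min => /andP[].
have := H _ _ ps ms1 ts; have := K _ _ ps ms2 ts.
set S := RS_sum _ _ _ _ _ => HK HH.
have := ler_normD (J - S) (S - I); rewrite subrKA distrC.
by rewrite distrC in HK; rewrite (distrC I); lra.
Qed.

Lemma RS_integralP f g V a b : a <= b -> ucont a b f ->
  (forall u v, a <= u -> u <= v -> v <= b -> `|g v - g u| <= V v - V u) ->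
  is_RS_integral f g a b (RS_integral f g a b).
Proof.
by move=> ab cf gV; have [I HI] := RS_integral_exists ab cf gV; rewrite (RS_integralE ab HI).
Qed.

Lemma RS_integral_bound f g V a b B : a <= b ->
  (forall u v, a <= u -> u <= v -> v <= b -> `|g v - g u| <= V v - V u) ->
  (forall u, a <= u -> u <= b -> `|f u| <= B) ->
  `|RS_integral f g a b| <= B * (V b - V a).
Proof.
move=> ab gV fB; rewrite /RS_integral; case: xgetP => [I _ HI|_]; last first.
  rewrite normr0 mulr_ge0//; first exact: le_trans (normr_ge0 _) (fB a _ _).
  exact: le_trans (normr_ge0 _) (gV _ _ _ ab _).
apply/ler_addgt0Pr => e e0; have [h h0 H] := HI _ e0.
have [s ps ms] := fine_partition ab h0; have ts := tags_of_left ps.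
have := H _ _ ps ms ts; have := RS_sum_bound gV fB ps ts.
set S := RS_sum _ _ _ _ _ => HS HIS.
have := ler_normD (I - S) S; rewrite subrK distrC; lra.
Qed.

Lemma is_RS_integral_linear f f' g a b I I' x : is_RS_integral f g a b I ->
  is_RS_integral f' g a b I' ->
  is_RS_integral (fun u => f u + x * f' u) g a b (I + x * I').
Proof.
move=> HI HI' e e0; have e20 : 0 < e / 2 by rewrite divr_gt0.
have e'0 : 0 < e / (2 * (`|x| + 1)) by rewrite divr_gt0// mulr_gt0//; have := normr_ge0 x; lra.
have [h h0 H] := HI _ e20; have [k k0 K] := HI' _ e'0.
exists (Num.min h k) => [|s xi ps ms ts]; first by rewrite lt_min h0.
have ms1 : mesh_lt a s h by move=> i /ms; rewrite lt_min => /andP[].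
have ms2 : mesh_lt a s k by move=> i /ms; rewrite lt_min => /andP[].
have -> : RS_sum (fun u => f u + x * f' u) g a s xi =
    RS_sum f g a s xi + x * RS_sum f' g a s xi.
  rewrite /RS_sum mulr_sumr -big_split; apply: eq_bigr => i _ /=.
  by rewrite mulrDl mulrA.
have {}H := H _ _ ps ms1 ts; have {}K := K _ _ ps ms2 ts.
rewrite opprD addrACA -mulrBr (le_lt_trans (ler_normD _ _))// normrM.
have : `|x| * `|RS_sum f' g a s xi - I'| <= e / 2; last by lra.
apply: (@le_trans _ _ (`|x| * (e / (2 * (`|x| + 1))))).
  by rewrite ler_wpM2l// ltW.
have -> : `|x| * (e / (2 * (`|x| + 1))) = e / 2 * (`|x| / (`|x| + 1)).
  by field; have := normr_ge0 x; lra.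
rewrite -[leRHS]mulr1 ler_pM2l// ler_pdivrMr ?mul1r; have := normr_ge0 x; lra.
Qed.

Lemma is_RS_integral_cst g a b x :
  is_RS_integral (fun=> x) g a b (x * (g b - g a)).
Proof.
move=> e e0; exists 1 => // s xi ps _ _.
suff -> : RS_sum (fun=> x) g a s xi = x * (g b - g a) by rewrite subrr normr0.
elim: s a xi ps => [|y s IH] a xi.
  by move=> /itv_partition_nil ->; rewrite RS_sum_nil subrr mulr0.
by move=> /itv_partition_consE[_ ps]; rewrite RS_sum_cons IH//; ring.
Qed.

Lemma mesh_lt_cat a c s t h : itv_partition a c s ->
  mesh_lt a s h -> mesh_lt c t h -> mesh_lt a (s ++ t) h.
Proof.
elim: s a => [|y s IH] a; first by move=> /itv_partition_nil ->.
move=> /itv_partition_consE[ay ps].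
move=> /(forall_cells_cons (fun _ u v => v - u < h))[m0 ms] mt.
by apply/(forall_cells_cons (fun _ u v => v - u < h)); split=> //; exact: IH.
Qed.

(** Left end points serve as tags because they depend on the partition alone: those of a
    concatenation are those of its two pieces. *)
Lemma RS_sum_left_cat f g a c s t : itv_partition a c s ->
  RS_sum f g a (s ++ t) (nth a (a :: s ++ t)) =
  RS_sum f g a s (nth a (a :: s)) + RS_sum f g c t (nth c (c :: t)).
Proof.
elim: s a => [|y s IH] a.
  by move=> /itv_partition_nil ->; rewrite RS_sum_nil add0r.
move=> /itv_partition_consE[ay ps]; rewrite /= !RS_sum_cons -addrA; congr (_ + _).
have tagE q : RS_sum f g y q (fun i => nth a [:: a, y & q] i.+1) =
    RS_sum f g y q (nth y (y :: q)).
  rewrite /RS_sum; apply: eq_bigr => i _; congr (f _ * _) => /=.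
  by apply: set_nth_default; rewrite /= ltnW// ltnS.
by rewrite (tagE (s ++ t)) (tagE s) IH.
Qed.

Lemma RS_integral_split f g a b c I J K : a <= c -> c <= b ->
  is_RS_integral f g a c I -> is_RS_integral f g c b J ->
  is_RS_integral f g a b K -> K = I + J.
Proof.
move=> ac cb HI HJ HK.
apply/eqP; rewrite -subr_eq0 -normr_le0 leNgt; apply/negP => KIJ.
have e0 : 0 < `|K - (I + J)| / 3 by rewrite divr_gt0.
have [h h0 H] := HI _ e0; have [j j0 H'] := HJ _ e0; have [k k0 H''] := HK _ e0.
have hjk : 0 < Num.min h (Num.min j k) by rewrite !lt_min h0 j0.
have [s ps ms] := fine_partition ac hjk; have [t pt mt] := fine_partition cb hjk.
have mr := mesh_lt_cat ps ms mt; have pr := itv_partition_cat ps pt.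
have min1 q u : mesh_lt u q (Num.min h (Num.min j k)) ->
    [/\ mesh_lt u q h, mesh_lt u q j & mesh_lt u q k].
  by move=> mq; split=> i /mq; rewrite !lt_min => /and3P[].
have [ms1 _ _] := min1 _ _ ms; have [_ mt1 _] := min1 _ _ mt.
have [_ _ mr1] := min1 _ _ mr.
have := H _ _ ps ms1 (tags_of_left ps); have := H' _ _ pt mt1 (tags_of_left pt).
have := H'' _ _ pr mr1 (tags_of_left pr); rewrite (RS_sum_left_cat _ _ _ ps).
set S := RS_sum _ _ _ _ _; set S' := RS_sum _ _ _ _ _ => HK' HJ' HI'.
have : `|K - (I + J)| <= `|S + S' - K| + (`|S - I| + `|S' - J|).
  rewrite (distrC _ K).
  have -> : K - (I + J) = (K - (S + S')) + ((S - I) + (S' - J)) by ring.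
  by rewrite (le_trans (ler_normD _ _))// lerD2l ler_normD.
by lra.
Qed.

End RiemannStieltjesTheory.

(** * Signatures of paths of bounded variation *)

Section SignatureOfBoundedVariationPaths.
Variables (R : realType) (m : nat).
Implicit Types (x : R -> 'rV[R]_m) (V : R -> R) (w : seq 'I_m).

(** [V] plays the role of the length run up to the current time, plus the time itself for augmented
    paths. Keeping only this inequality, rather than the length, makes restriction to subintervals
    immediate. *)
Definition dominated_path (a b : R) x V : Prop :=
  (forall i, ucont a b (fun u => x u ord0 i)) /\
  forall i u v, a <= u -> u <= v -> v <= b ->
    `|x v ord0 i - x u ord0 i| <= V v - V u.

Lemma dominated_path_sub a b a' b' x V : a <= a' -> b' <= b ->
  dominated_path a b x V -> dominated_path a' b' x V.
Proof.
move=> aa' bb' [cx xV]; split=> [i|i u v au uv vb]; first exact: ucont_sub (cx i).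
by apply: xV => //; [exact: le_trans au|exact: le_trans bb'].
Qed.

(** The letter [i] gives access to the domination: over an empty alphabet nothing constrains [V]. *)
Lemma dominated_path_mono a b x V (i : 'I_m) u v : dominated_path a b x V ->
  a <= u -> u <= v -> v <= b -> V u <= V v.
Proof. by move=> [_ xV] au uv vb; rewrite -subr_ge0 (le_trans _ (xV i u v _ _ _)). Qed.

Lemma signature_nil x s t : signature x s t [::] = 1.
Proof. by []. Qed.

Lemma signature_rcons x s t w i : signature x s t (rcons w i) =
  RS_integral (fun r => signature x s r w) (fun u => x u ord0 i) s t.
Proof. by rewrite /signature rev_rcons. Qed.

(** By monotonicity of [V] the integrand is at most its bound at the final time. The factorial is
    lost but the homogeneous degree is kept, and only the degree is used below. *)
Lemma signature_bound a b x V s t w : dominated_path a b x V ->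
  a <= s -> s <= t -> t <= b -> `|signature x s t w| <= (V t - V s) ^+ size w.
Proof.
move=> xV as_; elim/last_ind: w t => [|w i IH] t st tb.
  by rewrite signature_nil normr1.
rewrite signature_rcons size_rcons exprSr; apply: RS_integral_bound => //.
  by move=> u v su uv vt; apply: (proj2 xV) => //; [exact: le_trans su|exact: le_trans tb].
move=> u su ut; apply: le_trans (IH u su (le_trans ut tb)) _.
have Vsu := dominated_path_mono i xV as_ su (le_trans ut tb).
have Vut := dominated_path_mono i xV (le_trans as_ su) ut tb.
by rewrite lerXn2r ?nnegrE ?subr_ge0// ?lerD2r// (le_trans Vsu).
Qed.

Lemma RS_integral_ucont (f g V : R -> R) a b : ucont a b f -> ucont a b g ->
  (forall u v, a <= u -> u <= v -> v <= b -> `|g v - g u| <= V v - V u) ->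
  ucont a b (fun t => RS_integral f g a t).
Proof.
move=> cf cg gV e e0.
have [ab|ba] := leP a b; last first.
  exists 1 => // u v au uv vb; move: ba; rewrite ltNge => /negP[].
  exact: le_trans au (le_trans uv vb).
have [B B0 fB] := ucont_bounded cf.
have V0 : 0 <= V b - V a by apply: le_trans (gV _ _ _ ab _).
have e10 : 0 < e / (2 * (V b - V a + 1)) by rewrite divr_gt0// mulr_gt0//; lra.
have e20 : 0 < e / (2 * (B + 1)) by rewrite divr_gt0// mulr_gt0//; lra.
have [h h0 hf] := cf _ e10; have [k k0 kg] := cg _ e20.
exists (Num.min h k) => [|u v au uv vb]; first by rewrite lt_min h0.
rewrite lt_min => /andP[vh vk].
have av := le_trans au uv; have ub := le_trans uv vb.
have gVs p q : a <= p -> q <= b ->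
    forall u v, p <= u -> u <= v -> v <= q -> `|g v - g u| <= V v - V u.
  by move=> ap qb z z' pz zz' zq; apply: gV => //; [exact: le_trans pz|exact: le_trans qb].
have cfs p q : a <= p -> q <= b -> ucont p q f by move=> ap qb; exact: ucont_sub cf.
have Iau := RS_integralP au (cfs _ _ (lexx a) ub) (gVs _ _ (lexx a) ub).
have Iuv := RS_integralP uv (cfs _ _ au vb) (gVs _ _ au vb).
have Iav := RS_integralP av (cfs _ _ (lexx a) vb) (gVs _ _ (lexx a) vb).
rewrite (RS_integral_split au uv Iau Iuv Iav) addrC addKr.
have Iuc := is_RS_integral_linear (-1) Iuv (is_RS_integral_cst g u v (f u)).
have osc : `|RS_integral (fun r => f r + -1 * f u) g u v| <=
    e / (2 * (V b - V a + 1)) * (V v - V u).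
  apply: RS_integral_bound => //; first exact: gVs.
  move=> r ur rv; rewrite mulN1r; apply: hf => //; first exact: le_trans rv vb.
  by apply: le_lt_trans vh; rewrite lerD2r.
rewrite (RS_integralE uv Iuc) in osc.
set I := RS_integral f g u v in osc *.
have -> : I = I + -1 * (f u * (g v - g u)) + f u * (g v - g u) by ring.
apply: le_trans (ler_normD _ _) _.
rewrite [e]splitr; apply: lerD.
  apply: le_trans osc _.
  have Vuv : V v - V u <= V b - V a.
    have := le_trans (normr_ge0 _) (gV a u (lexx _) au ub).
    have := le_trans (normr_ge0 _) (gV v b av vb (lexx _)); lra.
  have -> : e / (2 * (V b - V a + 1)) * (V v - V u) =
      e / 2 * ((V v - V u) / (V b - V a + 1)) by field; lra.
  by rewrite -[leRHS]mulr1 ler_pM2l ?divr_gt0// ler_pdivrMr ?mul1r; lra.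
rewrite normrM; apply: (@le_trans _ _ (B * (e / (2 * (B + 1))))).
  by rewrite ler_pM// ?fB// kg.
have -> : B * (e / (2 * (B + 1))) = e / 2 * (B / (B + 1)) by field; lra.
by rewrite -[leRHS]mulr1 ler_pM2l ?divr_gt0// ler_pdivrMr ?mul1r; lra.
Qed.

Lemma signature_ucont a b x V s w : dominated_path a b x V ->
  a <= s -> ucont s b (fun t => signature x s t w).
Proof.
move=> xV as_; have [cx gV] := dominated_path_sub as_ (lexx b) xV.
elim/last_ind: w => [|w i IH]; first exact: ucont_cst.
apply: (@eq_ucont _ s b (fun t => RS_integral (fun r => signature x s r w)
    (fun u => x u ord0 i) s t)) => [u _ _|]; first by rewrite signature_rcons.
exact: RS_integral_ucont (gV i).
Qed.

Lemma tmul_rcons (a b : tseries R m) w i : tmul a b (rcons w i) =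
  a (rcons w i) * b [::] + tmul a (fun v => b (rcons v i)) w.
Proof.
rewrite /tmul size_rcons big_ord_recr /= addrC; congr (_ + _).
  by rewrite -(size_rcons w i) take_size drop_size.
apply: eq_bigr => k _; have kw : (k <= size w)%N by rewrite -ltnS.
by rewrite -cats1 take_cat drop_cat; case: ltngtP kw => // [_ _|-> _];
  rewrite ?cats1// subnn take0 cats0 take_size drop0 drop_size.
Qed.

Lemma is_RS_integral_tmul (f : R -> tseries R m) (I : tseries R m)
    (g : R -> R) s t (c : tseries R m) w :
  (forall v, is_RS_integral (fun r => f r v) g s t (I v)) ->
  is_RS_integral (fun r => tmul c (f r) w) g s t (tmul c I w).
Proof.
move=> fI; rewrite /tmul.
have : forall r : seq 'I_(size w).+1, is_RS_integral
    (fun u => \sum_(k <- r) c (take k w) * f u (drop k w)) g s t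
    (\sum_(k <- r) c (take k w) * I (drop k w)).
  elim=> [|k r IH].
    have := is_RS_integral_cst g s t 0; rewrite mul0r big_nil.
    by under [X in _ -> is_RS_integral X _ _ _ _]eq_fun do rewrite big_nil.
  have := is_RS_integral_linear (c (take k w)) IH (fI (drop k w)).
  rewrite big_cons addrC.
  by under [X in _ -> is_RS_integral X _ _ _ _]eq_fun do rewrite big_cons addrC.
by apply.
Qed.

(** Induction on the last letter, whose integral over [s, t] is split at [r]. The piece before [r]
    is the term whose cut falls after the whole word; after [r] the induction hypothesis rewrites
    the integrand as a combination of signatures started at [r]. *)
Lemma chen a b x V s r t : dominated_path a b x V ->
  a <= s -> s <= r -> r <= t -> t <= b ->
  signature x s t = tmul (signature x s r) (signature x r t).
Proof.
move=> xV as_ sr rt tb; apply/funext => w; have ar := le_trans as_ sr.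
elim/last_ind: w t rt tb => [|w i IH] t rt tb; first by rewrite tmul_nil mulr1.
have st := le_trans sr rt; have rb := le_trans rt tb.
have P p q (f : R -> R) : a <= p -> p <= q -> q <= b -> ucont p q f ->
    is_RS_integral f (fun u => x u ord0 i) p q
      (RS_integral f (fun u => x u ord0 i) p q).
  move=> ap pq qb cf; apply: (RS_integralP (V := V)) => // u v pu uv vq.
  by apply: (proj2 xV) => //; [exact: le_trans pu|exact: le_trans qb].
have csig p q v : a <= p -> q <= b -> ucont p q (fun u => signature x p u v).
  by move=> ap qb; apply: ucont_sub (signature_ucont v xV ap).
have csr : ucont r t (fun u => signature x s u w).
  exact: ucont_sub (signature_ucont w xV as_).
rewrite tmul_rcons mulr1 !signature_rcons.
rewrite (RS_integral_split sr rt (P _ _ _ as_ sr rb (csig _ _ _ as_ rb))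
  (P _ _ _ ar rt tb csr) (P _ _ _ as_ st tb (csig _ _ _ as_ tb))).
congr (_ + _); apply: (RS_integralE rt).
have H : is_RS_integral (fun u => tmul (signature x s r) (signature x r u) w)
    (fun u => x u ord0 i) r t
    (tmul (signature x s r) (fun v => signature x r t (rcons v i)) w).
  apply: is_RS_integral_tmul => v; rewrite signature_rcons.
  by apply: P => //; exact: csig.
move=> e /H[h h0 {}H]; exists h => // p xi pp mp tp.
rewrite (_ : RS_sum _ _ _ _ _ = RS_sum (fun u =>
  tmul (signature x s r) (signature x r u) w) (fun u => x u ord0 i) r p xi).
  exact: H.
apply: eq_bigr => k _; rewrite IH//.
  have [rk _] := itv_partition_nth_bounds pp (ltn_ord k).
  by have /andP[+ _] := tp k (ltn_ord k); exact: le_trans.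
have [_ kt] := itv_partition_nth_bounds pp (ltn_ord k).
have /andP[_ +] := tp k (ltn_ord k) => /le_trans; apply; exact: le_trans tb.
Qed.

Lemma signature_incr a b x V s r t : dominated_path a b x V ->
  a <= s -> s <= r -> r <= t -> t <= b ->
  tmul (tinv (signature x s r)) (signature x s t) = signature x r t.
Proof.
by move=> xV as_ sr rt tb; rewrite (chen xV as_ sr rt tb) tmulA tmulVl// tmul1l.
Qed.

Lemma bv_path_dominated a b x : a <= b -> bv_path a b x ->
  exists V, [/\ dominated_path a b x V, 0 <= V a,
    ((V b)%:E <= path_length a b x)%E &
    forall u v, a <= u -> u <= v -> v <= b -> V u <= V v].
Proof.
move=> ab [cx lx].
have F0 u v : (0 <= (euclidean_norm (x v - x u))%:E)%E by rewrite lee_fin sqrtr_ge0.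
have [V [FV V0 Vb]] := control_of_partition_sums ab F0 lx.
exists V; split=> //; last first.
  move=> u v au; rewrite le_eqVlt => /predU1P[->//|uv] vb.
  by rewrite -subr_ge0 -lee_fin; apply: le_trans (FV u v au uv vb).
split=> [i|i u v au uv vb].
  apply: within_ucont => u; apply: (@continuous_comp (subspace `[a, b]) _ _ x
    (fun M : 'rV[R]_m => M ord0 i)); first exact: cx.
  exact: coord_continuous.
move: uv; rewrite le_eqVlt => /predU1P[->|uv]; first by rewrite !subrr normr0.
have := FV u v au uv vb; rewrite lee_fin; apply: le_trans.
rewrite /euclidean_norm -sqrtr_sqr ler_sqrt; last by apply: sumr_ge0 => j _; exact: sqr_ge0.
rewrite (bigD1 i)//= !mxE lerDl; apply: sumr_ge0 => j _; exact: sqr_ge0.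
Qed.

(** * The Carnot-Caratheodory distance and the coordinates *)

Lemma cc_norm_ge0 N (g : tseries R m) : (0 <= cc_norm N g)%E.
Proof.
apply: le_ereal_inf_tmp => _ [x _ <-]; apply: le_ereal_sup_tmp.
exists (partition_sum 0 [:: 1] (fun u v => (euclidean_norm (x v - x u))%:E)).
  by exists [:: 1] => //; exact: itv_partition1.
by apply: partition_sum_ge0 => u v; rewrite lee_fin sqrtr_ge0.
Qed.

(** The strict bound yields a path of length below [L] with step-[N] signature [g], to which
    [signature_bound] applies. The exponent records the homogeneity of the norm, which later turns
    p-variation into order [size w / p]. *)
Lemma cc_norm_coord N (g : tseries R m) L w : (cc_norm N g < L%:E)%E ->
  (size w <= N)%N -> `|g w| <= L ^+ size w.
Proof.
move=> /ereal_inf_lt[_ [x [bx <-] <-]] xL wN; rewrite ttrunc_le//.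
have [V [xV V0 V1 _]] := bv_path_dominated ler01 bx.
apply: le_trans (signature_bound w xV (lexx 0) ler01 (lexx 1)) _.
have {xL}V1L : V 1 < L by rewrite -lte_fin; exact: le_lt_trans xL.
case: w wN => // i w _.
have V01 := dominated_path_mono i xV (lexx 0) ler01 (lexx 1).
rewrite lerXn2r ?nnegrE ?subr_ge0//; first by rewrite (le_trans V0)// (le_trans V01)// ltW.
by rewrite lerBlDr (le_trans (ltW V1L))// lerDl.
Qed.

(** Here h is the product of the inverse of [a] with [b]. The cut after the last letter yields
    [a w]; every other suffix is nonempty, and there |h| is at most a positive power of [e], hence
    at most [e]. *)
Lemma cc_dist_coord N (a b : tseries R m) e w : a [::] = 1 -> b [::] = 1 ->
  (cc_dist N a b < e%:E)%E -> e <= 1 -> (size w <= N)%N ->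
  exists h : tseries R m, b w = a w + \sum_(k < size w) a (take k w) * h (drop k w)
    /\ forall k : 'I_(size w), `|h (drop k w)| <= e.
Proof.
move=> a1 b1 abe e1 wN; exists (tmul (tinv a) b); split.
  have -> : b w = tmul a (tmul (tinv a) b) w by rewrite tmulA tmulV// tmul1l.
  rewrite /tmul big_ord_recr /= take_size drop_size addrC; congr (_ + _).
  by rewrite big_ord1 /= b1 tinv_nil !mulr1.
move=> k; have kN : (size (drop k w) <= N)%N by rewrite size_drop (leq_trans (leq_subr _ _)).
have := cc_norm_coord abe kN; rewrite ttrunc_le// => /le_trans; apply.
have k0 : (0 < size (drop k w))%N by rewrite size_drop subn_gt0.
have e0 : 0 <= e by rewrite -lee_fin (le_trans (cc_norm_ge0 _ _) (ltW abe)).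
by rewrite -(prednK k0) exprS ler_piMr// exprn_ile1.
Qed.

Lemma cc_dist_close N (a b : tseries R m) e B : a [::] = 1 -> b [::] = 1 ->
  (cc_dist N a b < e%:E)%E -> 0 <= e -> e <= 1 ->
  (forall w, (size w <= N)%N -> `|a w| <= B) ->
  forall w, (size w <= N)%N -> `|b w - a w| <= N%:R * B * e.
Proof.
move=> a1 b1 abe e0 e1 aB w wN.
have [h [-> hE]] := cc_dist_coord a1 b1 abe e1 wN.
have B0 : 0 <= B by rewrite (le_trans _ (aB [::] _)).
rewrite addrC addKr (le_trans (ler_norm_sum _ _ _))//.
apply: (@le_trans _ _ (\sum_(k < size w) B * e)).
  apply: ler_sum => k _; rewrite normrM ler_pM//.
  by apply: aB; rewrite size_take_min geq_min wN orbT.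
by rewrite sumr_const card_ord -[leRHS]mulrA mulr_natl; apply: ler_wpMn2l; rewrite ?mulr_ge0.
Qed.

(** The expansion of [cc_dist_coord], solved for [a w], bounds |a w| by [B] plus the bounds at the
    proper prefixes, a recursion that [B * 2 ^+ k] solves. In this way approximating lifts inherit a
    bound from their limit. *)
Lemma cc_dist_bounded N (a b : tseries R m) B : a [::] = 1 -> b [::] = 1 ->
  (cc_dist N a b < 1)%E ->
  (forall w, (size w <= N)%N -> `|b w| <= B) ->
  forall w, (size w <= N)%N -> `|a w| <= B * 2 ^+ N.
Proof.
move=> a1 b1 abe bB.
have B0 : 0 <= B by rewrite (le_trans _ (bB [::] _)).
have geom n : \sum_(k < n) B * 2 ^+ k = B * 2 ^+ n - B :> R.
  elim: n => [|n IH]; first by rewrite big_ord0 mulr1 subrr.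
  by rewrite big_ord_recr /= IH exprS; ring.
have H n w : (size w <= n)%N -> (size w <= N)%N -> `|a w| <= B * 2 ^+ size w.
  elim: n w => [|n IH] w wn wN.
    by move: wn; rewrite leqn0 size_eq0 => /eqP ->; rewrite mulr1 a1 -b1 bB.
  have [h [bE hE]] := cc_dist_coord a1 b1 abe (lexx 1) wN.
  have -> : a w = b w - \sum_(k < size w) a (take k w) * h (drop k w).
    by rewrite bE addrK.
  rewrite (le_trans (ler_normB _ _))//.
  apply: (@le_trans _ _ (B + \sum_(k < size w) B * 2 ^+ k)); last by rewrite geom; lra.
  apply: lerD; first exact: bB.
  apply: le_trans (ler_norm_sum _ _ _) _; apply: ler_sum => k _.
  have szk : size (take k w) = k by rewrite size_takel// ltnW.
  rewrite normrM -[leRHS]mulr1 ler_pM//.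
  by rewrite -{2}szk IH// szk ?(leq_trans (ltnW (ltn_ord k)) wN)// -ltnS (leq_trans _ wn).
move=> w wN; apply: le_trans (H _ w (leqnn _) wN) _.
by rewrite ler_wpM2l// ler_weXn2l// ler1n.
Qed.

End SignatureOfBoundedVariationPaths.

(** * Approximation of a regular path by products of steps *)

Section SmallTriangularArrays.
Variable R : realType.
Implicit Types (a b : nat -> nat -> R).

(** Row [n] belongs to the partition of an interval into [n.+1] equal steps: boundedness and
    smallness range over its points, k <= n.+1, summability over its steps, k < n.+1. *)
Definition row_bounded a : Prop := exists C,
  \forall n \near \oo, forall k, (k <= n.+1)%N -> `|a n k| <= C.

Definition row_small a : Prop := forall e, 0 < e ->
  \forall n \near \oo, forall k, (k <= n.+1)%N -> `|a n k| <= e.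

Definition row_summable a : Prop := forall e, 0 < e ->
  \forall n \near \oo, \sum_(k < n.+1) `|a n k| <= e.

Lemma row_small_bounded a : row_small a -> row_bounded a.
Proof. by move=> /(_ 1 ltr01) a1; exists 1. Qed.

Lemma row_boundedD a b : row_bounded a -> row_bounded b ->
  row_bounded (fun n k => a n k + b n k).
Proof.
move=> [A aA] [B bB]; exists (A + B); near=> n => k kn.
rewrite (le_trans (ler_normD _ _))// lerD//.
  by move: k kn; near: n.
by move: k kn; near: n.
Unshelve. all: by end_near. Qed.

Lemma row_boundedM a b : row_bounded a -> row_bounded b ->
  row_bounded (fun n k => a n k * b n k).
Proof.
move=> [A aA] [B bB]; exists (A * B); near=> n => k kn.
rewrite normrM ler_pM//.
  by move: k kn; near: n.
by move: k kn; near: n.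
Unshelve. all: by end_near. Qed.

Lemma row_smallD a b : row_small a -> row_small b ->
  row_small (fun n k => a n k + b n k).
Proof.
move=> sa sb e e0; have e20 : 0 < e / 2 by rewrite divr_gt0.
have {}sa := sa _ e20; have {}sb := sb _ e20; near=> n => k kn.
rewrite (le_trans (ler_normD _ _))// [e]splitr lerD//.
  by move: k kn; near: n.
by move: k kn; near: n.
Unshelve. all: by end_near. Qed.

Lemma row_small_sum (I : Type) (r : seq I) (P : pred I) (a : I -> nat -> nat -> R) :
  (forall i, P i -> row_small (a i)) ->
  row_small (fun n k => \sum_(i <- r | P i) a i n k).
Proof.
move=> sa; elim: r => [|i r IH].
  by move=> e e0; near=> n => k _; rewrite big_nil normr0 ltW.
move=> e e0; have [Pi|nPi] := boolP (P i); last first.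
  have := IH e e0; apply: filterS => n H k kn.
  by rewrite big_cons (negbTE nPi) H.
have := row_smallD (sa i Pi) IH e0; apply: filterS => n H k kn.
by rewrite big_cons Pi H.
Unshelve. all: by end_near. Qed.

Lemma row_bounded_sum (I : Type) (r : seq I) (P : pred I) (a : I -> nat -> nat -> R) :
  (forall i, P i -> row_bounded (a i)) ->
  row_bounded (fun n k => \sum_(i <- r | P i) a i n k).
Proof.
move=> sa; elim: r => [|i r [C IH]].
  by exists 0; near=> n => k _; rewrite big_nil normr0.
have [Pi|nPi] := boolP (P i); last first.
  exists C; move: IH; apply: filterS => n H k kn.
  by rewrite big_cons (negbTE nPi) H.
have [D H] := row_boundedD (sa i Pi) (ex_intro _ C IH).
exists D; move: H; apply: filterS => n H k kn.
by rewrite big_cons Pi H.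
Unshelve. all: by end_near. Qed.

Lemma row_bounded_gt0 a : row_bounded a -> exists2 C, 0 < C &
  \forall n \near \oo, forall k, (k <= n.+1)%N -> `|a n k| <= C.
Proof.
move=> [C aC]; exists (`|C| + 1); first by rewrite ltr_wpDl.
apply: filterS aC => n aC k kn; rewrite (le_trans (aC k kn))//.
by rewrite (le_trans (ler_norm _))// lerDl.
Qed.

Lemma row_smallM a b : row_small a -> row_bounded b ->
  row_small (fun n k => a n k * b n k).
Proof.
move=> sa /row_bounded_gt0[B B0 bB] e e0.
have {}sa := sa _ (divr_gt0 e0 B0); near=> n => k kn.
rewrite normrM -[e](divfK (lt0r_neq0 B0)) ler_pM//.
  by move: k kn; near: n.
by move: k kn; near: n.
Unshelve. all: by end_near. Qed.

Lemma row_summableD a b : row_summable a -> row_summable b ->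
  row_summable (fun n k => a n k + b n k).
Proof.
move=> sa sb e e0; have e20 : 0 < e / 2 by rewrite divr_gt0.
have {}sa := sa _ e20; have {}sb := sb _ e20; near=> n.
apply: (@le_trans _ _ (\sum_(k < n.+1) (`|a n k| + `|b n k|))).
  by apply: ler_sum => k _; exact: ler_normD.
by rewrite big_split/= [e]splitr lerD//; near: n.
Unshelve. all: by end_near. Qed.

Lemma row_summable_sum (I : Type) (r : seq I) (P : pred I) (a : I -> nat -> nat -> R) :
  (forall i, P i -> row_summable (a i)) ->
  row_summable (fun n k => \sum_(i <- r | P i) a i n k).
Proof.
move=> sa; elim: r => [|i r IH].
  move=> e e0; near=> n; rewrite big1 ?ltW// => k _.
  by rewrite big_nil normr0.
move=> e e0; have [Pi|nPi] := boolP (P i); last first.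
  have := IH e e0; apply: filterS => n; apply: le_trans.
  by apply: ler_sum => k _; rewrite big_cons (negbTE nPi).
have := row_summableD (sa i Pi) IH e0; apply: filterS => n; apply: le_trans.
by apply: ler_sum => k _; rewrite big_cons Pi.
Unshelve. all: by end_near. Qed.

Lemma row_summableM a b C : row_summable a ->
  (\forall n \near \oo, forall k, (k < n.+1)%N -> `|b n k| <= C) ->
  row_summable (fun n k => b n k * a n k).
Proof.
move=> sa bC e e0; have B0 : 0 < `|C| + 1 by rewrite ltr_wpDl.
have {}sa := sa _ (divr_gt0 e0 B0); near=> n.
apply: (@le_trans _ _ ((`|C| + 1) * \sum_(k < n.+1) `|a n k|)).
  rewrite mulr_sumr; apply: ler_sum => k _; rewrite normrM ler_wpM2r//.
  apply: (@le_trans _ _ C); last by rewrite (le_trans (ler_norm _))// lerDl.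
  by case: k => k /=; move: k; near: n.
by rewrite mulrC -ler_pdivlMr//; near: n.
Unshelve. all: by end_near. Qed.

Lemma row_summable_partial_sums a : row_summable a ->
  row_small (fun n k => \sum_(j < k) a n j).
Proof.
move=> sa e /sa; apply: filterS => n H k kn; apply: le_trans H.
rewrite (le_trans (ler_norm_sum _ _ _))//.
rewrite (big_ord_widen _ (fun j => `|a n j|) kn) [leRHS](bigID (fun j : 'I_n.+1 => (j < k)%N)) /=.
by rewrite lerDl sumr_ge0.
Qed.

End SmallTriangularArrays.

Section RegularPaths.
Variables (R : realType) (m : nat) (T : R).
Implicit Types (Z : R -> tseries R m) (w : seq 'I_m) (D : R -> R -> R).

Definition regular_path Z : Prop :=
  (forall t, 0 <= t -> t <= T -> Z t [::] = 1) /\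
  forall w, ucont 0 T (fun t => Z t w).

Definition tincr Z u v : tseries R m := tmul (tinv (Z u)) (Z v).

Lemma ucont_tmul Z Z' : (forall w, ucont 0 T (fun t => Z t w)) ->
  (forall w, ucont 0 T (fun t => Z' t w)) ->
  forall w, ucont 0 T (fun t => tmul (Z t) (Z' t) w).
Proof. by move=> cZ cZ' w; apply: ucont_sum => k; exact: ucontM. Qed.

Lemma ucont_tinv Z : (forall w, ucont 0 T (fun t => Z t w)) ->
  forall w, ucont 0 T (fun t => tinv (Z t) w).
Proof.
move=> cZ w; apply: ucont_sum => k; move: {k}(nat_of_ord k) => k.
elim: k w => [|k IH] w /=; first exact: ucont_cst.
by apply: ucont_tmul => // v; apply: ucontD; [exact: ucont_cst|exact: ucontN].
Qed.

Lemma tincr_nil Z u v : regular_path Z -> 0 <= v -> v <= T -> tincr Z u v [::] = 1.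
Proof. by move=> [Z1 _] v0 vT; rewrite /tincr tmul_nil tinv_nil Z1// mulr1. Qed.

Lemma tincr_refl Z u : regular_path Z -> 0 <= u -> u <= T -> tincr Z u u = tone.
Proof. by move=> [Z1 _] u0 uT; rewrite /tincr tmulVl// Z1. Qed.

Lemma tincr_bounded Z w : regular_path Z -> exists2 C, 0 <= C &
  forall u v, 0 <= u -> u <= T -> 0 <= v -> v <= T -> `|tincr Z u v w| <= C.
Proof.
move=> [_ cZ]; rewrite /tincr /tmul.
elim: (index_enum _) => [|k r [C C0 H]].
  by exists 0 => // u v *; rewrite big_nil normr0.
have [A A0 hA] := ucont_bounded (ucont_tinv cZ (take k w)).
have [B B0 hB] := ucont_bounded (cZ (drop k w)).
exists (A * B + C) => [|u v u0 uT v0 vT]; first by rewrite addr_ge0// mulr_ge0.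
rewrite big_cons (le_trans (ler_normD _ _))// lerD ?H//.
by rewrite normrM ler_pM// ?hA// hB.
Qed.

(** Subtracting the increment over [u, u], which vanishes on [w], leaves in every term a uniformly
    small difference of values of [Z], multiplied by a bounded coordinate of [tinv (Z u)]. *)
Lemma tincr_small Z w e : regular_path Z -> w != [::] -> 0 < e ->
  exists2 h, 0 < h & forall u v, 0 <= u -> u <= v -> v <= T -> v - u < h ->
    `|tincr Z u v w| <= e.
Proof.
move=> rZ w0 e0; have [Z1 cZ] := rZ.
have diffE u v : 0 <= u -> u <= v -> v <= T -> tincr Z u v w =
    \sum_(k < (size w).+1) tinv (Z u) (take k w) * (Z v (drop k w) - Z u (drop k w)).
  move=> u0 uv vT; have uT := le_trans uv vT.
  rewrite -[LHS]subr0 [X in _ - X](_ : 0 = tincr Z u u w); last first.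
    by rewrite (tincr_refl rZ)// /tone (negbTE w0).
  by rewrite /tincr -tmulBr.
suff [h h0 H] : exists2 h, 0 < h & forall u v, 0 <= u -> u <= v -> v <= T -> v - u < h ->
    `|\sum_(k < (size w).+1) tinv (Z u) (take k w) * (Z v (drop k w) - Z u (drop k w))| <= e.
  by exists h => // u v u0 uv vT vu; rewrite diffE// H.
elim: (index_enum _) e e0 => [|k r IH] e e0.
  by exists 1 => // *; rewrite big_nil normr0 ltW.
have [A A0 hA] := ucont_bounded (ucont_tinv cZ (take k w)).
have A1 : 0 < A + 1 by lra.
have e20 : 0 < e / 2 by rewrite divr_gt0.
have [h h0 H] := IH _ e20; have [l l0 L] := cZ (drop k w) _ (divr_gt0 e20 A1).
exists (Num.min h l) => [|u v u0 uv vT]; first by rewrite lt_min h0.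
rewrite lt_min => /andP[vh vl]; rewrite big_cons (le_trans (ler_normD _ _))//.
rewrite [e]splitr lerD ?H// normrM.
apply: (@le_trans _ _ (A * (e / 2 / (A + 1)))).
  by rewrite ler_pM// ?hA ?L// (le_trans uv).
by rewrite mulrCA -[leRHS]mulr1 ler_pM2l// ler_pdivrMr// mul1r; lra.
Qed.

(** A little-o of the increments of a fixed [W]; these telescope along a partition, so the sum of
    the errors tends to 0. [W] may depend on the word: it will be a dominating [V], the time, or a
    p-variation control plus the time. *)
Definition negligible D : Prop := exists W : R -> R, forall e, 0 < e ->
  exists2 h, 0 < h & forall u v, 0 <= u -> u <= v -> v <= T -> v - u < h ->
    `|D u v| <= e * (W v - W u).

Lemma eq_negligible D D' :
  (forall u v, 0 <= u -> u <= v -> v <= T -> D u v = D' u v) ->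
  negligible D -> negligible D'.
Proof.
move=> DD' [W HW]; exists W => e /HW[h h0 H]; exists h => // u v u0 uv vT vu.
by rewrite -DD'// H.
Qed.

Lemma negligible0 : negligible (fun _ _ => 0).
Proof. by exists (fun=> 0) => e e0; exists 1 => // *; rewrite subrr mulr0 normr0. Qed.

Lemma negligibleN D : negligible D -> negligible (fun u v => - D u v).
Proof.
by move=> [W HW]; exists W => e /HW[h h0 H]; exists h => // *; rewrite normrN H.
Qed.

End RegularPaths.

Section EvenPartitions.
Variables (R : realType).
Implicit Types (s t T : R) (n k : nat).

Definition even_point s t n k : R := s + (t - s) * (k%:R / n.+1%:R).

Lemma even_point0 s t n : even_point s t n 0 = s.
Proof. by rewrite /even_point mul0r mulr0 addr0. Qed.

Lemma even_point_last s t n : even_point s t n n.+1 = t.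
Proof. by rewrite /even_point divff ?pnatr_eq0// mulr1 addrC subrK. Qed.

Lemma even_point_step s t n k :
  even_point s t n k.+1 - even_point s t n k = (t - s) / n.+1%:R.
Proof. by rewrite /even_point -natr1; ring. Qed.

Lemma even_point_leS s t n k : s <= t ->
  even_point s t n k <= even_point s t n k.+1.
Proof.
by move=> st; rewrite -subr_ge0 even_point_step divr_ge0// subr_ge0.
Qed.

Lemma even_point_ge s t n k : s <= t -> s <= even_point s t n k.
Proof. by move=> st; rewrite lerDl mulr_ge0 ?subr_ge0// divr_ge0. Qed.

Lemma even_point_le s t n k : s <= t -> (k <= n.+1)%N -> even_point s t n k <= t.
Proof.
move=> st kn; rewrite /even_point -lerBrDl ler_piMr ?subr_ge0//.
by rewrite ler_pdivrMr ?ltr0n// mul1r ler_nat.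
Qed.

Lemma even_mesh_near s t h : 0 < h -> \forall n \near \oo, (t - s) / n.+1%:R < h.
Proof.
move=> h0; near=> n; rewrite ltr_pdivrMr ?ltr0n// mulrC -ltr_pdivrMr//.
apply: le_lt_trans (_ : (Num.truncn ((t - s) / h)).+1%:R < _).
  by rewrite ltW// truncnS_gt.
by rewrite ltr_nat ltnS; near: n; exact: nbhs_infty_gt.
Unshelve. all: by end_near. Qed.

Lemma negligible_row_summable T (D : R -> R -> R) s t : negligible T D ->
  0 <= s -> s <= t -> t <= T ->
  row_summable (fun n k => D (even_point s t n k) (even_point s t n k.+1)).
Proof.
move=> [W HW] s0 st tT e e0.
have K0 : 0 < `|W t - W s| + 1 by rewrite ltr_wpDl.
have [h h0 H] := HW _ (divr_gt0 e0 K0); near=> n.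
apply: (@le_trans _ _ (\sum_(k < n.+1) e / (`|W t - W s| + 1) *
    (W (even_point s t n k.+1) - W (even_point s t n k)))).
  apply: ler_sum => k _; apply: H.
  - exact: le_trans (even_point_ge _ _ st).
  - exact: even_point_leS.
  - exact: le_trans (even_point_le st (ltn_ord k)) tT.
  - by rewrite even_point_step; near: n; exact: even_mesh_near.
rewrite -mulr_sumr -(big_mkord xpredT
  (fun k => W (even_point s t n k.+1) - W (even_point s t n k))).
rewrite telescope_sumr// even_point0 even_point_last.
apply: (@le_trans _ _ (e / (`|W t - W s| + 1) * `|W t - W s|)).
  by rewrite ler_wpM2l ?ler_norm// divr_ge0// ltW.
by rewrite -mulrA ler_piMr ?(ltW e0)// mulrC ler_pdivrMr// mul1r lerDl.
Unshelve. all: by end_near. Qed.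

End EvenPartitions.

Section Perturbation.
Variables (R : realType) (m : nat) (T : R).
Variables (Z : R -> tseries R m) (E : R -> R -> tseries R m).

Fixpoint step_product (t : R) (n k : nat) : tseries R m :=
  if k is k'.+1 then
    tmul (step_product t n k') (E (even_point 0 t n k') (even_point 0 t n k))
  else tone.

(* With D = tincr Z and F_k the product of the first k steps, F_k Z_k^-1 - 1 is
   the sum over j < k of F_j (E_j - D_j) Z_(j+1)^-1, whose coordinate w only
   involves coordinates of F_j of smaller length because E_j - D_j vanishes on
   the empty word; whence the induction on the length of w. *)
Lemma step_product_cvg t : regular_path T Z -> Z 0 = tone ->
  (forall u v, 0 <= u -> u <= v -> v <= T -> E u v [::] = 1) ->
  (forall w, negligible T (fun u v => E u v w - tincr Z u v w)) ->
  0 <= t -> t <= T ->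
  forall w, (step_product t n n.+1 w) @[n --> \oo] --> Z t w.
Proof.
move=> rZ Z0 E1 ED t0 tT; have [Z1 cZ] := rZ.
pose r n k := even_point 0 t n k; pose F n k := step_product t n k.
have rge n k : 0 <= r n k by exact: even_point_ge.
have rle n k : (k <= n.+1)%N -> r n k <= T.
  by move=> kn; exact: le_trans (even_point_le t0 kn) tT.
pose X n k : tseries R m := tmul (fun w => E (r n k) (r n k.+1) w -
  tincr Z (r n k) (r n k.+1) w) (tinv (Z (r n k.+1))).
have rS n k : r n k <= r n k.+1 by exact: even_point_leS.
have X0 n k : (k < n.+1)%N -> X n k [::] = 0.
  move=> kn; rewrite /X tmul_nil E1//; last exact: rle.
  by rewrite (tincr_nil _ rZ) ?subrr ?mul0r//; exact: rle.
have Zb w : row_bounded (fun n k => Z (r n k) w).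
  have [C _ H] := ucont_bounded (cZ w); exists C; near=> n => k kn.
  by apply: H => //; exact: rle.
have Xs w : row_summable (fun n k => X n k w).
  rewrite /X /tmul; apply: row_summable_sum => b _.
  have [C _ H] := ucont_bounded (ucont_tinv cZ (drop b w)).
  have /row_summableM := negligible_row_summable (ED (take b w)) (lexx 0) t0 tT.
  move=> /(_ (fun n k => tinv (Z (r n k.+1)) (drop b w)) C).
  have Cn : \forall n \near \oo, forall k, (k < n.+1)%N ->
      `|tinv (Z (r n k.+1)) (drop b w)| <= C.
    by near=> n => k kn; apply: H => //; exact: rle.
  move=> /(_ Cn); congr row_summable.
  by apply/funext => n; apply/funext => k; rewrite mulrC.
have telE n k : (k <= n.+1)%N -> tmul (F n k) (tinv (Z (r n k))) =
    fun w => tone w + \sum_(j < k) tmul (F n j) (X n j) w.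
  elim: k => [|k IH] kn; apply/funext => w.
    by rewrite big_ord0 addr0 /F /= /r even_point0 Z0 tinv1 tmul1l.
  have {}IH := IH (ltnW kn).
  rewrite big_ord_recr /= addrA -[X in X + _](congr1 (@^~ w) IH) -/(r n k).
  rewrite /X /F /= -/(F n k) -/(r n k) -/(r n k.+1).
  have -> : tinv (Z (r n k)) = tmul (tincr Z (r n k) (r n k.+1)) (tinv (Z (r n k.+1))).
    by rewrite /tincr -tmulA tmulV ?tmul1r// Z1//; exact: rle.
  rewrite -tmulA; set Zi := tinv _.
  have -> : tmul (fun v => E (r n k) (r n k.+1) v - tincr Z (r n k) (r n k.+1) v) Zi =
      fun v => tmul (E (r n k) (r n k.+1)) Zi v - tmul (tincr Z (r n k) (r n k.+1)) Zi v.
    by apply/funext => v; rewrite tmulBl.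
  by rewrite tmulBr addrCA subrr addr0.
pose H n k : tseries R m := fun w => \sum_(j < k) tmul (F n j) (X n j) w.
(* Multiplying [telE] on the right by [Z] shows that [F] is bounded on [w] as soon as [H] is small
   on words no longer than [w]; the induction alternates between the two. *)
have FE n k : (k <= n.+1)%N -> forall w, F n k w = Z (r n k) w + tmul (H n k) (Z (r n k)) w.
  move=> kn w; have ZV := tmulVl (Z1 _ (rge n k) (rle _ _ kn)).
  rewrite -[F n k]tmul1r -ZV tmulA (telE _ _ kn) -[in X in _ = X + _](tmul1l (Z (r n k))).
  by rewrite /tmul -big_split /=; apply: eq_bigr => j _; rewrite mulrDl.
have Fb w : (forall v, (size v <= size w)%N -> row_small (fun n k => H n k v)) ->
    row_bounded (fun n k => F n k w).
  move=> sH.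
  have [C HC] : row_bounded (fun n k => Z (r n k) w + tmul (H n k) (Z (r n k)) w).
    apply: row_boundedD => //; apply: row_bounded_sum => b _.
    apply: row_boundedM => //; apply: row_small_bounded; apply: sH.
    by rewrite size_take_min geq_minr.
  by exists C; apply: filterS HC => n HC k kn; rewrite FE// HC.
have sH w : row_small (fun n k => H n k w).
  have [n] := ubnP (size w); elim: n w => // n IH w; rewrite ltnS => wn.
  have -> : (fun n k => H n k w) = fun n k =>
      \sum_(b < (size w).+1) \sum_(j < k) F n j (take b w) * X n j (drop b w).
    by apply/funext => N; apply/funext => k; rewrite exchange_big.
  apply: row_small_sum => b _.
  apply: (row_summable_partial_sums (a := fun n j => F n j (take b w) * X n j (drop b w))).
  have [bw|] := ltnP b (size w); last first.
    move=> wb e e0; near=> N; rewrite big1 ?ltW// => k _.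
    by rewrite drop_oversize// X0// mulr0 normr0.
  have szb : size (take b w) = b by rewrite size_takel// ltnW.
  have [C FC] : row_bounded (fun n k => F n k (take b w)).
    apply: Fb => v; rewrite szb => vb; apply: IH.
    by rewrite (leq_ltn_trans vb)// (leq_trans bw).
  apply: (row_summableM (C := C)) => //.
  by move: FC; apply: filterS => N HN k kN; exact/HN/ltnW.
move=> w; apply/cvgrPdist_le => e e0.
have sHZ : row_small (fun n k => tmul (H n k) (Z (r n k)) w).
  by apply: row_small_sum => b _; exact: row_smallM.
apply: filterS (sHZ e e0) => n Hn; have := Hn n.+1 (leqnn _).
rewrite -/(F n n.+1) FE// /r even_point_last distrC [Z t w + _]addrC addrK.
by [].
Unshelve. all: by end_near. Qed.

End Perturbation.

(** * Words containing the time letter *)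

Section TimeLetter.
Variables (R : realType) (m : nat).

(** The triple product expands over pairs of cuts i <= j. The first sum keeps the pairs with i <= q,
    the second those with j <= q, so the difference keeps i <= q < j. Applied to three consecutive
    signatures, this is the increment of a partial Chen sum when the intermediate time moves by one
    step. *)
Lemma tmul_cut (a b c : tseries R m) (v : seq 'I_m) q : (q <= size v)%N ->
  \sum_(i < q.+1) a (take i v) * tmul b c (drop i v) -
  \sum_(j < q.+1) tmul a b (take j v) * c (drop j v) =
  \sum_(i < (size v).+1 | (i <= q)%N) \sum_(j < (size v).+1 | (q < j)%N)
    a (take i v) * b (drop i (take j v)) * c (drop j v).
Proof.
move=> qv; pose n := (size v).+1.
pose t i j := a (take i v) * b (drop i (take j v)) * c (drop j v).
have bcE (i : 'I_n) : a (take i v) * tmul b c (drop i v) =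
    \sum_(j < n | (i <= j)%N) t i j.
  have -> : \sum_(j < n | (i <= j)%N) t i j = \sum_(0 + i <= j < n) t i j.
    by rewrite add0n big_geq_mkord.
  rewrite big_addn big_mkord /tmul mulr_sumr size_drop -subSn; last by rewrite -ltnS.
  by apply: eq_bigr => k _; rewrite /t mulrA drop_drop take_drop.
have abE (j : 'I_n) : tmul a b (take j v) * c (drop j v) =
    \sum_(i < n | (i <= j)%N) t i j.
  have sj : size (take j v) = j by rewrite size_takel// -ltnS.
  rewrite /tmul mulr_suml sj.
  rewrite (big_ord_widen n
    (fun k => a (take k (take j v)) * b (drop k (take j v)) * c (drop j v))) //.
  by apply: eq_bigr => i ij; rewrite take_takel.
have widen (F : nat -> R) : \sum_(i < q.+1) F i = \sum_(i < n | (i <= q)%N) F i.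
  by rewrite (big_ord_widen n).
rewrite (widen (fun i => a (take i v) * tmul b c (drop i v))).
rewrite (widen (fun j => tmul a b (take j v) * c (drop j v))).
rewrite (eq_bigr _ (fun i _ => bcE i)) (eq_bigr _ (fun j _ => abE j)).
have -> : \sum_(j < n | (j <= q)%N) \sum_(i < n | (i <= j)%N) t i j =
    \sum_(i < n | (i <= q)%N) \sum_(j < n | (i <= j)%N && (j <= q)%N) t i j.
  rewrite (exchange_big_dep (fun i : 'I_n => (i <= q)%N)) /=; last first.
    by move=> j i jq ij; exact: leq_trans jq.
  by apply: eq_bigr => i _; apply: eq_bigl => j; rewrite andbC.
rewrite -sumrB; apply: eq_bigr => i iq.
rewrite (bigID (fun j : 'I_n => (j <= q)%N)) /= addrC addrK.
apply: eq_bigl => j; rewrite -ltnNge.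
by case: ltnP; rewrite ?andbF// andbT => qj; rewrite (leq_trans iq)// ltnW.
Qed.

End TimeLetter.

Section TimeLetterBound.
Variables (R : realType) (d : nat) (T : R).
Variables (x : R -> 'rV[R]_d.+1) (V : R -> R).
Hypothesis xV : dominated_path 0 T x V.
Hypothesis xt : forall u, 0 <= u -> u <= T -> x u ord0 ord0 = u.

Let sig : R -> tseries R d.+1 := signature x 0.

Lemma regular_signature : regular_path T sig.
Proof. by split=> // w; exact: signature_ucont xV (lexx 0). Qed.

Lemma tincr_signature u v : 0 <= u -> u <= v -> v <= T ->
  tincr sig u v = signature x u v.
Proof. by move=> u0 uv vT; exact: signature_incr xV (lexx 0) u0 uv vT. Qed.

Lemma signature_refl u : 0 <= u -> u <= T -> signature x u u = tone.
Proof.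
by move=> u0 uT; rewrite -tincr_signature// (tincr_refl regular_signature).
Qed.

Lemma signature_letter i u v : u <= v ->
  signature x u v [:: i] = x v ord0 i - x u ord0 i.
Proof.
move=> uv; rewrite (signature_rcons x u v [::] i).
by rewrite (RS_integralE uv (is_RS_integral_cst _ _ _ 1)) mul1r.
Qed.

(** Once the last letter is split off, the integrand is the coordinate of a nonempty word, hence
    small on a short interval, and it is integrated against a path dominated by [V]. *)
Lemma signature_negligible w : (1 < size w)%N ->
  negligible T (fun u v => signature x u v w).
Proof.
case/lastP: w => // w i; rewrite size_rcons ltnS => w0.
have wn0 : w != [::] by rewrite -size_eq0 -lt0n.
exists V => e e0; have [h h0 H] := tincr_small regular_signature wn0 e0.
exists h => // u v u0 uv vT vu; rewrite signature_rcons; apply: RS_integral_bound => //.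
  by move=> y z uy yz zv; apply: (proj2 xV) => //; [exact: le_trans uy|exact: le_trans vT].
move=> r ur rv; rewrite -tincr_signature//; last exact: le_trans vT.
by apply: H => //; [exact: le_trans vT|rewrite (le_lt_trans _ vu)// lerD2r].
Qed.

(* The integral of S_(s,r)(u) S_(r,t)(u') dr over [s, t] is the coordinate
   u 0 u' of S_(s,t); the cut of u 0 u' at a length at most |u| telescopes
   along a fine partition, and each step is S_(s,r)(u) dr S_(r,t)(u') up to
   summably small terms. *)
Lemma signature_time_letter s t u u' B B' : 0 <= s -> s <= t -> t <= T ->
  (forall a b, s <= a -> a <= b -> b <= t -> `|signature x a b u| <= B) ->
  (forall a b, s <= a -> a <= b -> b <= t -> `|signature x a b u'| <= B') ->
  `|signature x s t (u ++ ord0 :: u')| <= (t - s) * (B * B').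
Proof.
move=> s0 st tT hB hB'; set v := u ++ ord0 :: u'; set q := size u.
have sv : size v = (q + (size u').+1)%N by rewrite size_cat.
have qv : (q <= size v)%N by rewrite sv leq_addr.
have v0 : v != [::] by rewrite -size_eq0 sv addnS.
have sT : s <= T by exact: le_trans tT.
have t0 : 0 <= t by exact: le_trans st.
pose S := signature x.
pose r n k := even_point s t n k.
have rge n k : s <= r n k by exact: even_point_ge.
have rle n k : (k <= n.+1)%N -> r n k <= t by exact: even_point_le.
have rS n k : r n k <= r n k.+1 by exact: even_point_leS.
pose Phi y := \sum_(i < q.+1) S s y (take i v) * S y t (drop i v).
have Phi_s : Phi s = S s t v.
  rewrite /Phi big_ord_recl take0 drop0 {1}/S signature_nil mul1r big1 ?addr0// => i _.
  rewrite lift0 /S signature_refl// /tone -size_eq0 size_takel ?mul0r//.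
  exact: leq_trans (ltn_ord i) qv.
have Phi_t : Phi t = 0.
  rewrite /Phi big1// => i _; rewrite /S signature_refl// /tone -size_eq0 size_drop.
  rewrite subn_eq0 leqNgt (leq_trans (ltn_ord i)) ?mulr0//.
  by rewrite sv addnS ltnS leq_addr.
pose n1 := (size v).+1.
pose tm n k (i j : nat) := S s (r n k) (take i v) *
  S (r n k) (r n k.+1) (drop i (take j v)) * S (r n k.+1) t (drop j v).
(* The pair (q, q + 1) leaves exactly the time letter in the middle factor. Every other pair with i
   <= q < j leaves at least two letters there, hence a negligible increment. *)
pose other (ij : 'I_n1 * 'I_n1) :=
  [&& (ij.1 <= q)%N, (q < ij.2)%N & ~~ ((ij.1 == q :> nat) && (ij.2 == q.+1 :> nat))].
have qn1 : (q < n1)%N by rewrite ltnS.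
have q1n1 : (q.+1 < n1)%N by rewrite /n1 ltnS sv addnS ltnS leq_addr.
have stepE n k : (k < n.+1)%N -> Phi (r n k) - Phi (r n k.+1) =
    S s (r n k) u * (r n k.+1 - r n k) * S (r n k.+1) t u' +
    \sum_(ij | other ij) tm n k ij.1 ij.2.
  move=> kn; rewrite /Phi.
  have r0 l : 0 <= r n l by exact: le_trans (rge n l).
  have rt : r n k.+1 <= t by exact: rle.
  under eq_bigr do rewrite /S (chen xV (r0 k) (rS n k) rt tT).
  under [X in _ - X]eq_bigr do rewrite /S (chen xV s0 (rge n k) (rS n k) (le_trans rt tT)).
  rewrite (tmul_cut _ _ _ qv) pair_big_dep /=.
  rewrite (bigD1 (Ordinal qn1, Ordinal q1n1)) /=; last by rewrite leqnn ltnSn.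
  congr (_ + _).
    have -> : take q v = u by rewrite take_size_cat.
    have -> : drop q.+1 v = u'.
      by rewrite /v -cat1s catA drop_size_cat// size_cat addn1.
    have -> : drop q (take q.+1 v) = [:: ord0].
      by rewrite /v -cat1s catA take_size_cat ?size_cat ?addn1// drop_size_cat.
    have rT := le_trans rt tT.
    by rewrite signature_letter// !xt// (le_trans (rS n k)).
  by apply: eq_bigl => -[i j]; rewrite /other /= andbA xpair_eqE -!val_eqE.
have telE n : S s t v = \sum_(k < n.+1) (Phi (r n k) - Phi (r n k.+1)).
  rewrite (eq_bigr (fun k : 'I_n.+1 => - (Phi (r n k.+1) - Phi (r n k)))) => [|k _].
    rewrite sumrN -(big_mkord xpredT (fun k => Phi (r n k.+1) - Phi (r n k))).
    by rewrite telescope_sumr// /r even_point0 even_point_last Phi_t Phi_s sub0r opprK.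
  by rewrite opprB.
have bnd a b w : 0 <= a -> a <= b -> b <= T ->
    `|S a b w| <= (`|V T - V 0|) ^+ size w.
  move=> a0 ab bT; apply: le_trans (signature_bound w xV a0 ab bT) _.
  case: w => // i w.
  have V1 := dominated_path_mono ord0 xV (lexx 0) a0 (le_trans ab bT).
  have V2 := dominated_path_mono ord0 xV a0 ab bT.
  have V3 := dominated_path_mono ord0 xV (le_trans a0 ab) bT (lexx T).
  rewrite lerXn2r ?nnegrE ?subr_ge0// ger0_norm ?subr_ge0; lra.
have rest : row_summable (fun n k => \sum_(ij | other ij) tm n k ij.1 ij.2).
  apply: row_summable_sum => -[i j] /and3P[/= iq qj ij].
  have sz : (1 < size (drop i (take j v)))%N.
    have jv : (j <= size v)%N by rewrite -ltnS.
    rewrite size_drop size_takel// ltn_subRL addn1; move: ij.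
    move: iq; rewrite leq_eqVlt => /predU1P[->|iq _]; last exact: leq_ltn_trans iq qj.
    by rewrite eqxx /= => jq; rewrite ltn_neqAle eq_sym jq.
  have H1 := negligible_row_summable (signature_negligible sz) s0 st tT.
  have Cn1 : \forall n \near \oo, forall k, (k < n.+1)%N ->
      `|S s (r n k) (take i v)| <= (`|V T - V 0|) ^+ size (take i v).
    near=> n => k kn; apply: bnd => //; exact: le_trans (rle _ _ (ltnW kn)) tT.
  have Cn2 : \forall n \near \oo, forall k, (k < n.+1)%N ->
      `|S (r n k.+1) t (drop j v)| <= (`|V T - V 0|) ^+ size (drop j v).
    near=> n => k kn; apply: bnd => //; last exact: rle.
    exact: le_trans (rge _ _).
  have := row_summableM (row_summableM H1 Cn1) Cn2; congr row_summable.
  by apply/funext => n; apply/funext => k; rewrite /tm mulrC.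
(* [V] enters only through the choice of [n]; as e is arbitrary, the final bound keeps no trace of
   it. *)
apply/ler_addgt0Pr => e e0; have {rest} := rest e e0.
move=> /filter_ex[n Hn]; rewrite -[signature x s t v]/(S s t v) (telE n).
have rT k : (k <= n.+1)%N -> r n k <= T by move=> kn; rewrite (le_trans _ tT)// rle.
rewrite (le_trans (ler_norm_sum _ _ _))//.
have BB0 : 0 <= B * B'.
  by apply: mulr_ge0; apply: le_trans (normr_ge0 (signature x s s _)) _; [exact: hB|exact: hB'].
apply: (@le_trans _ _ (\sum_(k < n.+1) ((B * B') * (r n k.+1 - r n k) +
    `|\sum_(ij | other ij) tm n k ij.1 ij.2|))).
  apply: ler_sum => k _; rewrite stepE// (le_trans (ler_normD _ _))// lerD2r.
  rewrite !normrM (@ger0_norm _ (r n k.+1 - r n k)) ?subr_ge0// mulrAC.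
  rewrite ler_wpM2r ?subr_ge0// ler_pM//.
    by apply: hB => //; apply: rle; rewrite ltnW.
  by apply: hB' => //; apply: rle.
rewrite big_split /= lerD// -mulr_sumr.
rewrite -(big_mkord xpredT (fun k => r n k.+1 - r n k)) telescope_sumr//.
by rewrite /r even_point0 even_point_last mulrC.
Unshelve. all: by end_near. Qed.

End TimeLetterBound.

(** * Variation controls and time augmentation *)

Section PVariation.
Variable R : realType.
Implicit Types (p T e u v : R) (G : R -> R -> \bar R).

Lemma pvar_control p T G : 0 < p -> 0 <= T ->
  (ereal_sup [set partition_sum 0%R s (fun u v => G u v `^ p)
             | s in itv_partition 0%R T] `^ p^-1 < +oo)%E ->
  exists W : R -> R, forall u v, 0 <= u -> u < v -> v <= T ->
    (G u v `^ p <= (W v - W u)%:E)%E.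
Proof.
move=> p0 T0 /lty_poweRy; rewrite invr_eq0 gt_eqF// => /(_ isT) Soo.
have Gp0 u v : (0 <= G u v `^ p)%E by exact: poweR_ge0.
by have [W [H _ _]] := control_of_partition_sums T0 Gp0 Soo; exists W.
Qed.

(** A cell [u, v] alone is not a partition of [0, T]; the monotone control of the partition sums
    bounds its contribution by the supremum over [0, T]. The rest undoes the powers p and 1/p in the
    extended reals. *)
Lemma pvar_cell p T G e u v : 0 < p -> 0 < e -> (forall u v, (0 <= G u v)%E) ->
  (ereal_sup [set partition_sum 0%R s (fun u v => G u v `^ p)
             | s in itv_partition 0%R T] `^ p^-1 < e%:E)%E ->
  0 <= u -> u < v -> v <= T -> (G u v < e%:E)%E.
Proof.
move=> p0 e0 G0; set S := ereal_sup _ => Se u0 uv vT.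
have T0 : 0 <= T by rewrite (le_trans u0)// (le_trans (ltW uv)).
have S0 : (0 <= S)%E.
  move: T0; rewrite le_eqVlt => /predU1P[T0|T0].
    apply: ereal_sup_ubound; exists [::]; first by rewrite -T0.
    by rewrite /partition_sum big_ord0.
  apply: (@le_trans _ _ (partition_sum 0 [:: T] (fun u v => G u v `^ p)%E)).
    by apply: partition_sum_ge0 => *; exact: poweR_ge0.
  by apply: ereal_sup_ubound; exists [:: T] => //; exact: itv_partition1.
have Sep : (S < (e `^ p)%:E)%E.
  rewrite ltNge; apply/negP => eS; move: Se; rewrite ltNge => /negP; apply.
  have := @gt0_ler_poweR R p^-1; rewrite invr_ge0 (ltW p0) => /(_ isT).
  move=> /(_ (e `^ p)%:E S); rewrite !in_itv/= !leey !andbT lee_fin powR_ge0 S0.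
  move=> /(_ isT isT eS) /=; rewrite -powRrM divff ?gt_eqF// powRr1//.
  exact: ltW.
have Soo : (S < +oo)%E by rewrite (lt_trans Sep) ?ltry.
have Gp0 a b : (0 <= G a b `^ p)%E by exact: poweR_ge0.
have [W [H W0 WS]] := control_of_partition_sums T0 Gp0 Soo.
have {}H' := H u v u0 uv vT.
have mono a b : 0 <= a -> a <= b -> b <= T -> W a <= W b.
  move=> a0; rewrite le_eqVlt => /predU1P[->//|ab] bT.
  by rewrite -subr_ge0 -lee_fin; apply: le_trans (H a b a0 ab bT).
have GS : (G u v `^ p < (e `^ p)%:E)%E.
  apply: le_lt_trans H' (le_lt_trans _ (le_lt_trans WS Sep)).
  have := mono 0 u (lexx 0) u0 (le_trans (ltW uv) vT).
  have := mono v T (le_trans u0 (ltW uv)) vT (lexx T).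
  by rewrite lee_fin; lra.
rewrite ltNge; apply/negP => eG; move: GS; rewrite ltNge => /negP; apply.
rewrite -poweR_EFin; apply: (gt0_ler_poweR (ltW p0)) => //.
  by rewrite in_itv/= leey andbT lee_fin ltW.
by rewrite in_itv/= leey andbT.
Qed.

End PVariation.

Section AugmentedSignature.
Variables (R : realType) (d : nat).

Lemma eq_incr_tincr (m N : nat) (X Z : R -> tseries R m) u v w :
  (forall w', (size w' <= N)%N -> X u w' = Z u w') ->
  (forall w', (size w' <= N)%N -> X v w' = Z v w') ->
  (size w <= N)%N -> incr N X u v w = tincr Z u v w.
Proof.
move=> Xu Xv wN; rewrite /incr ttrunc_le//; apply: (@eq_tmul_le _ _ N) => //.
by apply: eq_tinv_le.
Qed.

(** There are finitely many words of at most [N] letters; the induction removes the first letter and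
    adds up the bounds over the alphabet. *)
Lemma words_uniform_bound (A : Type) (m N : nat) (f : A -> tseries R m) :
  (forall w, exists C, forall x, `|f x w| <= C) ->
  exists C, forall x w, (size w <= N)%N -> `|f x w| <= C.
Proof.
elim: N f => [|N IH] f fC.
  by have [C HC] := fC [::]; exists C => x [].
have /fin_all_exists[C HC] : forall i : 'I_m, exists C, forall x w,
    (size w <= N)%N -> `|f x (i :: w)| <= C.
  by move=> i; apply: (IH (fun x w => f x (i :: w))) => w; exact: fC.
have [C0 HC0] := fC [::].
exists (`|C0| + \sum_i `|C i|) => x [_|i w wN].
  by rewrite (le_trans (HC0 x))// (le_trans (ler_norm _))// lerDl sumr_ge0.
rewrite (le_trans (HC i x w wN))// (le_trans (ler_norm _))// (bigD1 i)//=.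
by rewrite addrCA lerDl addr_ge0// sumr_ge0.
Qed.

Lemma time_augment_dominated T (x : R -> 'rV[R]_d) : 0 <= T -> bv_path 0 T x ->
  exists V, dominated_path 0 T (time_augment x) V.
Proof.
move=> T0 /(bv_path_dominated T0)[V [[cx xV] _ _ mV]].
have time_coord u : time_augment x u ord0 ord0 = u by rewrite mxE unlift_none.
have space_coord u i : time_augment x u ord0 (lift ord0 i) = x u ord0 i.
  by rewrite mxE liftK.
exists (fun u => V u + u); split=> [i|i u v u0 uv vT].
  have [j ->|->] := unliftP ord0 i.
    by apply: (@eq_ucont _ _ _ (fun u => x u ord0 j)) => // u _ _; rewrite space_coord.
  apply: (@eq_ucont _ _ _ id) => [u _ _|]; first by rewrite time_coord.
  by move=> e e0; exists e => // u v _ uv _ /ltW; rewrite ger0_norm ?subr_ge0.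
have [j ->|->] := unliftP ord0 i.
  by rewrite !space_coord (le_trans (xV j u v u0 uv vT))//; lra.
rewrite !time_coord ger0_norm ?subr_ge0//.
by have := mV u v u0 uv vT; lra.
Qed.

End AugmentedSignature.

(** * Approximation of the signature of an augmented rough path *)

Definition euler_step (R : realType) (d N : nat) (X : R -> tseries R d)
    (u v : R) : tseries R d.+1 :=
  fun w => if w == [:: ord0] then v - u
           else if ord0 \in w then 0
           else incr N X u v (pmap (unlift ord0) w).

Section AugmentedSignatureApproximation.
Variables (R : realType) (d N : nat) (p T : R).
Variables (X : R -> tseries R d) (Xhat Z : R -> tseries R d.+1).
Hypotheses (p0 : 0 < p) (pN : p < N.+1%:R) (N0 : (0 < N)%N) (T0 : 0 <= T).
Hypothesis rZ : regular_path T Z.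
Hypothesis Zhat : forall t, 0 <= t -> t <= T ->
  forall w, (size w <= N)%N -> Xhat t w = Z t w.
Hypothesis hatX : forall t, 0 <= t -> t <= T ->
  forall w, Xhat t (map (lift ord0) w) = X t w.
Hypothesis Zpvar : forall n, (N <= n)%N ->
  (pvar_norm n p 0 T (fun t => ttrunc n (Z t)) < +oo)%E.
Variables (x : nat -> R -> 'rV[R]_d.+1).
Hypothesis xdom : forall k, exists V, dominated_path 0 T (x k) V.
Hypothesis xtime : forall k u, 0 <= u -> u <= T -> x k u ord0 ord0 = u.
Hypothesis xcvg :
  pvar_dist N p 0 T (lift_path N (x k)) Xhat @[k --> \oo] --> (0 : \bar R)%E.

Let D := tincr Z.

(** A small p-variation distance makes all increments of the lift close to those of [Xhat], first
    for the Carnot-Caratheodory distance and then coordinatewise. The constants depend only on [N]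
    and on bounds for [Z], so one index [k] serves all u <= v. *)
Lemma signature_approx e : 0 < e -> exists k, forall u v, 0 <= u -> u <= v ->
  v <= T -> forall w, (size w <= N)%N -> `|signature (x k) u v w - D u v w| <= e.
Proof.
move=> e0.
(* The value 0 outside the square is there because [words_uniform_bound] ranges over all points of a
   type. *)
pose f (uv : R * R) : tseries R d.+1 := fun w =>
  if [&& 0 <= uv.1, uv.1 <= T, 0 <= uv.2 & uv.2 <= T] then D uv.1 uv.2 w else 0.
have [B HB] : exists C, forall uv w, (size w <= N)%N -> `|f uv w| <= C.
  apply: words_uniform_bound => w; have [C C0 HC] := tincr_bounded w rZ.
  exists C => uv; rewrite /f; case: ifPn => [/and4P[? ? ? ?]|_]; first exact: HC.
  by rewrite normr0.
have B0 : 0 <= B by exact: le_trans (normr_ge0 _) (HB (0, 0) [::] isT).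
have K0 : 0 < N%:R * (B * 2 ^+ N) + 1 by rewrite ltr_wpDl// !mulr_ge0.
pose e' := Num.min 1 (e / (N%:R * (B * 2 ^+ N) + 1)).
have e'0 : 0 < e' by rewrite lt_min ltr01 divr_gt0.
have e'1 : e' <= 1 by rewrite ge_min lexx.
have /fine_cvgP[xfin /cvgrPdist_lt /(_ e' e'0) xlt] := xcvg.
have [k [kfin klt]] := filter_ex (filterI xfin xlt); exists k => u v u0 uv vT w wN.
have [V xV] := xdom k; have uT := le_trans uv vT; have v0 := le_trans u0 uv.
move: uv; rewrite le_eqVlt => /predU1P[uv|uv].
  by rewrite -uv (signature_refl xV)// /D (tincr_refl rZ)// subrr normr0 ltW.
have ke' : (pvar_dist N p 0 T (lift_path N (x k)) Xhat < e'%:E)%E.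
  rewrite -(fineK kfin) lte_fin; apply: le_lt_trans klt.
  by rewrite sub0r normrN ler_norm.
have G0 a b : (0 <= cc_dist N (incr N (lift_path N (x k)) a b) (incr N Xhat a b))%E.
  exact: cc_norm_ge0.
have := pvar_cell p0 e'0 G0 ke' u0 uv vT.
set a := incr N _ u v; set b := incr N _ u v => ab.
have aE w' : (size w' <= N)%N -> a w' = signature (x k) u v w'.
  move=> w'N; rewrite /a (@eq_incr_tincr _ _ _ _ (signature (x k) 0))//.
  - by rewrite (tincr_signature xV)// ltW.
  - by move=> v' v'N; rewrite /lift_path ttrunc_le.
  - by move=> v' v'N; rewrite /lift_path ttrunc_le.
have bE w' : (size w' <= N)%N -> b w' = D u v w'.
  by move=> w'N; rewrite /b (@eq_incr_tincr _ _ _ _ Z)// => v' v'N; rewrite Zhat.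
have a1 : a [::] = 1 by rewrite aE.
have b1 : b [::] = 1 by rewrite bE// /D (tincr_nil _ rZ).
have bB w' : (size w' <= N)%N -> `|b w'| <= B.
  by move=> w'N; rewrite bE//; have := HB (u, v) w' w'N; rewrite /f /= u0 uT v0 vT.
have aB := cc_dist_bounded a1 b1 (lt_le_trans ab _) bB.
rewrite -aE// -bE// distrC.
apply: le_trans (cc_dist_close a1 b1 ab (ltW e'0) e'1 (aB _) wN) _.
  by rewrite lee_fin.
apply: (@le_trans _ _ (N%:R * (B * 2 ^+ N) * (e / (N%:R * (B * 2 ^+ N) + 1)))).
  by rewrite ler_wpM2l ?mulr_ge0// ge_min lexx orbT.
by rewrite mulrCA -[leRHS]mulr1 ler_pM2l// ler_pdivrMr// mul1r lerDl.
Qed.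

(** Every approximating path has time as a coordinate, so its increment is exactly v - u, and the
    limit keeps this value. *)
Lemma tincr_time u v : 0 <= u -> u <= v -> v <= T -> D u v [:: ord0] = v - u.
Proof.
move=> u0 uv vT; apply/eqP; rewrite eq_sym -subr_eq0 -normr_le0.
apply/ler_addgt0Pr => e e0; rewrite add0r.
have [k /(_ u v u0 uv vT [:: ord0] N0)] := signature_approx e0.
rewrite signature_letter// !xtime//; first exact: le_trans vT.
exact: le_trans uv.
Qed.

(** The bound of [signature_time_letter] does not see the variation of the approximating path, so it
    passes to the limit and gives (t - s) B B'. As [w] has a second letter, [u] or [u'] is nonempty,
    and its bound is small when t - s is. The control is time itself. *)
Lemma tincr_time_letter_negligible w : ord0 \in w -> (1 < size w)%N ->
  (size w <= N)%N -> negligible T (fun u v => D u v w).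
Proof.
move=> /splitPr[u u'] w1 wN; exists id => e e0.
have uN : (size u <= N)%N by rewrite (leq_trans _ wN)// size_cat leq_addr.
have uN' : (size u' <= N)%N.
  by rewrite (leq_trans _ wN)// size_cat /= addnS -addSn leq_addl.
suff [h h0 [B [B' [BB hB]]]] : exists2 h, 0 < h & exists B B',
    [/\ 0 <= B, 0 <= B' & B * B' <= e / 2] /\
    forall s t, 0 <= s -> s <= t -> t <= T -> t - s < h ->
      `|D s t u| <= B /\ `|D s t u'| <= B'.
  exists h => // s t s0 st tT tsh; have [B0 B'0 BBe] := BB.
  apply/ler_addgt0Pr => e1 e10.
  have sT := le_trans st tT.
  (* [K] bounds the coefficient of [e2] in the expansion of the perturbed bound, by t - s <= 1 + T
     and e2 <= 1. *)
  pose K := (1 + T) * (B + B' + 1) + 1.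
  have K0 : 0 < K by rewrite /K ltr_wpDl// mulr_ge0//; lra.
  pose e2 := Num.min 1 (e1 / K).
  have e20 : 0 < e2 by rewrite lt_min ltr01 divr_gt0.
  have e21 : e2 <= 1 by rewrite ge_min lexx.
  have e2K : e2 * K <= e1 by rewrite -ler_pdivlMr// ge_min lexx orbT.
  have [k Hk] := signature_approx e20; have [V xV] := xdom k.
  have bound v B0' : (size v <= N)%N ->
      (forall s t, 0 <= s -> s <= t -> t <= T -> t - s < h -> `|D s t v| <= B0') ->
      forall a b, s <= a -> a <= b -> b <= t -> `|signature (x k) a b v| <= B0' + e2.
    move=> vN HB a b sa ab bt; have a0 := le_trans s0 sa; have bT := le_trans bt tT.
    rewrite -[signature _ _ _ _](subrK (D a b v)) addrC (le_trans (ler_normD _ _))//.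
    by rewrite lerD ?Hk// HB// (le_lt_trans _ tsh)//; lra.
  have S1 := bound u B uN (fun s t s0 st tT ts => proj1 (hB s t s0 st tT ts)).
  have S2 := bound u' B' uN' (fun s t s0 st tT ts => proj2 (hB s t s0 st tT ts)).
  have H := signature_time_letter xV (xtime k) s0 st tT S1 S2.
  have H' := Hk s t s0 st tT _ wN.
  have H3 : `|D s t (u ++ ord0 :: u')| <= (t - s) * ((B + e2) * (B' + e2)) + e2.
    rewrite -[D _ _ _](subrK (signature (x k) s t (u ++ ord0 :: u'))).
    by rewrite (le_trans (ler_normD _ _))// addrC lerD// distrC.
  apply: le_trans H3 _.
  have -> : (t - s) * ((B + e2) * (B' + e2)) + e2 =
      (t - s) * (B * B') + e2 * ((t - s) * (B + B' + e2) + 1) by ring.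
  apply: lerD; first by rewrite mulrC ler_wpM2r ?subr_ge0//; lra.
  apply: le_trans e2K; rewrite ler_wpM2l ?(ltW e20)// /K lerD2r ler_pM//; lra.
have [C C0 HC] := tincr_bounded u rZ; have [C' C'0 HC'] := tincr_bounded u' rZ.
have [u0|u0] := eqVneq u [::].
  have u'0 : u' != [::] by move: w1; rewrite u0; case: (u').
  have C1 : 0 < C + 1 by lra.
  have e20 : 0 < e / 2 / (C + 1) by rewrite !divr_gt0.
  have [h h0 H] := tincr_small rZ u'0 e20; exists h => //.
  exists C, (e / 2 / (C + 1)); split.
    split=> //; first exact: ltW.
    by rewrite mulrCA -[leRHS]mulr1 ler_pM2l ?divr_gt0// ler_pdivrMr// mul1r; lra.
  move=> s t s0 st tT ts; split; last exact: H.
  by apply: HC => //; [exact: le_trans tT|exact: le_trans st].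
have C1 : 0 < C' + 1 by lra.
have e20 : 0 < e / 2 / (C' + 1) by rewrite !divr_gt0.
have [h h0 H] := tincr_small rZ u0 e20; exists h => //.
exists (e / 2 / (C' + 1)), C'; split.
  split=> //; first exact: ltW.
  by rewrite mulrC mulrCA -[leRHS]mulr1 ler_pM2l ?divr_gt0// ler_pdivrMr// mul1r; lra.
move=> s t s0 st tT ts; split; first exact: H.
by apply: HC' => //; [exact: le_trans tT|exact: le_trans st].
Qed.

(* |w| > p, so |D_(u,v)(w)| <= 2^|w| (W_v - W_u)^(|w|/p) beats W_v - W_u when the
   latter is small; otherwise the continuity of Z suffices. *)
Lemma tincr_long_negligible w : (N < size w)%N -> negligible T (fun u v => D u v w).
Proof.
move=> Nw; set n := size w; have n0 : (0 < n)%N by exact: leq_ltn_trans Nw.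
have [W0 HW0] := pvar_control p0 T0 (Zpvar (ltnW Nw)).
pose W u := W0 u + u; exists W => e e0.
have wn0 : w != [::] by rewrite -size_eq0 -lt0n.
have np : 1 < n%:R / p.
  rewrite ltr_pdivlMr// mul1r; apply: lt_le_trans pN _.
  by rewrite ler_nat.
pose a := n%:R / p - 1; have a0 : 0 < a by rewrite subr_gt0.
have e20 : 0 < e / 2 ^+ n by rewrite divr_gt0// exprn_gt0.
pose y := (e / 2 ^+ n) `^ a^-1; have y0 : 0 < y by rewrite powR_gt0.
have [h h0 H] := tincr_small rZ wn0 (mulr_gt0 e0 y0); exists h => // u v u0 uv vT vu.
move: uv; rewrite le_eqVlt => /predU1P[uv|uv].
  rewrite -uv subrr mulr0 /D (tincr_refl rZ)//; last by rewrite uv.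
  by rewrite /tone (negbTE wn0) normr0.
set dl := W v - W u.
have uT : u <= T by rewrite (le_trans (ltW uv)).
have HWuv := HW0 u v u0 uv vT.
have dl0 : 0 < dl.
  have : 0 <= W0 v - W0 u by rewrite -lee_fin; apply: le_trans HWuv; exact: poweR_ge0.
  by rewrite /dl /W; lra.
have [ydl|dly] := leP y dl.
  by apply: le_trans (H u v u0 (ltW uv) vT vu) _; rewrite ler_pM2l.
have cc_lt : (cc_norm n (incr n (fun t => ttrunc n (Z t)) u v) < (2 * dl `^ p^-1)%:E)%E.
  rewrite ltNge; apply/negP => ccge.
  have := @gt0_ler_poweR R p (ltW p0) (2 * dl `^ p^-1)%:E _ _ _ ccge.
  rewrite !in_itv/= !leey !andbT lee_fin mulr_ge0 ?powR_ge0// cc_norm_ge0.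
  move=> /(_ isT isT) /= ccp; have := le_trans ccp HWuv; rewrite lee_fin.
  rewrite powRM ?powR_ge0// -powRrM mulVf ?gt_eqF// powRr1 ?(ltW dl0)//.
  have : 1 <= 2 `^ p :> R by rewrite -[leLHS](powRr0 2) ler_powR ?ler1n ?(ltW p0).
  move=> p2; apply/negP; rewrite -ltNge.
  apply: (@lt_le_trans _ _ dl); first by rewrite /dl /W; lra.
  by rewrite ler_peMl// ltW.
have := cc_norm_coord cc_lt (leqnn n).
rewrite (@eq_incr_tincr _ _ _ _ Z)//; last 2 first.
- by move=> w' w'n; rewrite ttrunc_le.
- by move=> w' w'n; rewrite ttrunc_le.
move=> /le_trans; apply; rewrite exprMn.
have -> : (dl `^ p^-1) ^+ n = dl `^ a * dl.
  rewrite -powR_mulrn ?powR_ge0// -powRrM -{3}(powRr1 (ltW dl0)).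
  by rewrite -powRD ?(gt_eqF dl0) ?implybT// /a subrK mulrC.
rewrite mulrA ler_pM2r// -ler_pdivlMl ?exprn_gt0// mulrC.
have -> : e / 2 ^+ n = y `^ a.
  by rewrite /y -powRrM mulVf ?gt_eqF// powRr1// ltW.
rewrite ge0_ler_powR ?nnegrE ?ltW//.
Qed.

Lemma euler_step_diff_negligible w :
  negligible T (fun u v => euler_step N X u v w - D u v w).
Proof.
have [->|w1] := eqVneq w [:: ord0].
  apply: (@eq_negligible _ T (fun _ _ => 0)); last exact: negligible0.
move=> u v u0 uv vT; apply/esym.
  by rewrite /euler_step eqxx tincr_time// subrr.
have [ww|nw] := boolP (ord0 \in w).
  apply: (@eq_negligible _ _ (fun u v => - D u v w)).
    by move=> u v _ _ _; rewrite /euler_step (negbTE w1) ww sub0r.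
  apply: negligibleN; have [wN|Nw] := leqP (size w) N.
    apply: tincr_time_letter_negligible => //.
    case: w w1 ww {wN} => [|i [|j w]]// /negP w1.
    by rewrite mem_seq1 => /eqP i0; case: w1; rewrite -i0.
  exact: tincr_long_negligible.
have wE : w = map (lift ord0) (pmap (unlift ord0) w).
  elim: w nw {w1} => //= i w IH; rewrite inE negb_or => /andP[i0 /IH {1}->].
  by case: (unliftP ord0 i) i0 => [j -> _|->]; rewrite ?eqxx.
have szw : size (pmap (unlift ord0) w) = size w by rewrite [in RHS]wE size_map.
have [wN|Nw] := leqP (size w) N; last first.
  apply: (@eq_negligible _ _ (fun u v => - D u v w)).
    move=> u v _ _ _; rewrite /euler_step (negbTE w1) (negbTE nw).
    by rewrite /incr /ttrunc szw leqNgt Nw sub0r.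
  by apply: negligibleN; exact: tincr_long_negligible.
apply: (@eq_negligible _ T (fun _ _ => 0)); last exact: negligible0.
move=> u v u0 uv vT; apply/esym.
rewrite /euler_step (negbTE w1) (negbTE nw) {2}wE.
have uT := le_trans uv vT; have v0 := le_trans u0 uv.
rewrite (@eq_incr_tincr _ _ _ _ (fun t v => Z t (map (lift ord0) v)))//.
- rewrite /D /tincr tmul_map.
  rewrite (_ : (fun v0 => tinv (Z u) _) = tinv (fun v => Z u (map (lift ord0) v))).
    by rewrite subrr.
  by apply/funext => v'; rewrite tinv_map.
- by move=> w' w'N; rewrite -hatX// Zhat// size_map.
- by move=> w' w'N; rewrite -hatX// Zhat// size_map.
- by rewrite szw.
Qed.

Lemma euler_step_nil u v : 0 <= u -> u <= v -> v <= T -> euler_step N X u v [::] = 1.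
Proof.
move=> u0 uv vT; rewrite /euler_step /= /incr ttrunc_le// tmul_nil tinv_nil mul1r.
have v0 := le_trans u0 uv.
by rewrite -hatX// Zhat// (proj1 rZ).
Qed.

End AugmentedSignatureApproximation.

(** For each n the product reads [X] at finitely many times. Hence [Z t] does not depend on the
    chosen augmentation and signature, and it inherits measurability from evaluations. *)
Theorem augmented_signature_cvg (R : realType) (d : nat) (p T : R)
    (X : R -> tseries R d) (Z : R -> tseries R d.+1) :
  1 <= p -> 0 <= T -> augmented_signature p T X Z -> forall t, 0 <= t -> t <= T ->
  forall w, step_product (euler_step (Num.truncn p) X) t n n.+1 w
    @[n --> \oo] --> Z t w.
Proof.
move=> p1 T0 [Xhat [[[_ Xc Xcont] [x Cx xcvg]] hatX] [Z0 Zg Zt Zc Zp]] t t0 tT w.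
set N := Num.truncn p in xcvg Zt Zp *.
have p0 : 0 < p by exact: lt_le_trans p1.
have N0 : (0 < N)%N by rewrite truncn_gt0.
have pN : p < N.+1%:R by exact: truncnS_gt.
have tin u : 0 <= u -> u <= T -> 0 <= u <= T by move=> -> ->.
have rZ : regular_path T Z.
  split=> [u u0 uT|v]; first by have [] := Zg u (tin u u0 uT).
  exact: within_ucont (Zc v).
have Zhat u : 0 <= u -> u <= T -> forall w, (size w <= N)%N -> Xhat u w = Z u w.
  by move=> u0 uT v vN; rewrite -Zt ?tin// ttrunc_le.
have hatX' u : 0 <= u -> u <= T -> forall w, Xhat u (map (lift ord0) w) = X u w.
  by move=> u0 uT v; rewrite hatX ?tin.
have xdom k : exists V, dominated_path 0 T (x k) V.
  by have [y by_ <-] := Cx k; exact: time_augment_dominated.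
have xtime k u : 0 <= u -> u <= T -> x k u ord0 ord0 = u.
  by have [y by_ <-] := Cx k => _ _; rewrite mxE unlift_none.
apply: (@step_product_cvg _ _ T) => //.
- by move=> u v; exact: (euler_step_nil rZ Zhat hatX').
- move=> v.
  exact: (euler_step_diff_negligible p0 pN N0 T0 rZ Zhat hatX' Zp xdom xtime xcvg).
Qed.

(** * Measurability *)

Section MeasurabilityOfEvaluations.
Variables (R : realType) (d : nat) (p T : R).
Hypotheses (p1 : 1 <= p) (T0 : 0 < T).

Let N := Num.truncn p.

Lemma rough_path_nil (X : R -> tseries R d) t : geometric_rough_path p T X ->
  0 <= t -> t <= T -> X t [::] = 1.
Proof.
move=> [[[_ Xg _] _] _] t0 tT.
have [|a [a1 _] <-] := Xg t; first by rewrite t0 tT.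
by rewrite ttrunc_le.
Qed.

Lemma rough_path_long (X : R -> tseries R d) t w : geometric_rough_path p T X ->
  0 <= t -> t <= T -> (N < size w)%N -> X t w = 0.
Proof.
move=> [[[_ Xg _] _] _] t0 tT Nw.
have [|a _ <-] := Xg t; first by rewrite t0 tT.
by rewrite /ttrunc leqNgt Nw.
Qed.

Lemma incr0 (X : R -> tseries R d) t w : X 0 = tone -> (size w <= N)%N ->
  incr N X 0 t w = X t w.
Proof. by move=> X0 wN; rewrite /incr ttrunc_le// X0 tinv1 tmul1l. Qed.

(** Upper rays generate the Borel sets, so lower semicontinuity is enough. It follows from
    [cc_dist_close] on the single cell [0, t], with constants taken from [X] alone. *)
Lemma evaluation_open t w a : 0 <= t -> t <= T ->
  geometric_open p T [set X : R -> tseries R d | geometric_rough_path p T X /\ a < X t w].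
Proof.
move=> t0 tT; split=> [X []//|X [GX aX]].
have [wN|Nw] := leqP (size w) N; last first.
  exists 1 => // Y GY _; split=> //; move: aX.
  by rewrite (rough_path_long GX t0 tT Nw) (rough_path_long GY t0 tT Nw).
have X0 : X 0 = tone by case: GX => -[[]].
have [B HB] : exists C, forall (u : unit) w, (size w <= N)%N -> `|X t w| <= C.
  by apply: (@words_uniform_bound _ _ _ _ (fun=> X t)) => w'; exists `|X t w'|.
have {}HB := HB tt.
have B0 : 0 <= B by exact: le_trans (normr_ge0 _) (HB [::] isT).
have K0 : 0 < N%:R * B + 1 by rewrite ltr_wpDl// mulr_ge0.
pose e := Num.min 1 ((X t w - a) / (N%:R * B + 1)).
have e0 : 0 < e by rewrite lt_min ltr01 divr_gt0// subr_gt0.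
have e1 : e <= 1 by rewrite ge_min lexx.
exists e => // Y GY XYe; split=> //.
have Y0 : Y 0 = tone by case: GY => -[[]].
(* Time 0 bounds no cell; there both paths have the value [tone]. *)
move: t0; rewrite le_eqVlt => /predU1P[t0|t0].
  by move: aX; rewrite -t0 X0 Y0.
have G0 u v : (0 <= cc_dist N (incr N X u v) (incr N Y u v))%E by exact: cc_norm_ge0.
have cc := pvar_cell (lt_le_trans ltr01 p1) e0 G0 XYe (lexx 0) t0 tT.
have := @cc_dist_close _ _ N (incr N X 0 t) (incr N Y 0 t) e B.
rewrite !incr0// !(rough_path_nil _ (ltW t0) tT)// => /(_ erefl erefl cc (ltW e0) e1).
have HB' w' : (size w' <= N)%N -> `|incr N X 0 t w'| <= B by move=> ?; rewrite incr0// HB.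
move=> /(_ HB' w wN); rewrite !incr0//.
have : N%:R * B * e < X t w - a.
  apply: (@le_lt_trans _ _ (N%:R * B * ((X t w - a) / (N%:R * B + 1)))).
    by rewrite ler_wpM2l ?mulr_ge0// ge_min lexx orbT.
  by rewrite mulrCA -[ltRHS]mulr1 ltr_pM2l ?subr_gt0// ltr_pdivrMr// mul1r ltrDl.
by rewrite ler_norml => ? /andP[? ?]; lra.
Qed.

Lemma measurable_geometric_rough_path :
  measurable (geometric_rough_path p T : set (rough_space R d p T)).
Proof.
apply: sub_sigma_algebra; split=> // X GX; exists 1 => // Y GY _.
Qed.

Lemma measurable_evaluation t w : 0 <= t -> t <= T ->
  measurable_fun (geometric_rough_path p T : set (rough_space R d p T))
    (fun X : rough_space R d p T => (X : R -> tseries R d) t w).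
Proof.
move=> t0 tT mG; apply: (measurability _ (RGenOInfty.measurableE R)) => //.
move=> _ [_ [a ->] <-]; apply: sub_sigma_algebra.
have := evaluation_open w a t0 tT; congr (geometric_open p T).
by apply/seteqP; split=> X /= [GX]; rewrite in_itv/= andbT.
Qed.

End MeasurabilityOfEvaluations.

Section MeasurableSeries.
Context {disp : measure_display} {S : measurableType disp} {R : realType}.
Variable A : set S.

Definition mseries (m : nat) (f : S -> tseries R m) : Prop :=
  forall w, measurable_fun A (fun x => f x w).

Lemma mseries_cst m (a : tseries R m) : mseries (fun=> a).
Proof. by move=> w; exact: measurable_cst. Qed.

Lemma mseries_tmul m (f g : S -> tseries R m) : mseries f -> mseries g ->
  mseries (fun x => tmul (f x) (g x)).
Proof.
by move=> mf mg w; rewrite /tmul; apply: measurable_sum => k; exact: measurable_funM.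
Qed.

Lemma mseries_tinv m (f : S -> tseries R m) : mseries f ->
  mseries (fun x => tinv (f x)).
Proof.
move=> mf w; rewrite /tinv; apply: measurable_sum => k; move: {k}(nat_of_ord k) => k.
elim: k w => [|k IH] w /=; first exact: measurable_cst.
apply: (mseries_tmul (f := fun x v => tone v - f x v)) => // v.
by apply: measurable_funB => //; exact: measurable_cst.
Qed.

Lemma mseries_ttrunc m n (f : S -> tseries R m) : mseries f ->
  mseries (fun x => ttrunc n (f x)).
Proof.
move=> mf w; rewrite /ttrunc; case: (size w <= n)%N; first exact: mf.
exact: measurable_cst.
Qed.

Lemma mseries_incr m n (F : S -> R -> tseries R m) u v :
  mseries (F ^~ u) -> mseries (F ^~ v) -> mseries (fun x => incr n (F x) u v).
Proof.
by move=> mu mv; apply: mseries_ttrunc; apply: mseries_tmul => //; exact: mseries_tinv.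
Qed.

Lemma mseries_concatenation m n th (F G : S -> R -> tseries R m) t :
  mseries (F ^~ 0) -> mseries (F ^~ th) -> mseries (F ^~ t) ->
  mseries (G ^~ th) -> mseries (G ^~ t) ->
  mseries (fun x => concatenation n th (F x) (G x) t).
Proof.
move=> F0 Fth Ft Gth Gt; rewrite /concatenation; case: (t < th).
  exact: mseries_incr.
by apply: mseries_ttrunc; apply: mseries_tmul; exact: mseries_incr.
Qed.

Lemma mseries_step_product (d n : nat) (F : S -> R -> tseries R d) T t k :
  (forall s, 0 <= s -> s <= T -> mseries (F ^~ s)) -> 0 <= t -> t <= T ->
  forall j, (j <= k.+1)%N ->
    mseries (fun x => step_product (euler_step n (F x)) t k j).
Proof.
move=> mF t0 tT; elim=> [|j IH] jk; first exact: mseries_cst.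
apply: mseries_tmul; first exact: IH (ltnW jk).
move=> w; rewrite /euler_step; case: (w == _); first exact: measurable_cst.
case: (ord0 \in w); first exact: measurable_cst.
have jt l : (l <= k.+1)%N -> even_point 0 t k l <= T.
  by move=> lk; exact: le_trans (even_point_le t0 lk) tT.
apply: mseries_incr; apply: mF.
- exact: even_point_ge.
- exact: jt (ltnW jk).
- exact: even_point_ge.
- exact: jt.
Qed.

End MeasurableSeries.

Section RunningSupremum.
Variables (R : realType) (d : nat) (p T : R).
Hypotheses (p1 : 1 <= p) (T0 : 0 <= T).

(** An enumeration of the rationals of [0, 1] through the coding of pairs: [minn] caps the fraction
    at 1 and [odflt] handles codes of no pair, so that every index gives a legitimate point. *)
Definition unit_ratio (k : nat) : R :=
  let ij := odflt (0, 0)%N (choice.unpickle k) in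
  (minn ij.1 ij.2.+1)%:R / ij.2.+1%:R.

Lemma unit_ratio_ge0 m : 0 <= unit_ratio m.
Proof. by rewrite divr_ge0. Qed.

Lemma unit_ratio_le1 m : unit_ratio m <= 1.
Proof. by rewrite ler_pdivrMr ?ltr0n// mul1r ler_nat geq_minr. Qed.

(** Rounding s / t down to a multiple of 1 / (j + 1) approximates from the left, the order of
    arguments that [ucont] expects. *)
Lemma unit_ratio_dense t s h : 0 <= s -> s <= t -> 0 < h ->
  exists m, t * unit_ratio m <= s /\ s - t * unit_ratio m < h.
Proof.
move=> s0 st h0.
have [t0|t0] := eqVneq t 0.
  exists 0%N; rewrite t0 mul0r subr0 s0; split=> //.
  by rewrite (le_lt_trans st)// t0.
have {}t0 : 0 < t by rewrite lt_neqAle eq_sym t0 (le_trans s0).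
have [j jt] : exists j : nat, t / j.+1%:R < h.
  by have /filter_ex[j] := even_mesh_near 0 t h0; rewrite subr0; exists j.
have j0 : 0 < j.+1%:R :> R by rewrite ltr0n.
pose x := s / t * j.+1%:R; pose i := Num.truncn x.
have x0 : 0 <= x by rewrite mulr_ge0// divr_ge0// ltW.
have ix : i%:R <= x by rewrite truncn_le.
have xi : x < i.+1%:R by exact: truncnS_gt.
have xj : x <= j.+1%:R by rewrite ler_piMl// ler_pdivrMr// mul1r.
have ij : (i <= j.+1)%N by rewrite -(ler_nat R) (le_trans ix).
exists (choice.pickle (i, j)); rewrite /unit_ratio choice.pickleK /= (minn_idPl ij).
have sE : s = t * (x / j.+1%:R) by rewrite /x; field; rewrite !gt_eqF.
split.
  by rewrite [leRHS]sE ler_pM2l// ler_pM2r ?invr_gt0.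
rewrite [X in X - _]sE -mulrBr -mulrBl.
apply: le_lt_trans jt; rewrite ler_pM2l// -[leRHS]mul1r ler_pM2r ?invr_gt0//.
by move: xi; rewrite -natr1; lra.
Qed.

(** The upper limit makes the functional defined and measurable without any convergence; it is the
    true limit for a path that has an augmented signature. [esups] at index 0 is the supremum over
    all [m]. *)
Definition approx_running_sup (l : dual_tensor R d.+1) (X : R -> tseries R d)
    (t : R) : \bar R :=
  esups (fun m => limn_esup (fun n => `|pairing l (step_product
    (euler_step (Num.truncn p) X) (t * unit_ratio m) n n.+1)|%:E)) 0%N.

Lemma measurable_approx_running_sup {disp : measure_display}
    {S : measurableType disp} (A : set S) (F : S -> R -> tseries R d) l t :
  (forall s, 0 <= s -> s <= T -> mseries A (F ^~ s)) -> 0 <= t -> t <= T ->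
  measurable_fun A (fun x => approx_running_sup l (F x) t).
Proof.
move=> mF t0 tT; apply: measurable_fun_esups => m.
apply: measurable_fun_limn_esup => n; apply/measurable_EFinP.
apply: (measurableT_comp (@normr_measurable R setT)).
apply: measurable_sum => w; apply: measurable_funM; first exact: measurable_cst.
have tm : t * unit_ratio m <= T.
  by rewrite (le_trans _ tT)// ler_piMr// unit_ratio_le1.
by apply: (mseries_step_product _ mF) => //; rewrite mulr_ge0// unit_ratio_ge0.
Qed.

Lemma pairing_step_product_cvg (l : dual_tensor R d.+1) (X : R -> tseries R d) Z :
  augmented_signature p T X Z ->
  forall t, 0 <= t -> t <= T -> pairing l (step_product
    (euler_step (Num.truncn p) X) t n n.+1) @[n --> \oo] --> pairing l (Z t).
Proof.
move=> XZ t t0 tT; rewrite /pairing; apply: cvg_big => [|w _]; first exact: add_continuous.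
apply: cvgMl_tmp; exact: augmented_signature_cvg XZ _ t0 tT w.
Qed.

Lemma pairing_ucont (l : dual_tensor R d.+1) (X : R -> tseries R d) Z :
  augmented_signature p T X Z ->
  ucont 0 T (fun t => pairing l (Z t) : R).
Proof.
move=> [Xhat _ [_ _ _ Zc _]]; apply: ucont_sum => w; apply: ucontM.
  exact: ucont_cst.
exact: within_ucont (Zc w).
Qed.

Lemma running_supE (l : dual_tensor R d.+1) (X : R -> tseries R d) Z t :
  augmented_signature p T X Z -> 0 <= t -> t <= T ->
  running_sup l Z t = approx_running_sup l X t.
Proof.
move=> XZ t0 tT.
have limE m : limn_esup (fun n => `|pairing l (step_product
    (euler_step (Num.truncn p) X) (t * unit_ratio m) n n.+1)|%:E) =
    `|pairing l (Z (t * unit_ratio m))|%:E.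
  have H : `|pairing l (step_product (euler_step (Num.truncn p) X)
      (t * unit_ratio m) n n.+1)|%:E @[n --> \oo] -->
      `|pairing l (Z (t * unit_ratio m))|%:E.
    have tm0 : 0 <= t * unit_ratio m by rewrite mulr_ge0// unit_ratio_ge0.
    have tmT : t * unit_ratio m <= T.
      by rewrite (le_trans _ tT)// ler_piMr// unit_ratio_le1.
    apply: cvg_EFin; first by near=> n.
    exact: cvg_norm (pairing_step_product_cvg (l := l) XZ tm0 tmT).
  by rewrite is_cvg_limn_esupE; [exact/cvg_lim|apply/cvg_ex; eexists; exact: H].
have -> : approx_running_sup l X t =
    ereal_sup (range (fun m => `|pairing l (Z (t * unit_ratio m))|%:E)).
  congr (ereal_sup _); apply/seteqP; split=> [_ [m _ <-]|_ [m _ <-]]; exists m => //.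
apply/eqP; rewrite eq_le; apply/andP; split; last first.
  apply: ge_ereal_sup => _ [m _ <-]; apply: ereal_sup_ubound.
  exists (t * unit_ratio m) => //=; rewrite in_itv/= mulr_ge0 ?unit_ratio_ge0//.
  by rewrite ler_piMr// unit_ratio_le1.
apply: ge_ereal_sup => _ [s /= sE <-]; move: sE; rewrite in_itv/= => /andP[s0 st].
apply/lee_addgt0Pr => e e0.
have [h h0 H] := pairing_ucont l XZ e0.
have [m [ms sm]] := unit_ratio_dense s0 st h0.
have {}H : `|pairing l (Z s) - pairing l (Z (t * unit_ratio m))| <= e.
  by apply: H => //; [rewrite mulr_ge0 ?unit_ratio_ge0// (le_trans s0)|exact: le_trans tT].
apply: (@le_trans _ _ (`|pairing l (Z (t * unit_ratio m))|%:E + e%:E)%E); last first.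
  by rewrite leeD2r//; apply: ereal_sup_ubound; exists m.
rewrite -EFinD lee_fin addrC -lerBlDr; apply: le_trans H.
exact: lerB_dist.
Unshelve. all: by end_near. Qed.

End RunningSupremum.

(** * Hoeffding's inequality for frequencies *)

Section HoeffdingBernoulli.
Variable R : realType.

(* With s = 1 - c + c e^x and q = s'/s one has q' = (1 - c) c e^x / s^2 <= 1/4,
   so the mean value theorem bounds first q - c and then ln s - c x. *)
Lemma bernoulli_mgf_le (c x : R) : 0 <= c <= 1 -> 0 <= x ->
  1 - c + c * expR x <= expR (x * c + x ^+ 2 / 8).
Proof.
move=> /andP[c0 c1] x0.
pose s (y : R) : R := 1 - c + c * expR y.
have s0 y : 0 < s y.
  have e0 := expR_gt0 y; rewrite /s.
  have [->|cn0] := eqVneq c 0; first by rewrite subr0 mul0r addr0.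
  have {cn0} cp : 0 < c by rewrite lt_neqAle eq_sym cn0.
  by have := mulr_gt0 cp e0; lra.
have ds (y : R) : is_derive y 1 s (c * expR y).
  have := is_deriveD (is_derive_cst (1 - c : R) y 1) (is_deriveZ c (is_derive_expR y)).
  by rewrite add0r.
pose q (y : R) : R := c * expR y * (s y)^-1.
have dq (y : R) : is_derive y 1 q (c * expR y * (1 - c) / s y ^+ 2).
  have sy0 : s y != 0 by rewrite gt_eqF.
  apply: (is_derive_eq (is_deriveM (is_deriveZ c (is_derive_expR y)) (is_deriveV sy0 (ds y)))).
  change ((c * expR y) * (- s y ^- 2 * (c * expR y)) + (s y)^-1 * (c * expR y) =
    c * expR y * (1 - c) / s y ^+ 2).
  have -> : 1 - c = s y - c * expR y by rewrite addrK.
  by field.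
have derivable_cont (f : R -> R) (df : R -> R) (a b : R) :
    (forall y : R, is_derive y 1 f (df y)) -> {within `[a, b], continuous f}.
  by move=> fdf; apply: derivable_within_continuous => y _; have [] := fdf y.
have q_le y : 0 <= y -> q y <= c + y / 4.
  move=> y0.
  have [z _ qE] := MVT_segment y0 (fun z _ => dq z) (derivable_cont _ _ _ _ dq).
  have q0 : q 0 = c by rewrite /q /s expR0 mulr1 subrK invr1 mulr1.
  have : q y - q 0 <= y / 4; last by rewrite q0; lra.
  rewrite qE subr0 mulrC ler_wpM2l// ler_pdivrMr ?exprn_gt0//.
  have := sqr_ge0 (1 - c - c * expR z); rewrite /s !expr2; lra.
pose h (y : R) : R := y * c + y ^+ 2 / 8 - ln (s y).
have dh (y : R) : is_derive y 1 h (c + y / 4 - q y).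
  have dls := is_derive1_comp (is_derive1_ln (s0 y)) (ds y).
  have -> : h = (c \*: (id : R -> R)) + (8^-1 \*: ((id : R -> R) ^+ 2)) - (@ln R \o s).
    by apply/funext => z; rewrite /h /= !fctE /= /GRing.scale /= mulrC [_ / 8]mulrC.
  apply: (is_derive_eq (is_deriveB (is_deriveD (is_deriveZ c (is_derive_id y 1))
    (is_deriveZ 8^-1 (is_deriveX 2 (is_derive_id y 1)))) dls)).
  rewrite /GRing.scale /= /q; field.
  by rewrite gt_eqF.
have [z zx hE] := MVT_segment x0 (fun z _ => dh z) (derivable_cont _ _ _ _ dh).
have h0 : h 0 = 0 by rewrite /h /s expR0 mulr1 subrK ln1 mul0r expr0n /= mul0r addr0 subr0.
have z0 : 0 <= z by move: zx; rewrite in_itv => /andP[].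
have : 0 <= h x.
  by move: hE; rewrite h0 !subr0 => ->; rewrite mulr_ge0// subr_ge0 q_le.
rewrite /h subr_ge0 => lns; rewrite -/(s x) -[s x]lnK ?posrE//.
by rewrite ler_expR.
Qed.

(** [J] is the set of successes in [n] trials of parameter [c]. The factor exp(x (|J| - n a)) is at
    least 1 on the range of summation; once it is inserted, the sum over all [J] factors by
    distributivity into [n] Bernoulli moment generating functions. *)
Lemma binomial_upper_tail (n : nat) (c a : R) : 0 <= c <= 1 -> c <= a ->
  \sum_(J : {set 'I_n} | n%:R * a <= #|J|%:R) \prod_i (if i \in J then c else 1 - c)
  <= expR (- 2 * n%:R * (a - c) ^+ 2).
Proof.
(* This x minimizes x^2 / 8 - x (a - c), with minimum - 2 (a - c)^2. *)
move=> c01 ca; have /andP[c0 c1] := c01; pose x := 4 * (a - c).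
have x0 : 0 <= x by rewrite mulr_ge0// subr_ge0.
have w0 (J : {set 'I_n}) : 0 <= \prod_i (if i \in J then c else 1 - c).
  by apply: prodr_ge0 => i _; case: ifP; rewrite ?subr_ge0.
apply: (@le_trans _ _ (\sum_(J : {set 'I_n}) expR (x * (#|J|%:R - n%:R * a)) *
    \prod_i (if i \in J then c else 1 - c))).
  rewrite [leRHS](bigID (fun J : {set 'I_n} => n%:R * a <= #|J|%:R)) /= ler_wpDr//.
    by apply: sumr_ge0 => J _; rewrite mulr_ge0// expR_ge0.
  apply: ler_sum => J aJ; rewrite ler_peMl// -[leLHS]expR0 ler_expR.
  by rewrite mulr_ge0// subr_ge0.
have -> : \sum_(J : {set 'I_n}) expR (x * (#|J|%:R - n%:R * a)) *
    \prod_i (if i \in J then c else 1 - c) =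
    expR (- (x * (n%:R * a))) * (c * expR x + (1 - c)) ^+ n.
  rewrite -[n in _ ^+ n]card_ord -prodr_const (bigA_distr _ _ (fun=> c * expR x) (fun=> 1 - c)).
  rewrite mulr_sumr; apply: eq_bigr => J _.
  rewrite mulrBr addrC expRD -mulrA; congr (_ * _).
  have -> : expR (x * #|J|%:R) = \prod_(i : 'I_n) (if i \in J then expR x else 1).
    by rewrite -big_mkcond /= prodr_const -expRM_natr.
  rewrite -big_split /=; apply: eq_bigr => i _; case: ifP => _; first exact: mulrC.
  by rewrite mul1r.
have b1 : (c * expR x + (1 - c)) ^+ n <= expR (x * c + x ^+ 2 / 8) ^+ n.
  rewrite lerXn2r ?nnegrE ?expR_ge0//; last by rewrite addrC bernoulli_mgf_le.
  by rewrite addr_ge0 ?subr_ge0// mulr_ge0// expR_ge0.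
apply: le_trans (ler_wpM2l (expR_ge0 _) b1) _.
rewrite -expRM_natr -expRD ler_expR /x; lra.
Qed.

Lemma hoeffding_bound_le (n : nat) (x y : R) : 0 <= x -> x <= y ->
  expR (- 2 * n%:R * y ^+ 2) <= expR (- 2 * n%:R * x ^+ 2).
Proof.
move=> x0 xy; rewrite ler_expR !mulNr lerN2 ler_wpM2l ?mulr_ge0//.
by rewrite lerXn2r ?nnegrE// (le_trans x0).
Qed.

End HoeffdingBernoulli.

Lemma measurable_ge {disp : measure_display} {Omega : measurableType disp}
    {R : realType} (f : Omega -> R) (a : R) : measurable_fun setT f ->
  measurable [set o | a <= f o].
Proof.
move=> mf; have := mf measurableT `[a, +oo[%classic (measurable_itv _).
rewrite setTI; congr measurable.
by apply/seteqP; split=> o /=; rewrite in_itv/= andbT.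
Qed.

Section HoeffdingEvents.
Context {disp : measure_display} {Omega : measurableType disp} {R : realType}.
Variable P : probability Omega R.

Lemma measure_bigsetU_le (I : Type) (r : seq I) (Q : pred I) (A : I -> set Omega) :
  (forall i, measurable (A i)) ->
  (P (\big[setU/set0]_(i <- r | Q i) A i) <= \sum_(i <- r | Q i) P (A i))%E.
Proof.
move=> mA; elim: r => [|i r IH]; first by rewrite !big_nil measure0.
rewrite !big_cons; case: (Q i) => //.
apply: le_trans; first by apply: measureU2; [exact: mA|exact: bigsetU_measurable].
exact: leeD2l.
Qed.

Variables (disp' : measure_display) (E : measurableType disp') (n : nat).
Variable X : 'I_n -> Omega -> E.
Hypothesis mX : forall i, measurable_fun setT (X i).
Hypothesis iX : mutually_independent P X.

(** The event is covered by the atoms on which exactly the indices in [J] hit [C]. Independence,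
    applied to [C] and its complement, gives each atom its weight in [binomial_upper_tail]. *)
Lemma frequency_upper_tail (C : set E) (c a : R) : measurable C ->
  (forall i, P (X i @^-1` C) = c%:E) -> c <= a ->
  (P [set o | (n%:R * a <= \sum_(i < n) \1_(X i @^-1` C) o)%R]
   <= (expR (- 2 * n%:R * (a - c) ^+ 2))%:E)%E.
Proof.
move=> mC PC ca.
(* Without trials nothing forces [c] into [0, 1], but the bound is then 1. *)
have [n0|n0] := posnP n.
  have -> : expR (- 2 * n%:R * (a - c) ^+ 2) = 1 by rewrite n0 mulr0 mul0r expR0.
  apply: probability_le1.
  rewrite (_ : mkset _ = setT); first exact: measurableT.
  apply/seteqP; split=> // o _ /=; rewrite big1 => [|i]; first by rewrite n0 mul0r.
  by have := leq_ltn_trans (leq0n i) (ltn_ord i); rewrite n0.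
have mXC i : measurable (X i @^-1` C) by rewrite -[_ @^-1` _]setTI; exact: mX.
have c01 : 0 <= c <= 1.
  by rewrite -!lee_fin -(PC (Ordinal n0)) measure_ge0 probability_le1.
pose B (J : {set 'I_n}) i : set E := if i \in J then C else ~` C.
have mB J i : measurable (B J i) by rewrite /B; case: ifP => _ //; exact: measurableC.
have mpre J i : measurable (X i @^-1` B J i) by rewrite -[_ @^-1` _]setTI; exact: mX.
pose atom (J : {set 'I_n}) := \bigcap_(i in [set` [set: 'I_n]%SET]) (X i @^-1` B J i).
have matom J : measurable (atom J).
  by apply: fin_bigcap_measurable => [|i _]; [exact: finite_finset|exact: mpre].
have Patom J : P (atom J) = (\prod_i (if i \in J then c else 1 - c))%:E.
  rewrite /atom iX//.
  rewrite [LHS](eq_bigl xpredT) => [|i]; last by rewrite finset.in_setT.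
  rewrite -prodEFin; apply: eq_bigr => i _; rewrite /B; case: ifP => _ //.
  by rewrite preimage_setC probability_setC ?PC//; exact: mXC.
have cover : [set o | n%:R * a <= \sum_(i < n) \1_(X i @^-1` C) o] `<=`
    \big[setU/set0]_(J : {set 'I_n} | n%:R * a <= #|J|%:R) atom J.
  move=> o /= ao; pose J : {set 'I_n} := [set i | X i o \in C]%SET.
  have cardJ : \sum_(i < n) \1_(X i @^-1` C) o = #|J|%:R :> R.
    rewrite -sum1_card natr_sum [RHS]big_mkcond /=; apply: eq_bigr => i _.
    by rewrite finset.inE indicE (_ : (o \in X i @^-1` C) = (X i o \in C))//; case: (X i o \in C).
  rewrite -bigcup_seq_cond; exists J; first by rewrite /= mem_index_enum -cardJ.
  move=> i _; rewrite /= /B /J finset.inE; case: ifPn => [|]; first by rewrite inE.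
  by move=> /negP XC /mem_set.
have mev : measurable [set o | n%:R * a <= \sum_(i < n) \1_(X i @^-1` C) o].
  apply: measurable_ge; apply: measurable_sum => i; apply: measurable_indic.
  exact: mXC.
apply: (@le_trans _ _ (P (\big[setU/set0]_(J : {set 'I_n} | n%:R * a <= #|J|%:R) atom J))).
  by apply: le_measure => //; rewrite inE//; exact: bigsetU_measurable.
apply: le_trans (measure_bigsetU_le _ _ matom) _.
rewrite (eq_bigr _ (fun J _ => Patom J)) sumEFin lee_fin.
exact: binomial_upper_tail.
Qed.

End HoeffdingEvents.

(** * Threshold times *)

Section ThresholdTime.
Context {disp : measure_display} {Omega : measurableType disp} {R : realType}.
Variables (P : probability Omega R) (T alpha : R) (rate : R -> Omega -> R).
Hypothesis T0 : 0 <= T.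
Hypothesis rate_mono : forall o s t, 0 <= s -> s <= t -> t <= T -> rate s o <= rate t o.
Hypothesis rate_meas : forall t, 0 <= t -> t <= T -> measurable_fun setT (rate t).

Definition threshold_time (o : Omega) : \bar R :=
  mine (ereal_inf [set t%:E | t in
          [set t : R | (0 <= t <= T)%R /\ (alpha < rate t o)%R]]) T%:E.

Lemma threshold_time_lt o a : (threshold_time o < a%:E)%E <->
  T < a \/ exists t, [/\ 0 <= t, t <= T, t < a & alpha < rate t o].
Proof.
rewrite /threshold_time gt_min lte_fin; split.
  case/orP => [/ereal_inf_lt[_ [t [/andP[t0 tT] rt] <-]]|Ta]; last by left.
  by rewrite lte_fin => ta; right; exists t.
case=> [->|[t [t0 tT ta rt]]]; first by rewrite orbT.
apply/orP; left; apply: (@le_lt_trans _ _ t%:E); last by rewrite lte_fin.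
by apply: ereal_inf_lbound; exists t => //; split=> //; rewrite t0 tT.
Qed.

Lemma threshold_time_le o t : 0 <= t -> t <= T -> alpha < rate t o ->
  (threshold_time o <= t%:E)%E.
Proof.
move=> t0 tT rt; rewrite ge_min; apply/orP; left.
by apply: ereal_inf_lbound; exists t => //; split=> //; rewrite t0 tT.
Qed.

Lemma threshold_time_bounds o : exists t, [/\ threshold_time o = t%:E, 0 <= t & t <= T].
Proof.
have lo : (0%:E <= threshold_time o)%E.
  rewrite le_min lee_fin T0 andbT; apply: le_ereal_inf_tmp => _ [t [/andP[t0 _] _] <-].
  by rewrite lee_fin.
have up : (threshold_time o <= T%:E)%E by rewrite ge_min lexx orbT.
have fn : threshold_time o \is a fin_num.
  by rewrite ge0_fin_numE// (le_lt_trans up)// ltry.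
exists (fine (threshold_time o)); rewrite fineK//; split=> //.
  exact: fine_ge0.
by rewrite -lee_fin fineK.
Qed.

Lemma measurable_rate_gt t : 0 <= t -> t <= T -> measurable [set o | alpha < rate t o].
Proof.
move=> t0 tT; have mr : measurable_fun setT (rate t) by exact: rate_meas.
have := mr measurableT `]alpha, +oo[%classic (measurable_itv _).
rewrite setTI; congr measurable.
by apply/seteqP; split=> o /=; rewrite in_itv/= andbT.
Qed.

(** As the rate is monotone, crossing alpha before [a] means having crossed it at some term of a
    sequence increasing to [a]; the event is a countable union. *)
Lemma measurable_threshold_time_lt a : measurable [set o | (threshold_time o < a%:E)%E].
Proof.
have [Ta|aT] := ltP T a.
  rewrite (_ : mkset _ = setT); first exact: measurableT.
  by apply/seteqP; split=> // o _; apply/threshold_time_lt; left.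
have [a0|a0] := leP a 0.
  rewrite (_ : mkset _ = set0); first exact: measurable0.
  apply/seteqP; split=> // o /threshold_time_lt[|[t [t0 _ ta _]]]; first by rewrite ltNge aT.
  by move: (lt_le_trans ta a0); rewrite ltNge t0.
pose s m := a - a / m.+1%:R.
have s0 m : 0 <= s m.
  by rewrite subr_ge0 ler_pdivrMr ?ltr0n// ler_peMr ?ler1n// ltW.
have sa m : s m < a by rewrite ltrBlDr ltrDl divr_gt0.
have sT m : s m <= T by rewrite (le_trans (ltW (sa m))).
rewrite (_ : mkset _ = \bigcup_m [set o | alpha < rate (s m) o]).
  by apply: bigcup_measurable => m _; exact: measurable_rate_gt.
apply/seteqP; split=> [ o /threshold_time_lt[|[t [t0 tT ta rt]]]|o [m _ /= rs]].
- by rewrite ltNge aT.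
- have at0 : 0 < a - t by rewrite subr_gt0.
  have /filter_ex[m am] := even_mesh_near 0 a at0.
  exists m => //=; apply: lt_le_trans rt _; apply: rate_mono => //.
  by rewrite /s lerBrDl -lerBrDr; move: am; rewrite subr0; exact: ltW.
- by apply/threshold_time_lt; right; exists (s m).
Qed.

Lemma measurable_threshold_time : measurable_fun setT threshold_time.
Proof.
move=> _; apply: (measurability _ (ErealGenInftyO.measurableE R)) => //.
move=> _ [_ [a ->] <-]; rewrite setTI.
by have := measurable_threshold_time_lt a; congr measurable.
Qed.

Variables (g : R -> R) (delta theta missed fa : R).
Hypothesis g_inc : {homo g : x y / x < y}.
Hypothesis g0 : g 0 = 0.
Hypothesis delta0 : 0 < delta.
Hypotheses (theta0 : 0 <= theta) (thetaT : theta <= T).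
Hypothesis missed0 : 0 <= missed.
Hypothesis false_alarm_rate : (P [set o | (alpha < rate theta o)%R] <= fa%:E)%E.
Hypothesis missed_rate : forall t, theta <= t -> t <= T -> 1 + delta < g (t - theta) ->
  (P [set o | (rate t o <= alpha)%R] <= missed%:E)%E.

Let tau := threshold_time.
Let delay := generalized_inverse g (1 + delta).

Lemma delay_ge0 : (0 <= delay)%E.
Proof.
apply: le_ereal_inf_tmp => _ [x /= gx <-]; rewrite lee_fin leNgt; apply/negP => x0.
by have := le_lt_trans gx (g_inc x0); rewrite g0 ltNge addr_ge0// ltW.
Qed.

Lemma false_alarm_le : (P [set o | (tau o < theta%:E)%E] <= fa%:E)%E.
Proof.
apply: le_trans false_alarm_rate; apply: le_measure; rewrite ?inE.
- exact: measurable_threshold_time_lt.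
- exact: measurable_rate_gt.
move=> o /threshold_time_lt[|[t [t0 tT ta rt]]] /=; first by rewrite ltNge thetaT.
by apply: lt_le_trans rt _; apply: rate_mono => //; exact: ltW.
Qed.

(** At the infimum itself [g] may still lie below [1 + delta]. At [r + 1 / (m + 1)] strict
    monotonicity puts it above, so [missed_rate] bounds each [F m]; these events increase to the
    late event. *)
Lemma late_le r : delay = r%:E ->
  measurable [set o | ((theta + r)%:E < tau o)%E] /\
  (P [set o | ((theta + r)%:E < tau o)%E] <= missed%:E)%E.
Proof.
move=> dr.
have r0 : 0 <= r by rewrite -lee_fin -dr delay_ge0.
pose s m := theta + r + m.+1%:R^-1.
pose F m := [set o | ((s m)%:E < tau o)%E].
have mF m : measurable (F m).
  have mt : measurable_fun setT tau by exact: measurable_threshold_time.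
  have := emeasurable_fun_o_infty measurableT mt (s m)%:E.
  by rewrite setTI.
have FE : [set o | ((theta + r)%:E < tau o)%E] = \bigcup_m F m.
  apply/seteqP; split=> [ o|o [m _]] /=; rewrite /F /=; last first.
    by apply: lt_trans; rewrite lte_fin /s ltrDl invr_gt0.
  have [t [tE _ _]] := threshold_time_bounds o.
  rewrite /tau tE lte_fin => rt.
  have tr0 : 0 < t - (theta + r) by rewrite subr_gt0.
  have /filter_ex[m am] := even_mesh_near 0 1 tr0.
  exists m => //=; rewrite /F /= /tau tE lte_fin /s.
  by rewrite -ltrBrDl; move: am; rewrite subr0 div1r.
have mU : measurable (\bigcup_m F m) by apply: bigcup_measurable.
rewrite FE; split=> //.
have ndF : nondecreasing_seq F.
  move=> m k mk; apply/subsetPset => o; rewrite /F /=; apply: le_lt_trans.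
  by rewrite lee_fin lerD2l lef_pV2 ?posrE// ler_nat.
have cF := @nondecreasing_cvg_mu _ _ _ P F mF mU ndF.
rewrite -(cvg_lim _ cF)//; apply: lime_le; first by apply/cvg_ex; eexists; exact: cF.
near=> m => /=.
have s0 : theta <= s m by rewrite /s -addrA lerDl addr_ge0.
(* Past the horizon [F m] is empty, because the threshold time is capped at [T]. *)
have [Ts|sT] := ltP T (s m).
  rewrite (_ : F m = set0) ?measure0//.
  apply/seteqP; split=> // o; rewrite /F /=.
  have [t [tE _ tT]] := threshold_time_bounds o.
  by rewrite /tau tE lte_fin => st; have := lt_trans Ts (lt_le_trans st tT); rewrite ltxx.
have gs : 1 + delta < g (s m - theta).
  have : (generalized_inverse g (1 + delta) < (s m - theta)%:E)%E.
    rewrite -/delay dr lte_fin /s.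
    have -> : theta + r + m.+1%:R^-1 - theta = r + m.+1%:R^-1 by ring.
    by rewrite ltrDl invr_gt0.
  move=> /ereal_inf_lt[_ [x /= gx <-]]; rewrite lte_fin => xs.
  exact: le_lt_trans gx (g_inc xs).
have s0' : 0 <= s m by exact: le_trans s0.
apply: le_trans (missed_rate s0 sT gs); apply: le_measure; rewrite ?inE//.
  rewrite (_ : mkset _ = ~` [set o | alpha < rate (s m) o]).
    by apply: measurableC; exact: measurable_rate_gt.
  by apply/seteqP; split=> o /=; rewrite leNgt => /negP.
move=> o; rewrite /F /= => st; rewrite leNgt; apply/negP => rs.
by move: st; rewrite ltNge threshold_time_le.
Unshelve. all: by end_near. Qed.

Lemma on_time_ge :
  ((1 - missed)%:E <= P [set o | (maxe (tau o - theta%:E) 0 <= delay)%E])%E.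
Proof.
(* The delay is +oo when [g] stays below [1 + delta]; the event is then the whole space. *)
have := delay_ge0; case dE : delay => [r| |] r0 //; last first.
  rewrite (_ : mkset _ = setT); first by rewrite probability_setT lee_fin gerBl.
  by apply/seteqP; split=> // o _; exact: leey.
have [mL PL] := late_le dE.
rewrite (_ : mkset _ = ~` [set o | ((theta + r)%:E < tau o)%E]); last first.
  have E o : (maxe (tau o - theta%:E) 0 <= r%:E)%E = ~~ ((theta + r)%:E < tau o)%E.
    have [t [tE _ _]] := threshold_time_bounds o.
    by rewrite /tau tE -EFinB ge_max r0 andbT lee_fin lte_fin -leNgt lerBlDl.
  by apply/seteqP; split=> o /=; rewrite E => /negP.
by rewrite probability_setC// EFinB leeB.
Qed.

Lemma integral_cst_indic_le (r x : R) (A : set Omega) (f : Omega -> R) :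
  0 <= r -> 0 <= x -> measurable A -> measurable_fun setT f ->
  (forall o, 0 <= f o <= r + x * \1_A o) ->
  (\int[P]_o (f o)%:E <= r%:E + x%:E * P A)%E.
Proof.
move=> r0 x0 mA mf fr.
have mi : measurable_fun setT (fun o => x * \1_A o).
  by apply: measurable_funM; [exact: measurable_cst|exact: measurable_indic].
have -> : (r%:E + x%:E * P A = \int[P]_o (r%:E + (x * \1_A o)%:E))%E.
  rewrite ge0_integralD//; last 2 first.
  - by move=> o _; rewrite lee_fin mulr_ge0.
  - exact/measurable_EFinP.
  rewrite (integral_cst P measurableT r%:E) [X in (_ * X + _)%E](probability_setT P) mule1.
  congr (_ + _)%E.
  under eq_integral do rewrite EFinM.
  rewrite ge0_integralZl_EFin//; last by apply/measurable_EFinP; exact: measurable_indic.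
  by rewrite integral_indic// setIT.
apply: ge0_le_integral => //.
- by move=> o _; rewrite lee_fin; have /andP[] := fr o.
- exact/measurable_EFinP.
- apply/measurable_EFinP; apply: measurable_funD => //; exact: measurable_cst.
- by move=> o _; rewrite -EFinD lee_fin; have /andP[] := fr o.
Qed.

Lemma measurable_fine_threshold_time : measurable_fun setT (fun o => fine (tau o)).
Proof.
have mt : measurable_fun setT tau by exact: measurable_threshold_time.
exact: measurableT_comp (fine_measurable measurableT) mt.
Qed.

(** Pointwise, the delay is at most [r] off the late event and at most [r + T] on it. *)
Lemma expected_delay_le :
  (\int[P]_o maxe (tau o - theta%:E) 0 <= delay + (T * missed)%:E)%E.
Proof.
have := delay_ge0; case dE : delay => [r| |] r0 //; last exact: leey.
have [mL PL] := late_le dE.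
have fE o : maxe (tau o - theta%:E)%E 0%E = (Num.max (fine (tau o) - theta) 0)%:E.
  have [t [tE _ _]] := threshold_time_bounds o.
  by rewrite /tau tE -EFinB -EFin_max.
under eq_integral do rewrite fE.
apply: le_trans (integral_cst_indic_le (r := r) (x := T) _ T0 mL _ _) _ => //.
- apply: measurable_maxr; last exact: measurable_cst.
  by apply: measurable_funB; [exact: measurable_fine_threshold_time|exact: measurable_cst].
- move=> o; have [t [tE t0 tT]] := threshold_time_bounds o.
  rewrite le_max lexx orbT /= ge_max /tau tE /=.
  have T1 : 0 <= T * \1_[set o | ((theta + r)%:E < tau o)%E] o by rewrite mulr_ge0.
  rewrite (addr_ge0 r0 T1) andbT.
  have [late|ontime] := ltP (theta + r) t.
    rewrite indicE mem_set /=; last by rewrite /tau tE lte_fin.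
    by rewrite mulr1 lerBlDr (le_trans tT)// addrAC lerDr addr_ge0.
  by rewrite (@le_trans _ _ r)// ?lerDl// lerBlDl.
- by rewrite EFinM leeD2l// lee_wpmul2l.
Qed.

(** An early alarm costs at most theta <= T, so the argument for the delay applies with the union of
    the late and the early events. *)
Lemma expected_error_le :
  (\int[P]_o `|tau o - theta%:E| <= delay + (T * (missed + fa))%:E)%E.
Proof.
have := delay_ge0; case dE : delay => [r| |] r0 //; last exact: leey.
have [mL PL] := late_le dE; have PF := false_alarm_le.
have mF : measurable [set o | (tau o < theta%:E)%E] by exact: measurable_threshold_time_lt.
have fE o : `|tau o - theta%:E|%E = (`|fine (tau o) - theta|)%:E.
  by have [t [tE _ _]] := threshold_time_bounds o; rewrite /tau tE -EFinB abse_EFin.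
under eq_integral do rewrite fE.
apply: le_trans (integral_cst_indic_le (r := r) (x := T) _ T0 (measurableU _ _ mL mF) _ _) _ => //.
- apply: (measurableT_comp (@normr_measurable R setT)).
  by apply: measurable_funB; [exact: measurable_fine_threshold_time|exact: measurable_cst].
- move=> o; have [t [tE t0 tT]] := threshold_time_bounds o.
  rewrite normr_ge0 /= /tau tE /=.
  have [late|ontime] := ltP (theta + r) t.
    rewrite indicE mem_set /=; last by left; rewrite /= tE lte_fin.
    rewrite mulr1 ger0_norm; first by rewrite lerBlDr (le_trans tT)// addrAC lerDr addr_ge0.
    by rewrite subr_ge0 (le_trans _ (ltW late))// lerDl.
  have [early|notearly] := ltP t theta.
    rewrite indicE mem_set /=; last by right; rewrite /= tE lte_fin.
    rewrite mulr1 ltr0_norm ?subr_lt0// opprB lerBlDr (le_trans thetaT)//.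
    by rewrite addrAC lerDr addr_ge0.
  rewrite ger0_norm ?subr_ge0// (@le_trans _ _ r)// ?lerDl ?mulr_ge0//.
  by rewrite lerBlDl.
- rewrite EFinM leeD2l// lee_wpmul2l//.
  apply: (@le_trans _ _ (P [set o | ((theta + r)%:E < tau o)%E] +
    P [set o | (tau o < theta%:E)%E])%E); first exact: measureU2.
  by rewrite [leRHS]EFinD leeD.
Qed.

End ThresholdTime.

(** * The observed path before the change-point *)

Section PreChange.
Variables (R : realType) (d : nat) (p T : R).
Let N := Num.truncn p.

(** At u = theta the second branch is taken, but there the increment of [X2] over a trivial interval
    is the unit. This end point matters: false alarms are controlled by the rate at time theta
    itself. *)
Lemma concatenation_prechange (X1 X2 : R -> tseries R d) theta u :
  geometric_rough_path p T X1 -> geometric_rough_path p T X2 ->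
  theta <= T -> 0 <= u -> u <= theta ->
  concatenation N theta X1 X2 u = X1 u.
Proof.
move=> G1 G2 thT u0; rewrite le_eqVlt => ut.
have uT : u <= T by rewrite (le_trans _ thT)// le_eqVlt.
have X10 : X1 0 = tone by case: G1 => -[[]].
have incrE : incr N X1 0 u = X1 u.
  apply/funext => w; have [wN|Nw] := leqP (size w) N; first exact: incr0 X10 wN.
  by rewrite /incr /ttrunc leqNgt Nw (rough_path_long G1 u0 uT Nw).
rewrite /concatenation; move: ut => /predU1P[<-|->]; last exact: incrE.
rewrite ltxx incrE; apply/funext => w.
have [wN|Nw] := leqP (size w) N; last first.
  by rewrite /ttrunc leqNgt Nw (rough_path_long G1 u0 uT Nw).
rewrite ttrunc_le// -[RHS](congr1 (@^~ w) (tmul1r (X1 u))).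
apply: (@eq_tmul_le _ _ N) => // v vN; rewrite /incr ttrunc_le//.
by rewrite tmulVl// (rough_path_nil G2 u0 uT).
Qed.

Lemma eq_step_product_euler (m : nat) (X X' : R -> tseries R d) t n k :
  0 <= t -> (forall u, 0 <= u -> u <= t -> X u = X' u) -> (k <= n.+1)%N ->
  step_product (euler_step m X) t n k = step_product (euler_step m X') t n k.
Proof.
move=> t0 XX'; elim: k => [//|k IH] kn /=; rewrite IH 1?ltnW//; congr tmul.
apply/funext => w; rewrite /euler_step /incr !XX'//.
- exact: even_point_ge.
- exact: even_point_le.
- exact: even_point_ge.
- exact: even_point_le t0 (ltnW kn).
Qed.

Lemma eq_approx_running_sup (l : dual_tensor R d.+1) (X X' : R -> tseries R d) t :
  0 <= t -> (forall u, 0 <= u -> u <= t -> X u = X' u) ->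
  approx_running_sup p l X t = approx_running_sup p l X' t.
Proof.
move=> t0 XX'; rewrite /approx_running_sup; congr (esups _ 0%N).
apply/funext => k; congr limn_esup; apply/funext => n.
rewrite (@eq_step_product_euler _ X X')//; first by rewrite mulr_ge0// unit_ratio_ge0.
by move=> u u0 ut; apply: XX' => //; rewrite (le_trans ut)// ler_piMr// unit_ratio_le1.
Qed.

Lemma running_sup_mono (l : dual_tensor R d) (Z : R -> tseries R d) s t :
  s <= t -> (running_sup l Z s <= running_sup l Z t)%E.
Proof.
move=> st; apply: ereal_sup_le => _ [u + <-]; rewrite /= in_itv/= => /andP[u0 us].
by exists u => //; rewrite /= in_itv/= u0 (le_trans us).
Qed.

Hypotheses (p1 : 1 <= p) (T0 : 0 < T).
Local Notation G := (geometric_rough_path p T : set (rough_space R d p T)).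

Lemma mseries_rough_path s : 0 <= s -> s <= T ->
  mseries G (fun X : rough_space R d p T => (X : R -> tseries R d) s).
Proof. by move=> s0 sT w; exact: measurable_evaluation. Qed.

Lemma mseries_rough_concatenation theta s : 0 <= theta -> theta <= T ->
  0 <= s -> s <= T ->
  mseries (G `*` G) (fun X : rough_space R d p T * rough_space R d p T =>
    concatenation N theta X.1 X.2 s).
Proof.
move=> th0 thT s0 sT; have mG := @measurable_geometric_rough_path R d p T.
have m1 u : 0 <= u -> u <= T -> mseries (G `*` G)
    (fun X : rough_space R d p T * rough_space R d p T => (X.1 : R -> tseries R d) u).
  move=> u0 uT w; apply: (measurable_comp _ _ (mseries_rough_path u0 uT w)) => //.
    by move=> _ [X [GX _] <-].
  exact: measurable_funTS measurable_fst.
have m2 u : 0 <= u -> u <= T -> mseries (G `*` G)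
    (fun X : rough_space R d p T * rough_space R d p T => (X.2 : R -> tseries R d) u).
  move=> u0 uT w; apply: (measurable_comp _ _ (mseries_rough_path u0 uT w)) => //.
    by move=> _ [X [_ GX] <-].
  exact: measurable_funTS measurable_snd.
apply: (@mseries_concatenation _ _ _ (G `*` G) d N theta
  (fun X => X.1 : R -> tseries R d) (fun X => X.2 : R -> tseries R d) s).
- exact: m1 (ltW T0).
- exact: m1.
- exact: m1.
- exact: m2.
- exact: m2.
Qed.

End PreChange.

Theorem proposition4p4 (R : realType)
  (c : R -> R -> R -> R)
  (d : nat) (p T : R) (hd : (0 < d)%N) (hp : 1 <= p) (hT : 0 < T)
  (disp : measure_display) (Omega : measurableType disp)
  (P : probability Omega R)
  (* the pair (X^(1), X^(2)) *)
  (X1 X2 : {RV P >-> rough_space R d p T})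
  (hX1 : forall o, geometric_rough_path p T (X1 o))
  (hX2 : forall o, geometric_rough_path p T (X2 o))
  (hindep : independent2 P X1 X2)
  (hlaws : ~ same_law P X1 X2)
  (q M : R) (g : R -> R)
  (hq : 1 < q) (hM : 0 < M)
  (hg : {homo g : x y / x < y}) (hg0 : g 0 = 0)
  (hmoment :
    (maxe (\int[P]_o (holder_norm (Num.truncn p) p T (X2 o) `^ q))
          (\int[P]_o (holder_norm (Num.truncn p) p T (X1 o) `^ q))
       <= M%:E)%E)
  (hgap : forall s t : R, 0 <= s -> s < t -> t <= T ->
    (\int[P]_o pvar_dist (Num.truncn p) p s t (X2 o) (X1 o)
       >= (g `|t - s|)%:E)%E)
  (eps delta theta : R)
  (hdelta : 0 < delta < 1) (heps : 0 < eps < 2^-1) (htheta : 0 <= theta <= T)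
  (* signatures of the augmentations of X^(1) and of the observed path *)
  (Z1 Z : Omega -> R -> tseries R d.+1)
  (hZ1 : forall o, augmented_signature p T (X1 o) (Z1 o))
  (hZ : forall o, augmented_signature p T
    (concatenation (Num.truncn p) theta (X1 o) (X2 o)) (Z o))
  (l : dual_tensor R d.+1)
  (hl : detector_coefficient P T q M (c T p q) g eps delta theta Z1 Z l)
  (* n independent copies and the signatures of the n observed paths *)
  (n : nat) (hn : (0 < n)%N)
  (Y1 Y2 : 'I_n -> {RV P >-> rough_space R d p T})
  (hY1 : forall i o, geometric_rough_path p T (Y1 i o))
  (hY2 : forall i o, geometric_rough_path p T (Y2 i o))
  (hcopy : forall i,
    same_law P (fun o => (Y1 i o, Y2 i o)) (fun o => (X1 o, X2 o)))
  (hcopies : mutually_independent P (fun i o => (Y1 i o, Y2 i o)))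
  (W : 'I_n -> Omega -> R -> tseries R d.+1)
  (hW : forall i o, augmented_signature p T
    (concatenation (Num.truncn p) theta (Y1 i o) (Y2 i o)) (W i o))
  (alpha : R) (halpha : eps < alpha < 1 - eps) :
  let tau := detection_time T alpha l W in
  let missed := expR (- 2 * n%:R * (1 - eps - alpha) ^+ 2) in
  let false_alarm := expR (- 2 * n%:R * (alpha - eps) ^+ 2) in
  let delay := generalized_inverse g (1 + delta) in
  [/\ (P [set o | maxe (tau o - theta%:E) 0 <= delay] >= (1 - missed)%:E)%E,
      (P [set o | tau o < theta%:E] <= false_alarm%:E)%E,
      (\int[P]_o maxe (tau o - theta%:E) 0 <= delay + (T * missed)%:E)%E &
      (\int[P]_o `|tau o - theta%:E|
         <= delay + (T * (missed + false_alarm))%:E)%E].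
Proof.
move=> tau missed false_alarm delay.
have T0 := ltW hT; have p0 : 0 < p by exact: lt_le_trans hp.
have /andP[delta0 delta1] := hdelta; have /andP[th0 thT] := htheta.
have /andP[ea ae] := halpha.
have [hl1 hl2 _] := hl.
pose N := Num.truncn p; pose E := rough_space R d p T.
pose G : set E := geometric_rough_path p T.
have mG : measurable G := @measurable_geometric_rough_path R d p T.
have mGG : measurable (G `*` G) by exact: measurableX.
pose Phi t (x : E * E) := approx_running_sup p l (concatenation N theta x.1 x.2) t.
have mPhi t : 0 <= t -> t <= T -> measurable_fun (G `*` G) (Phi t).
  move=> t0 tT; apply: (@measurable_approx_running_sup R d p T) => // s s0 sT.
  exact: mseries_rough_concatenation.
(* [Phi t] is known to be measurable only on rough paths, so events are intersected with [G] times
   [G]; all the pairs considered lie there, so the preimages are unchanged. *)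
pose C t : set (E * E) := (G `*` G) `&` [set x | (1 < Phi t x)%E].
have mC t : 0 <= t -> t <= T -> measurable (C t).
  by move=> t0 tT; exact: emeasurable_fun_o_infty mGG (mPhi t t0 tT) 1%E.
have mY i : measurable_fun setT (fun o => (Y1 i o, Y2 i o)).
  by apply: measurable_fun_pair; exact: measurable_funPT.
have mX : measurable_fun setT (fun o => (X1 o, X2 o)).
  by apply: measurable_fun_pair; exact: measurable_funPT.
have WE i o t : 0 <= t -> t <= T -> running_sup l (W i o) t = Phi t (Y1 i o, Y2 i o).
  by move=> t0 tT; apply: (running_supE (T := T)) => //; exact: hW.
have ZE o t : 0 <= t -> t <= T -> running_sup l (Z o) t = Phi t (X1 o, X2 o).
  by move=> t0 tT; apply: (running_supE (T := T)) => //; exact: hZ.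
have WC i t : 0 <= t -> t <= T -> [set o | (1 < running_sup l (W i o) t)%E] =
    (fun o => (Y1 i o, Y2 i o)) @^-1` C t.
  move=> t0 tT; apply/seteqP; split=> o /=; rewrite WE//.
    by move=> Ph; split=> //; split; [exact: hY1|exact: hY2].
  by case.
pose freq (A : set (E * E)) o : R :=
  \sum_(i < n) \1_((fun o => (Y1 i o, Y2 i o)) @^-1` A) o.
have mYA i A : measurable A -> measurable ((fun o => (Y1 i o, Y2 i o)) @^-1` A).
  by move=> mA; rewrite -[_ @^-1` _]setTI; exact: mY.
have mfreq A : measurable A -> measurable_fun setT (freq A).
  by move=> mA; apply: measurable_sum => i; apply: measurable_indic; exact: mYA.
have n0 : 0 < n%:R :> R by rewrite ltr0n.
pose rate t o := exceedance_rate l W t o.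
have rateE t o : 0 <= t -> t <= T -> rate t o = n%:R^-1 * freq (C t) o.
  move=> t0 tT; rewrite /rate /exceedance_rate; congr (_ * _).
  by apply: eq_bigr => i _; rewrite WC.
have rate_mono o s t : 0 <= s -> s <= t -> t <= T -> rate s o <= rate t o.
  move=> s0 st tT; rewrite /rate /exceedance_rate ler_wpM2l ?invr_ge0//.
  apply: ler_sum => i _; rewrite !indicE ler_nat.
  case: (boolP (o \in _)) => // /set_mem /= so; rewrite mem_set//=.
  exact: lt_le_trans so (running_sup_mono _ _ st).
have rate_meas t : 0 <= t -> t <= T -> measurable_fun setT (rate t).
  move=> t0 tT; apply: (eq_measurable_fun (fun o => n%:R^-1 * freq (C t) o)).
    by move=> o _; rewrite rateE.
  by apply: measurable_funM; [exact: measurable_cst|apply: mfreq; exact: mC].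
pose pi t := fine (P ((fun o => (X1 o, X2 o)) @^-1` C t)).
have mXA A : measurable A -> measurable ((fun o => (X1 o, X2 o)) @^-1` A).
  by move=> mA; rewrite -[_ @^-1` _]setTI; exact: mX.
have piE t : 0 <= t -> t <= T -> P ((fun o => (X1 o, X2 o)) @^-1` C t) = (pi t)%:E.
  by move=> t0 tT; rewrite fineK// fin_num_measure//; apply: mXA; exact: mC.
have PYC i t : 0 <= t -> t <= T -> P ((fun o => (Y1 i o, Y2 i o)) @^-1` C t) = (pi t)%:E.
  by move=> t0 tT; rewrite -(piE t t0 tT); exact: hcopy (mC t t0 tT).
have missed_rate t : theta <= t -> t <= T -> 1 + delta < g (t - theta) ->
    (P [set o | (rate t o <= alpha)%R] <= missed%:E)%E.
  move=> tht tT gt; have t0 : 0 <= t by exact: le_trans tht.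
  have pi_ge : 1 - eps <= pi t.
    rewrite -lee_fin -piE//; apply: le_trans (hl2 t _) _; first by rewrite t0 tT.
    have tE : [set o | ((g (Num.max (t - theta) 0) - delta)%:E <= running_sup l (Z o) t)%E] =
        (fun o => (X1 o, X2 o)) @^-1`
          ((G `*` G) `&` [set x | ((g (Num.max (t - theta) 0) - delta)%:E <= Phi t x)%E]).
      apply/seteqP; split=> o /=; rewrite ZE//; last by case.
      by move=> Ph; split=> //; split; [exact: hX1|exact: hX2].
    rewrite tE; apply: le_measure; rewrite ?inE.
    - by apply: mXA; exact: emeasurable_fun_c_infty mGG (mPhi t t0 tT) _.
    - by apply: mXA; exact: mC.
    (* The detector guarantees g - delta, and g > 1 + delta turns this into a strict excess over
       1. *)
    move=> o [Go /= Pho]; split=> //=; apply: lt_le_trans Pho; rewrite lte_fin.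
    by rewrite max_l ?subr_ge0// ltrBrDr.
  (* A lower tail for [C t] is an upper tail for its complement, at level 1 - alpha and with
     parameter 1 - pi t. *)
  have freqC o : freq (~` C t) o = n%:R - freq (C t) o.
    apply/eqP; rewrite eq_sym subr_eq; apply/eqP; rewrite /freq -big_split /=.
    rewrite -[LHS]mulr1 -[n in LHS]card_ord mulr_natl -sumr_const; apply: eq_bigr => i _.
    rewrite !indicE -preimage_setC in_setC.
    by case: (_ \in _); rewrite ?addr0 ?add0r.
  have PYCC i : P ((fun o => (Y1 i o, Y2 i o)) @^-1` (~` C t)) = (1 - pi t)%:E.
    by rewrite -preimage_setC probability_setC ?PYC// -?EFinB//; apply: mYA; exact: mC.
  rewrite (_ : mkset _ = [set o | n%:R * (1 - alpha) <= freq (~` C t) o]); last first.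
    apply/seteqP; split=> o /=; rewrite rateE// freqC ler_pdivrMl// mulrBr mulr1.
      by rewrite lerD2l lerN2.
    by rewrite lerD2l lerN2.
  apply: le_trans (frequency_upper_tail mY hcopies _ PYCC _) _.
  - by apply: measurableC; exact: mC.
  - by rewrite lerD2l lerN2 (le_trans (ltW ae)).
  rewrite lee_fin; apply: hoeffding_bound_le; first by rewrite subr_ge0 ltW.
  have -> : 1 - alpha - (1 - pi t) = pi t - alpha by ring.
  by rewrite lerD2r.
have false_alarm_rate : (P [set o | (alpha < rate theta o)%R] <= false_alarm%:E)%E.
  have pi_le : pi theta <= eps.
    have Z1E o t : 0 <= t -> t <= T -> running_sup l (Z1 o) t = approx_running_sup p l (X1 o) t.
      by move=> t0 tT; apply: (running_supE (T := T)) => //; exact: hZ1.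
    have ZZ1 o : running_sup l (Z o) theta = running_sup l (Z1 o) theta.
      rewrite (ZE o theta th0 thT) (Z1E o theta th0 thT) /Phi.
      apply: eq_approx_running_sup => // u u0 ut.
      exact: concatenation_prechange (hX1 o) (hX2 o) thT u0 ut.
    have mlow : measurable [set o | (running_sup l (Z1 o) T <= delta%:E)%E].
      have mf : measurable_fun G (fun X : E => approx_running_sup p l X T).
        apply: (@measurable_approx_running_sup R d p T) => // s s0 sT.
        exact: mseries_rough_path.
      have m1 := emeasurable_fun_infty_c mG mf delta%:E.
      rewrite (_ : mkset _ = X1 @^-1`
        (G `&` [set X : E | (approx_running_sup p l X T <= delta%:E)%E])).
        exact: measurable_funPTI.
      apply/seteqP; split=> o /=; rewrite Z1E//; last by case.
      by move=> Ph; split=> //; exact: hX1.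
    rewrite -lee_fin -piE//.
    apply: (@le_trans _ _ (P (~` [set o | (running_sup l (Z1 o) T <= delta%:E)%E]))).
      apply: le_measure; rewrite ?inE.
      - by apply: mXA; exact: mC.
      - exact: measurableC.
      (* An excess over 1 at time theta is an excess over delta < 1 for the pre-change path, and it
         persists up to [T], where the detector bounds its probability by eps. *)
      move=> o [Go /=]; rewrite -ZE// ZZ1 => h1; apply/negP; rewrite -ltNge.
      apply: lt_le_trans (running_sup_mono _ _ thT); apply: lt_trans h1.
      by rewrite lte_fin.
    rewrite probability_setC//.
    have -> : eps%:E = (1%:E - (1 - eps)%:E)%E by rewrite -EFinB; congr EFin; ring.
    exact: leeB.
  apply: (@le_trans _ _ (P [set o | (n%:R * alpha <= freq (C theta) o)%R])).
    apply: le_measure; rewrite ?inE.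
    - exact: (measurable_rate_gt _ rate_meas th0 thT).
    - by apply: measurable_ge; apply: mfreq; exact: mC.
    by move=> o /=; rewrite rateE// ltr_pdivlMl// => /ltW.
  apply: le_trans (frequency_upper_tail mY hcopies (mC _ th0 thT) (fun i => PYC i _ th0 thT) _) _.
    by rewrite (le_trans pi_le)// ltW.
  rewrite lee_fin; apply: hoeffding_bound_le; first by rewrite subr_ge0 ltW.
  by rewrite lerD2l lerN2.
have missed0 : 0 <= missed by exact: expR_ge0.
split.
- exact: (on_time_ge T0 rate_mono rate_meas hg hg0 delta0 th0 missed0 missed_rate).
- exact: (false_alarm_le rate_mono rate_meas th0 thT false_alarm_rate).
- exact: (expected_delay_le T0 rate_mono rate_meas hg hg0 delta0 th0 missed0 missed_rate).
- exact: (expected_error_le T0 rate_mono rate_meas hg hg0 delta0 th0 thT missed0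
    false_alarm_rate missed_rate).
Qed.
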